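(* Fix $\sigma>1$, and for $\tau>0$ let $M_p^{\tau,\sigma}=p^{\tau p^\sigma}$ for $p\in\mathbb N$, $M_0^{\tau,\sigma}=1$, and let $\mathcal M_\sigma=\{(M_p^{\tau,\sigma})_{p\in\mathbb N_0}:\tau>0\}$. Then, both in the Roumieu case ($[\,\cdot\,]=\{\,\cdot\,\}$ throughout) and in the Beurling case ($[\,\cdot\,]=(\,\cdot\,)$ throughout): 1. $\mathcal S_{[\mathcal M_\sigma]}^{[\mathcal M_\sigma]}(\mathbb R^n)=\mathcal S_{[\mathcal W_\sigma]}^{[\mathcal M_\sigma]}(\mathbb R^n)$; 2. $\mathcal S_{[\mathcal W_\sigma]}^{[\mathcal M_\sigma]}(\mathbb R^n)$ is a nuclear space.
   Context: All spaces consist of functions $\varphi\in C^\infty(\mathbb R^n)$; $\alpha,\beta$ denote multi-indices in $\mathbb N_0^n$. - $\varphi\in\mathcal S_{\{\mathcal M_\sigma\}}^{\{\mathcal M_\sigma\}}(\mathbb R^n)$ iff $(\exists\tau>0)(\exists C>0)(\forall\alpha,\beta)\ \sup_{x\in\mathbb R^n}|x^\alpha\partial^\beta\varphi(x)|\le C M^{\tau,\sigma}_{|\alpha|}M^{\tau,\sigma}_{|\beta|}$. - $\varphi\in\mathcal S_{(\mathcal M_\sigma)}^{(\mathcal M_\sigma)}(\mathbb R^n)$ iff $(\forall\tau>0)(\exists C>0)(\forall\alpha,\beta)\ \sup_{x\in\mathbb R^n}|x^\alpha\partial^\beta\varphi(x)|\le C M^{\tau,\sigma}_{|\alpha|}M^{\tau,\sigma}_{|\beta|}$.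 The associated function of the sequence $(M_p^{\tau,\sigma})_p$ is $T_{\tau,\sigma}(r)=\sup_{p\in\mathbb N_0}\ln\frac{r^p}{M_p^{\tau,\sigma}}$ for $r>0$, and $T_{\tau,\sigma}(0)=0$. The weight family is $\mathcal W_\sigma=\{(w^\tau(x)=e^{T_{\tau,\sigma}(|x|)})_{x\in\mathbb R^n}:\tau>0\}$. - $\varphi\in\mathcal S_{\{\mathcal W_\sigma\}}^{\{\mathcal M_\sigma\}}(\mathbb R^n)$ iff $(\exists\tau>0)(\exists C>0)(\forall\beta)\ \sup_{x\in\mathbb R^n}|e^{T_{\tau,\sigma}(|x|)}\partial^\beta\varphi(x)|\le C M^{\tau,\sigma}_{|\beta|}$. - $\varphi\in\mathcal S_{(\mathcal W_\sigma)}^{(\mathcal M_\sigma)}(\mathbb R^n)$ iff $(\forall\tau>0)(\exists C>0)(\forall\beta)\ \sup_{x\in\mathbb R^n}|e^{T_{\tau,\sigma}(|x|)}\partial^\beta\varphi(x)|\le C M^{\tau,\sigma}_{|\beta|}$. Topology: for $\tau>0$ let $X_\tau$ be the Banach space of all $\varphi\in C^\infty(\mathbb R^n)$ with $\|\varphi\|_\tau=\sup_{\beta\in\mathbb N_0^n}\sup_{x\in\mathbb R^n}\frac{e^{T_{\tau,\sigma}(|x|)}|\partial^\beta\varphi(x)|}{M^{\tau,\sigma}_{|\beta|}}<\infty$. The Beurling space $\mathcal S_{(\mathcal W_\sigma)}^{(\mathcal M_\sigma)}(\mathbb R^n)=\bigcap_{\tau>0}X_\tau$ carries the projective limit locally convex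 topology (as $\tau\to0^+$), and the Roumieu space $\mathcal S_{\{\mathcal W_\sigma\}}^{\{\mathcal M_\sigma\}}(\mathbb R^n)=\bigcup_{\tau>0}X_\tau$ carries the locally convex inductive limit topology (as $\tau\to\infty$). Nuclear means nuclear as a locally convex space. The equality in item 1 is equality of spaces of functions. *)

(* Defs.v *)
From HB Require Import structures.
From mathcomp Require Import all_boot all_order all_algebra.
From mathcomp Require Import all_classical all_reals all_analysis.
From mathcomp.real_closed Require Import complex.
Import numFieldNormedType.Exports.

Set Implicit Arguments.
Unset Strict Implicit.
Unset Printing Implicit Defensive.

Import Order.TTheory GRing.Theory Num.Theory.

Local Open Scope classical_set_scope.
Local Open Scope ring_scope.

Record seminorm (K : numFieldType) (E : lmodType K) := Seminorm {
  seminorm_fun :> E -> K ;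
  seminormD : forall x y,
    seminorm_fun (x + y) <= seminorm_fun x + seminorm_fun y ;
  seminormZ : forall a x, seminorm_fun (a *: x) = `|a| * seminorm_fun x }.

HB.instance Definition _ (K : numFieldType) (E : lmodType K) :=
  gen_eqMixin (seminorm E).

Section seminorm_theory.
Variables (K : numFieldType) (E : lmodType K) (p : seminorm E).

Lemma seminorm0 : p 0 = 0.
Proof. by rewrite -(scale0r 0) seminormZ normr0 mul0r. Qed.

Lemma seminormN x : p (- x) = p x.
Proof. by rewrite -scaleN1r seminormZ normrN1 mul1r. Qed.

Lemma seminorm_ge0 x : 0 <= p x.
Proof.
have := seminormD p x (- x).
by rewrite subrr seminorm0 seminormN -mulr2n pmulrn_lge0.
Qed.

End seminorm_theory.

(* The vector space [E] with the locally convex topology generated by a set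
   [P] of seminorms: finite intersections of the balls [p (y - x) < e] with
   [p] in [P] and [e > 0] form a neighbourhood base at [x]. *)
Definition lcs_of (K : numFieldType) (E : lmodType K) (P : set (seminorm E)) :
  Type := E.

Section lcs_of.
Variables (K : numFieldType) (E : lmodType K) (P : set (seminorm E)).
Local Notation L := (lcs_of P).

HB.instance Definition _ := GRing.Lmodule.on L.

Implicit Types (x y z : E) (A : set E) (s : seq (seminorm E * K)).

Let valid s := all (fun pe => (pe.1 \in P) && (0 < pe.2)) s.
Let sball s x : set E :=
  [set y | all (fun pe : seminorm E * K => pe.1 (y - x) < pe.2) s].

Definition lcs_nbhs (x : L) : set_system L :=
  [set A | exists s : seq (seminorm E * K),
    all (fun pe => (pe.1 \in P) && (0 < pe.2)) s /\
    [set y : L | all (fun pe : seminorm E * K => pe.1 (y - x) < pe.2) s]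
      `<=` A].

HB.instance Definition _ := hasNbhs.Build L lcs_nbhs.

Let sball_center s x : valid s -> sball s x x.
Proof.
move=> vs; apply: sub_all vs => -[p e] /andP[_ e0] /=.
by rewrite subrr seminorm0.
Qed.

Let sball_nbhs s x y : valid s -> sball s x y -> nbhs (y : L) (sball s x).
Proof.
move=> vs xy.
exists [seq (pe.1, pe.2 - (pe.1 : seminorm E) (y - x)) | pe <- s]; split.
  rewrite all_map; apply/allP => -[p e] /= pes.
  move/allP: vs => /(_ _ pes) /= /andP[-> _] /=.
  by rewrite subr_gt0; move/allP: xy => /(_ _ pes).
move=> z; rewrite /= all_map; apply: sub_all => -[p e] /=.
rewrite ltrBrDr; apply: le_lt_trans.
by rewrite (le_trans _ (seminormD p _ _))// addrA subrK.
Qed.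

Let nbhs_filter (x : L) : ProperFilter (nbhs x).
Proof.
split.
  by move=> [s [vs /(_ x)]]; apply; exact: sball_center.
split.
- by exists [::]; split.
- move=> A B [s [vs sA]] [t [vt tB]]; exists (s ++ t); split.
    by rewrite all_cat vs vt.
  by move=> y /=; rewrite all_cat => /andP[/sA ? /tB ?].
- by move=> A B AB [s [vs sA]]; exists s; split=> // y /sA /AB.
Qed.

Let nbhs_singleton (x : L) (A : set L) : nbhs x A -> A x.
Proof. by move=> [s [vs]]; apply; exact: sball_center. Qed.

Let nbhs_nbhs (x : L) (A : set L) : nbhs x A -> nbhs x (nbhs^~ A).
Proof.
move=> [s [vs sA]]; exists s; split=> // y xy.
have [t [vt tB]] := sball_nbhs vs xy.
by exists t; split=> // z /tB /sA.
Qed.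

HB.instance Definition _ :=
  Nbhs_isNbhsTopological.Build L nbhs_filter nbhs_singleton nbhs_nbhs.

Let lcs_basis (x : L) (p : seminorm E) e :
  P p -> 0 < e -> nbhs x [set y : L | p (y - x) < e].
Proof.
move=> Pp e0; exists [:: (p, e)]; split; first by rewrite /= mem_set// e0.
by move=> y /= /andP[].
Qed.

Let near_all (T : Type) (F : set_system T) (FF : Filter F) (I : Type)
    (Q : T -> I -> bool) (v : I -> bool) (s : seq I) :
  all v s -> (forall i, v i -> F [set t | Q t i]) -> F [set t | all (Q t) s].
Proof.
move=> + FQ; elim: s => [_|i s IH /= /andP[vi vs]]; first exact: filterE.
by apply: filterS2 (FQ _ vi) (IH vs) => t /= -> ->.
Qed.

Let lcs_add_continuous : continuous (fun x : L * L => x.1 + x.2).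
Proof.
move=> [x y] A [s [vs sA]]; apply: (filterS (P := fun z : L * L =>
  sball s (x + y) (z.1 + z.2))) => [z /sA//|].
apply: (near_all _ vs) => -[p e] /= /andP[/set_mem Pp e0].
have e20 : 0 < e / 2 by rewrite divr_gt0.
exists ([set u | p (u - x) < e / 2], [set v | p (v - y) < e / 2]).
  by split; exact: lcs_basis.
move=> [u v] /= [ux vy]; rewrite opprD addrACA (le_lt_trans (seminormD p _ _))//.
by rewrite [ltRHS]splitr ltrD.
Qed.

Let lcs_scale_continuous : continuous (fun z : K^o * L => z.1 *: z.2).
Proof.
move=> [a x] A [s [vs sA]]; apply: (filterS (P := fun z : K^o * L =>
  sball s (a *: x) (z.1 *: z.2))) => [z /sA//|].
apply: (near_all _ vs) => -[p e] /= /andP[/set_mem Pp e0].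
have e20 : 0 < e / 2 by rewrite divr_gt0.
have px : 0 < p x + 1 by rewrite ltr_wpDl// seminorm_ge0.
have a1 : 0 < `|a| + 1 by rewrite ltr_wpDl.
exists ([set b : K^o | `|a - b| < 1 /\ `|a - b| < e / 2 / (p x + 1)],
        [set v | p (v - x) < e / 2 / (`|a| + 1)]).
  split; last by apply: lcs_basis; rewrite // divr_gt0.
  have near_a d : 0 < d -> nbhs (a : K^o) [set b : K^o | `|a - b| < d].
    by move=> d0; apply/nbhs_normP; exists d.
  by apply: filterI; apply: near_a => //; rewrite divr_gt0.
move=> [b v] /= [[ab1 abe] vx].
have -> : b *: v - a *: x = b *: (v - x) + (b - a) *: x.
  by rewrite scalerBr scalerBl addrA subrK.
rewrite (le_lt_trans (seminormD p _ _))// !seminormZ.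
have b1 : `|b| <= `|a| + 1.
  rewrite -[b](subrK a) addrC (le_trans (ler_normD _ _))// lerD2l.
  by rewrite distrC ltW.
rewrite [ltRHS]splitr ler_ltD//.
- rewrite (le_trans (ler_wpM2r (seminorm_ge0 _ _) b1))//.
  by rewrite mulrC -ler_pdivlMr// ltW.
- rewrite distrC; have [->|b0] := eqVneq `|a - b| 0; first by rewrite mul0r.
  rewrite (@lt_trans _ _ (`|a - b| * (p x + 1)))//; last by rewrite -ltr_pdivlMr.
  by rewrite ltr_pM2l ?ltrDl// lt_neqAle eq_sym b0/=.
Qed.

Let lcs_locally_convex : exists2 B : set_system L,
  (forall b, b \in B -> convex_set b) & basis B.
Proof.
exists [set U | exists s x, valid s /\ U = sball s x].
  move=> _ /[!inE] -[s [x [vs ->]]] u v l /[!inE] xu xv.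
  apply/allP => -[p e] pes /=.
  have {}xu := allP xu _ pes; have {}xv := allP xv _ pes; simpl in xu, xv.
  have -> : (conv l u v : E) - x =
            l%:num *: ((u : E) - x) + (1 - l%:num) *: ((v : E) - x).
    rewrite !scalerBr addrACA -opprD -scalerDl.
    by rewrite (addrC l%:num) subrK scale1r.
  rewrite (le_lt_trans (seminormD p _ _))// !seminormZ.
  have l0 : 0 <= l%:num by [].
  have l1 : 0 <= (1 - l%:num) by rewrite subr_ge0.
  rewrite (ger0_norm l0) (ger0_norm l1) -[ltRHS]mul1r.
  rewrite -[in ltRHS](subrK l%:num 1) (addrC _ l%:num) [ltRHS]mulrDl.
  have [l00|l00] := eqVneq l%:num 0.
    by rewrite l00 !mul0r !add0r subr0 !mul1r.
  rewrite ltr_leD//; last by rewrite ler_wpM2l// ltW.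
  by rewrite ltr_pM2l// lt_neqAle eq_sym l00.
split.
  move=> _ [s [x [vs ->]]]; rewrite openE => y; exact: sball_nbhs.
move=> x A [s [vs sA]]; exists (sball s x) => //; split.
  by exists s, x.
exact: sball_center.
Qed.

HB.instance Definition _ := PreTopologicalLmod_isTvs.Build K L
  lcs_add_continuous lcs_scale_continuous lcs_locally_convex.
HB.instance Definition _ :=
  PreTopologicalNmodule_isTopologicalNmodule.Build L lcs_add_continuous.
HB.instance Definition _ :=
  TopologicalNmodule_isTopologicalLmodule.Build K L lcs_scale_continuous.
HB.instance Definition _ := Uniform_isTvs.Build K L lcs_locally_convex.

Definition lcs : tvsType K := lcs_of P.

End lcs_of.

Section nuclear.
Variable K : numFieldType.

(* [h] embeds the quotient of [E] by the kernel of [p], normed by [p], as a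
   dense subspace of the Banach space [B]: it makes [B] the completion of
   [(E / ker p, p)]. *)
Definition is_completion (E : lmodType K) (p : seminorm E)
    (B : completeNormedModType K) (h : {linear E -> B}) :=
  (forall x, `|h x| = p x) /\ dense (range h).

(* The functionals [f k] are in the closed unit ball of the dual of [B1], the
   [y k] are in the closed unit ball of [B2], and [lam] is absolutely summable;
   in particular [T] is bounded. *)
Definition nuclear_map (B1 B2 : completeNormedModType K)
    (T : {linear B1 -> B2}) :=
  exists (lam : nat -> K) (f : nat -> {linear B1 -> K^o}) (y : nat -> B2),
    [/\ cvgn (series (fun k => `|lam k|)),
        forall k x, `|f k x| <= `|x|,
        forall k, `|y k| <= 1 &
        forall x, series (fun k => (lam k * f k x) *: y k) @ \oo --> T x].

(* A Hausdorff locally convex space is nuclear if every continuous seminorm [p]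
   is dominated by a continuous seminorm [q] such that the canonical map from
   the completion for [q] to the completion for [p] is nuclear. Completions
   exist and are unique up to isometric isomorphism, so it does not matter
   which ones are taken. *)
Definition nuclear_space (E : tvsType K) :=
  hausdorff_space E /\
  forall p : seminorm E, continuous p ->
  exists q : seminorm E, [/\ continuous q, forall x, p x <= q x &
    forall (Bq Bp : completeNormedModType K)
           (hq : {linear E -> Bq}) (hp : {linear E -> Bp}),
      is_completion q hq -> is_completion p hp ->
      exists2 T : {linear Bq -> Bp},
        forall x, T (hq x) = hp x & nuclear_map T].

End nuclear.

Section smooth_functions.
Variables (R : realType) (n : nat).
Implicit Types (f g : 'rV[R]_n -> R) (phi psi : 'rV[R]_n -> R[i]).
Implicit Types (i : 'I_n) (s : seq 'I_n) (a b : {ffun 'I_n -> nat}).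

Definition euclid_norm (x : 'rV[R]_n) : R := Num.sqrt (\sum_i x 0 i ^+ 2).

Definition mabs a : nat := (\sum_i a i)%N.

Definition monom a (x : 'rV[R]_n) : R := \prod_i x 0 i ^+ a i.

Definition pderiv i f : 'rV[R]_n -> R := fun x => 'D_(delta_mx 0 i) f x.

Definition pderivs s f := foldr pderiv f s.

Definition smooth f := forall s, continuous (pderivs s f) /\
  forall i x, derivable (pderivs s f) x (delta_mx 0 i).

(* [R[i]] carries no normed [R]-module structure in the library, so derivatives
   of complex-valued functions are taken on real and imaginary parts. *)
Definition Rep phi : 'rV[R]_n -> R := fun x => complex.Re (phi x).
Definition Imp phi : 'rV[R]_n -> R := fun x => complex.Im (phi x).

Definition csmooth phi := smooth (Rep phi) /\ smooth (Imp phi).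

Definition cpderivs s phi : 'rV[R]_n -> R[i] :=
  fun x => Complex (pderivs s (Rep phi) x) (pderivs s (Imp phi) x).

(* The sequence [mindex_seq a] lists each coordinate [i] with multiplicity
   [a i], so that [mderiv a phi] is the partial derivative of order [a]. *)
Definition mindex_seq a : seq 'I_n :=
  flatten [seq nseq (a i) i | i <- enum 'I_n].

Definition mderiv a phi := cpderivs (mindex_seq a) phi.

Definition cabs (z : R[i]) : R := Normc.normc z.

End smooth_functions.

Section spaces.
Variables (R : realType) (n : nat) (sigma : R).
Local Notation V := ('rV[R]_n -> R[i]).
Local Notation mindex := {ffun 'I_n -> nat}.
Implicit Types (phi psi : V) (tau : R).

Definition Mseq tau (p : nat) : R :=
  if p is 0%N then 1 else p%:R `^ (tau * p%:R `^ sigma).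

(* The supremum is taken in the extended reals, where it always exists; it is
   finite when [sigma > 1] and [tau > 0]. *)
Definition Tfun tau (r : R) : \bar R :=
  if r == 0 then 0%E
  else ereal_sup (range (fun p : nat => (ln (r ^+ p / Mseq tau p))%:E)).

Definition weight tau (x : 'rV[R]_n) : \bar R :=
  expeR (Tfun tau (euclid_norm x)).

Definition bounded_MM tau phi := exists2 C : R, 0 < C &
  forall a b : mindex,
    (ereal_sup (range (fun x : 'rV[R]_n =>
       (cabs ((monom a x)%:C%C * mderiv b phi x))%:E)) <=
     (C * Mseq tau (mabs a) * Mseq tau (mabs b))%:E)%E.

Definition bounded_WM tau phi := exists2 C : R, 0 < C &
  forall b : mindex,
    (ereal_sup (range (fun x : 'rV[R]_n =>
       weight tau x * (cabs (mderiv b phi x))%:E)) <=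
     (C * Mseq tau (mabs b))%:E)%E.

Definition SMM_roumieu : set V :=
  [set phi | csmooth phi /\ exists2 tau : R, 0 < tau & bounded_MM tau phi].
Definition SMM_beurling : set V :=
  [set phi | csmooth phi /\ forall tau : R, 0 < tau -> bounded_MM tau phi].
Definition SWM_roumieu : set V :=
  [set phi | csmooth phi /\ exists2 tau : R, 0 < tau & bounded_WM tau phi].
Definition SWM_beurling : set V :=
  [set phi | csmooth phi /\ forall tau : R, 0 < tau -> bounded_WM tau phi].

Definition Xnorm tau phi : \bar R :=
  ereal_sup (range (fun bx : mindex * 'rV[R]_n =>
    weight tau bx.2 * (cabs (mderiv bx.1 phi bx.2) / Mseq tau (mabs bx.1))%:E)%E).

Definition Xspace tau : set V :=
  [set phi | csmooth phi /\ (Xnorm tau phi < +oo)%E].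

End spaces.

Arguments SMM_roumieu {R} n sigma.
Arguments SMM_beurling {R} n sigma.
Arguments SWM_roumieu {R} n sigma.
Arguments SWM_beurling {R} n sigma.

Section smooth_theory.
Variables (R : realType) (n : nat).
Implicit Types (f g : 'rV[R]_n -> R) (phi psi : 'rV[R]_n -> R[i]).
Implicit Types (s : seq 'I_n).

Lemma pderivs_lin a b f g s : smooth f -> smooth g ->
  pderivs s (fun x => a * f x + b * g x) =
  (fun x => a * pderivs s f x + b * pderivs s g x).
Proof.
move=> sf sg; elim: s => [//|i s IH] /=; apply/funext => x.
rewrite IH /pderiv.
have df := (sf s).2 i x; have dg := (sg s).2 i x.
have -> : (fun x => a * pderivs s f x + b * pderivs s g x) =
  (a \*: pderivs s f) + (b \*: pderivs s g) by [].
rewrite deriveD; [|exact: derivableZ|exact: derivableZ].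
by rewrite (deriveZ _ df) (deriveZ _ dg).
Qed.

Lemma smooth_lin a b f g : smooth f -> smooth g ->
  smooth (fun x => a * f x + b * g x).
Proof.
move=> sf sg s; rewrite pderivs_lin//; split=> [x|i x].
  apply: (@continuousD _ _ _ (fun x => a * pderivs s f x)
    (fun x => b * pderivs s g x));
  apply: (@continuousM _ _ (cst _)); try exact: cst_continuous.
    exact: (sf s).1.
  exact: (sg s).1.
have -> : (fun x => a * pderivs s f x + b * pderivs s g x) =
  (a \*: pderivs s f) + (b \*: pderivs s g) by [].
by apply: derivableD; apply: derivableZ; [exact: (sf s).2|exact: (sg s).2].
Qed.

Lemma cabs0 : cabs (0 : R[i]) = 0. Proof. exact: Normc.normc0. Qed.

Lemma cabs_ge0 (z : R[i]) : 0 <= cabs z.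
Proof. by case: z => a b; exact: sqrtr_ge0. Qed.

Lemma cabsD (z w : R[i]) : cabs (z + w) <= cabs z + cabs w.
Proof. exact: le_normcD. Qed.

Lemma cabsM (z w : R[i]) : cabs (z * w) = cabs z * cabs w.
Proof. exact: Normc.normcM. Qed.

Lemma normr_cabs (z : R[i]) : `|z| = (cabs z)%:C%C.
Proof. by []. Qed.

Lemma csmooth0 : csmooth (0 : 'rV[R]_n -> R[i]).
Proof.
have s0 : smooth (cst 0 : 'rV[R]_n -> R).
  have s0 s : pderivs s (cst 0 : 'rV[R]_n -> R) = cst 0.
    elim: s => [//|i s IH] /=; rewrite IH; apply/funext => x.
    exact: derive_cst.
  move=> s; rewrite s0; split=> [|i x]; first exact: cst_continuous.
  exact: derivable_cst.
by split.
Qed.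

Let RepE (c : R[i]) phi psi : Rep (c *: phi + psi) = fun x =>
  1 * (complex.Re c * Rep phi x + (- complex.Im c) * Imp phi x) + 1 * Rep psi x.
Proof.
apply/funext => x; rewrite /Rep /Imp !fctE /= !mul1r.
by case: c (phi x) (psi x) => [a b] [u v] [w z] /=; rewrite mulNr.
Qed.

Let ImpE (c : R[i]) phi psi : Imp (c *: phi + psi) = fun x =>
  1 * (complex.Re c * Imp phi x + complex.Im c * Rep phi x) + 1 * Imp psi x.
Proof.
apply/funext => x; rewrite /Rep /Imp !fctE /= !mul1r.
by case: c (phi x) (psi x) => [a b] [u v] [w z] /=.
Qed.

Lemma csmooth_lin (c : R[i]) phi psi :
  csmooth phi -> csmooth psi -> csmooth (c *: phi + psi).
Proof.
move=> [rf jf] [rg jg]; split; rewrite ?RepE ?ImpE.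
  exact: (smooth_lin 1 1 (smooth_lin _ _ rf jf) rg).
exact: (smooth_lin 1 1 (smooth_lin _ _ jf rf) jg).
Qed.

Lemma cpderivs_lin (c : R[i]) phi psi s : csmooth phi -> csmooth psi ->
  cpderivs s (c *: phi + psi) = c *: cpderivs s phi + cpderivs s psi.
Proof.
move=> [rf jf] [rg jg]; apply/funext => x; rewrite /cpderivs RepE ImpE.
rewrite (pderivs_lin 1 1 _ (smooth_lin _ _ rf jf) rg) (pderivs_lin _ _ _ rf jf).
rewrite (pderivs_lin 1 1 _ (smooth_lin _ _ jf rf) jg) (pderivs_lin _ _ _ jf rf).
rewrite !fctE !mul1r mulNr.
by case: c => a b /=.
Qed.

Lemma cpderivs0 s : cpderivs s (0 : 'rV[R]_n -> R[i]) = 0.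
Proof.
have := cpderivs_lin (-1) s csmooth0 csmooth0.
by rewrite scaleN1r addNr scaleN1r addNr.
Qed.

End smooth_theory.

Section space_theory.
Variables (R : realType) (n : nat) (sigma : R).
Local Notation V := ('rV[R]_n -> R[i]).
Local Notation mindex := {ffun 'I_n -> nat}.
Local Notation M := (Mseq sigma).
Local Notation T := (Tfun sigma).
Local Notation w := (weight sigma).
Local Notation N := (@Xnorm R n sigma).
Local Notation bWM := (@bounded_WM R n sigma).
Implicit Types (phi psi : V) (tau : R).

Lemma Mseq_gt0 tau p : 0 < M tau p.
Proof. by case: p => [|p]; rewrite /= ?ltr01// powR_gt0. Qed.

Lemma Mseq_homo tau tau' p : tau <= tau' -> M tau p <= M tau' p.
Proof.
case: p => [//|p] tt' /=.
by rewrite ler_powR ?ler1n// ler_wpM2r// powR_ge0.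
Qed.

Lemma Tfun_anti tau tau' r : 0 <= r -> tau <= tau' ->
  (T tau' r <= T tau r)%E.
Proof.
rewrite /Tfun; have [//|r0 rge0 tt'] := eqVneq r 0.
have {r0 rge0}r0 : 0 < r by rewrite lt_neqAle eq_sym r0.
apply: ge_ereal_sup => _ [p _ <-].
apply: (@le_trans _ _ (ln (r ^+ p / M tau p))%:E); last first.
  by apply: ereal_sup_ubound; exists p.
rewrite lee_fin ler_ln ?posrE ?divr_gt0 ?exprn_gt0 ?Mseq_gt0//.
by rewrite ler_pM2l ?exprn_gt0// lef_pV2 ?posrE ?Mseq_gt0// Mseq_homo.
Qed.

Lemma weight_ge0 tau (x : 'rV[R]_n) : (0 <= w tau x)%E.
Proof. exact: expeR_ge0. Qed.

Lemma weight_anti tau tau' (x : 'rV[R]_n) : tau <= tau' ->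
  (w tau' x <= w tau x)%E.
Proof. by move=> tt'; rewrite lee_expeR Tfun_anti// sqrtr_ge0. Qed.

Lemma bounded_WM_homo tau tau' phi : tau <= tau' ->
  bWM tau phi -> bWM tau' phi.
Proof.
move=> tt' [C C0 hC]; exists C => // b.
apply: ge_ereal_sup => _ [x _ <-].
apply: (@le_trans _ _ (w tau x * (cabs (mderiv b phi x))%:E)%E).
  by rewrite lee_wpmul2r// ?lee_fin ?cabs_ge0// weight_anti.
apply: (@le_trans _ _ (C * M tau (mabs b))%:E).
  by apply: le_trans (hC b); apply: ereal_sup_ubound; exists x.
by rewrite lee_fin ler_pM2l// Mseq_homo.
Qed.

Lemma Xnorm_ge0 tau phi : (0 <= N tau phi)%E.
Proof.
apply: (@le_trans _ _ (w tau 0 *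
    (cabs (mderiv [ffun=> 0%N] phi 0) / M tau (mabs [ffun=> 0%N : nat]))%:E)%E).
  apply: mule_ge0; first exact: weight_ge0.
  by rewrite lee_fin divr_ge0 ?cabs_ge0// ltW// Mseq_gt0.
by apply: ereal_sup_ubound; exists ([ffun=> 0%N], 0).
Qed.

Lemma bounded_WMP tau phi : bWM tau phi <-> (N tau phi < +oo)%E.
Proof.
split=> [[C C0 hC]|Nlt].
  apply: (@le_lt_trans _ _ C%:E); last exact: ltry.
  apply: ge_ereal_sup => _ [[b x] _ <-] /=.
  rewrite EFinM muleA lee_pdivrMr ?Mseq_gt0//.
  by apply: le_trans (hC b); apply: ereal_sup_ubound; exists x.
have Nfin : N tau phi \is a fin_num by rewrite ge0_fin_numE ?Xnorm_ge0.
exists (fine (N tau phi) + 1).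
  by rewrite ltr_wpDl// fine_ge0// Xnorm_ge0.
move=> b; apply: ge_ereal_sup => _ [x _ <-] /=.
rewrite EFinM -lee_pdivrMr ?Mseq_gt0// -muleA -EFinM.
apply: (@le_trans _ _ (N tau phi)).
  by apply: ereal_sup_ubound; exists (b, x).
by rewrite -[leLHS](fineK Nfin) lee_fin lerDl.
Qed.

Lemma SWM_roumieuE :
  SWM_roumieu n sigma = \bigcup_(tau in [set t | 0 < t]) Xspace sigma tau.
Proof.
apply/seteqP; split=> [phi [sphi [tau t0 /bounded_WMP Nlt]]|phi [tau t0 [sphi Nlt]]].
  by exists tau.
by split=> //; exists tau => //; apply/bounded_WMP.
Qed.

Lemma SWM_beurlingE :
  SWM_beurling n sigma = \bigcap_(tau in [set t | 0 < t]) Xspace sigma tau.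
Proof.
apply/seteqP; split=> [phi [sphi h] tau t0|phi h].
  by split=> //; apply/bounded_WMP/h.
split=> [|tau t0]; first exact: (h 1 ltr01).1.
by apply/bounded_WMP; exact: (h tau t0).2.
Qed.

Lemma Xnorm0 tau : N tau 0 = 0%E.
Proof.
apply/eqP; rewrite eq_le Xnorm_ge0 andbT.
apply: ge_ereal_sup => _ [[b x] _ <-]; rewrite [X in cabs X](_ : _ = 0).
  by rewrite cabs0 mul0r mule0.
refine (congr1 (fun f : V => f x) (cpderivs0 R (mindex_seq b))).
Qed.

Lemma Xnorm_lin tau (c : R[i]) phi psi : csmooth phi -> csmooth psi ->
  (N tau (c *: phi + psi)%R <= (cabs c)%:E * N tau phi + N tau psi)%E.
Proof.
move=> sf sg; apply: ge_ereal_sup => _ [[b x] _ <-].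
rewrite [X in cabs X](_ : _ = c * mderiv b phi x + mderiv b psi x); last first.
  refine (congr1 (fun f : V => f x) (cpderivs_lin c (mindex_seq b) sf sg)).
rewrite [_.1]/= [_.2]/=.
have M0 := Mseq_gt0 tau (mabs b).
have sup_x f : (w tau x * (cabs (mderiv b f x) / M tau (mabs b))%:E
    <= N tau f)%E by apply: ereal_sup_ubound; exists (b, x).
apply: (@le_trans _ _ (w tau x *
  ((cabs c)%:E * (cabs (mderiv b phi x) / M tau (mabs b))%:E +
   (cabs (mderiv b psi x) / M tau (mabs b))%:E))%E).
  rewrite lee_wpmul2l ?weight_ge0// -EFinM -EFinD lee_fin mulrA -mulrDl.
  rewrite ler_pM2r ?invr_gt0// -cabsM.
  exact: cabsD.
have q_ge0 f : (0 <= (cabs (mderiv b f x) / M tau (mabs b))%:E)%E.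
  by rewrite lee_fin divr_ge0 ?cabs_ge0// ltW.
have c_ge0 : (0 <= (cabs c)%:E)%E by rewrite lee_fin cabs_ge0.
rewrite ge0_muleDr ?q_ge0//; last exact: mule_ge0.
by rewrite leeD// muleCA lee_wpmul2l.
Qed.

Lemma bounded_WM_lin tau (c : R[i]) phi psi : csmooth phi -> csmooth psi ->
  bWM tau phi -> bWM tau psi -> bWM tau (c *: phi + psi).
Proof.
move=> sf sg /bounded_WMP hf /bounded_WMP hg; apply/bounded_WMP.
apply: (le_lt_trans (Xnorm_lin _ _ sf sg)); rewrite lte_add_pinfty//.
by rewrite lte_mul_pinfty ?lee_fin ?cabs_ge0.
Qed.

Lemma bounded_WM0 tau : bWM tau 0.
Proof. by apply/bounded_WMP; rewrite Xnorm0. Qed.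

Lemma SWM_roumieu_closed :
  submod_closed [pred phi | phi \in SWM_roumieu n sigma].
Proof.
split=> [|c phi psi]; rewrite !inE.
  by split; [exact: csmooth0|exists 1 => //; exact: bounded_WM0].
move=> [sf [t t0 ht]] [sg [u u0 hu]]; split; first exact: csmooth_lin.
exists (Num.max t u); first by rewrite lt_max t0.
apply: bounded_WM_lin => //; [apply: bounded_WM_homo ht|apply: bounded_WM_homo hu].
  by rewrite le_max lexx.
by rewrite le_max lexx orbT.
Qed.

Lemma SWM_beurling_closed :
  submod_closed [pred phi | phi \in SWM_beurling n sigma].
Proof.
split=> [|c phi psi]; rewrite !inE.
  by split; [exact: csmooth0|move=> tau _; exact: bounded_WM0].
move=> [sf hf] [sg hg]; split; first exact: csmooth_lin.
by move=> tau t0; apply: bounded_WM_lin; [| |exact: hf|exact: hg].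
Qed.

End space_theory.

Section tvs_structure.
Variables (R : realType) (n : nat) (sigma : R).
Local Notation V := ('rV[R]_n -> R[i]).

Definition roumieu := {phi : V | phi \in SWM_roumieu n sigma}.
Definition beurling := {phi : V | phi \in SWM_beurling n sigma}.

HB.instance Definition _ := SubChoice.on roumieu.
HB.instance Definition _ := GRing.SubChoice_isSubLmodule.Build _ V
  [pred phi | phi \in SWM_roumieu n sigma] roumieu
  (SWM_roumieu_closed n sigma).
HB.instance Definition _ := SubChoice.on beurling.
HB.instance Definition _ := GRing.SubChoice_isSubLmodule.Build _ V
  [pred phi | phi \in SWM_beurling n sigma] beurling
  (SWM_beurling_closed n sigma).

Local Notation Xnorm := (@Xnorm R n sigma).

Lemma beurling_fin_num tau (phi : beurling) : 0 < tau ->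
  Xnorm tau (\val phi) \is a fin_num.
Proof.
move=> t0; rewrite ge0_fin_numE ?Xnorm_ge0//.
by have /set_mem[_ /(_ _ t0) /bounded_WMP] := valP phi.
Qed.

Lemma beurling_csmooth (phi : beurling) : csmooth (\val phi).
Proof. by have /set_mem[] := valP phi. Qed.

Definition beurling_norm tau (phi : beurling) : R[i] :=
  (fine (Xnorm tau (\val phi)))%:C%C.

Lemma beurling_norm_lin tau (c : R[i]) phi psi : 0 < tau ->
  beurling_norm tau (c *: phi + psi) <=
  `|c| * beurling_norm tau phi + beurling_norm tau psi.
Proof.
move=> t0; rewrite normr_cabs /beurling_norm -rmorphM -rmorphD lecR.
have fphi := beurling_fin_num phi t0; have fpsi := beurling_fin_num psi t0.
have fsum := beurling_fin_num (c *: phi + psi) t0.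
rewrite -lee_fin EFinD EFinM !fineK//.
exact: (Xnorm_lin sigma tau c (beurling_csmooth phi) (beurling_csmooth psi)).
Qed.

Lemma beurling_norm0 tau : 0 < tau -> beurling_norm tau 0 = 0.
Proof.
move=> t0; rewrite /beurling_norm.
have -> : Xnorm tau (\val (0 : beurling)) = 0%E by exact: Xnorm0.
by [].
Qed.

Lemma beurling_normD tau : 0 < tau -> forall phi psi,
  beurling_norm tau (phi + psi) <= beurling_norm tau phi + beurling_norm tau psi.
Proof.
move=> t0 phi psi; have := beurling_norm_lin 1 phi psi t0.
by rewrite scale1r normr1 mul1r.
Qed.

Lemma beurling_normZ tau : 0 < tau -> forall c phi,
  beurling_norm tau (c *: phi) = `|c| * beurling_norm tau phi.
Proof.
move=> t0.
have le c phi : beurling_norm tau (c *: phi) <= `|c| * beurling_norm tau phi.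
  have := beurling_norm_lin c phi 0 t0.
  by rewrite !addr0 (beurling_norm0 t0) addr0.
move=> c phi; apply/eqP; rewrite eq_le le/=.
have [->|c0] := eqVneq c 0; first by rewrite normr0 mul0r scale0r beurling_norm0.
have := le c^-1 (c *: phi).
by rewrite scalerA mulVf// scale1r normfV ler_pdivlMl// normr_gt0.
Qed.

Definition beurling_seminorm tau (tau0 : 0 < tau) : seminorm beurling :=
  Seminorm (beurling_normD tau0) (beurling_normZ tau0).

(* Projective limit topology: the coarsest locally convex topology making all
   the inclusions into the spaces [Xspace sigma tau] continuous. *)
Definition beurling_space := lcs [set p : seminorm beurling |
  exists (tau : R) (tau0 : 0 < tau), p = beurling_seminorm tau0].

(* Locally convex inductive limit topology: the finest locally convex topology
   making all the inclusions of the spaces [Xspace sigma tau] continuous, that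
   is, the one generated by all seminorms whose restriction to each
   [Xspace sigma tau] is continuous for [Xnorm sigma tau]. *)
Definition roumieu_space := lcs [set p : seminorm roumieu |
  forall tau : R, 0 < tau -> exists C : R, forall phi : roumieu,
    Xspace sigma tau (\val phi) ->
    p phi <= (C * fine (Xnorm tau (\val phi)))%:C%C].

End tvs_structure.

(* Main.v *)
Require Import Defs.
From HB Require Import structures.
From mathcomp Require Import all_boot all_order all_algebra.
From mathcomp Require Import all_classical all_reals all_analysis.
From mathcomp.real_closed Require Import complex.
From mathcomp Require Import ring lra.

(** The first assertion is elementary. The weight [exp (T_tau r)] is the least
    [B] such that [r^p <= M_p B] for all [p], so bounds with weights and bounds
    with monomials say the same thing, up to replacing the Euclidean norm of
    [x] by its largest coordinate. This costs a factor [n^p], which an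
    arbitrarily small increase of [tau] absorbs because [sigma > 1]
    ([expr_le_Mseq], [bounded_WM_of_MM]).

    For nuclearity, the first ingredient is that for [tau < tau'] the inclusion
    of the space of level [tau] into that of level [tau'] is of Hilbert-Schmidt
    type ([sampling]): there are linear forms [G j], with square summable norms
    for the level [tau], such that the square of the norm of level [tau'] is at
    most the sum of the [|G j phi|^2]. These forms sample the derivatives of
    order [p] on a grid whose step depends on [p]. By the mean value
    inequality, passing from a point to a grid point further away from the
    origin costs a derivative of order [p + 1], and the step is so small that
    this is at most half of the norm, which can be absorbed. The gap between
    [tau] and [tau'] makes the norms of the samples square summable, the weights
    summing over the grid and the sequences [M] over the orders of derivation.

    The second ingredient is an abstract expansion theorem for a scale of such
    inclusions ([nuclear_expansion]). Let [p] be a seminorm bounded on every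
    level. Each level carries the pre-Hilbert structure defined by its forms and
    a basis obtained by a greedy Gram-Schmidt process, which provides Parseval
    bounds without passing to a completion. Suitable multiples of all these
    basis vectors form one sequence [psi] with square summable seminorms
    [p (psi j)]. Evaluation at the [psi j] is then a square summable system on
    the space of linear forms dominated by [p]. Riesz representation on that
    space, applied to the evaluation at a point [x], yields coefficients [y j x],
    and the Hahn-Banach theorem shows that [x] is the sum of the [y j x *: psi j]
    for [p]. The coefficients are bounded on every level by multiples of one
    square summable sequence [b].

    The least [m] with [|y j x| <= m (b j)] for all [j] is therefore a seminorm
    bounded on every level ([coefficient_gauge]). Added to [p], it gives the
    seminorm [q] required by nuclearity: the expansion extends by density to the
    completions and exhibits the canonical map as a nuclear one
    ([nuclear_of_expansion]). The Roumieu space is the union of the levels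
    [1, 2, 3, ...], and there every seminorm bounded on all levels is continuous.
    In the Beurling case a continuous seminorm is bounded by a single norm, of
    level [tau0] say, and the scale consists of the norms of levels increasing
    to [tau0]. *)

Import numFieldNormedType.Exports.

Set Implicit Arguments.
Unset Strict Implicit.
Unset Printing Implicit Defensive.

Import Order.TTheory GRing.Theory Num.Theory.

Local Open Scope classical_set_scope.
Local Open Scope ring_scope.

(** * Limits of complex sequences *)
Section complex_limits.
Variable R : realType.
Local Notation K := R[i].
Implicit Types (u v : nat -> K) (l z w : K).

Lemma cabs_sqr z : cabs z ^+ 2 = complex.Re z ^+ 2 + complex.Im z ^+ 2.
Proof.
case: z => a b; rewrite /cabs /Normc.normc sqr_sqrtr //.
by rewrite addr_ge0 ?sqr_ge0.
Qed.

Lemma cabs_conj z : cabs (z^*%C) = cabs z.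
Proof. by case: z => a b; rewrite /cabs /Normc.normc /= sqrrN. Qed.

Lemma mul_conj z : z * z^*%C = (cabs z ^+ 2)%:C%C.
Proof. by rewrite -sqr_normc normr_cabs rmorphXn. Qed.

Lemma conjcM z w : (z * w)^*%C = z^*%C * w^*%C.
Proof. exact: rmorphM. Qed.

Lemma cabs_eq0 z : cabs z = 0 -> z = 0.
Proof. exact: Normc.eq0_normc. Qed.

Lemma cabsN z : cabs (- z) = cabs z.
Proof. exact: normcN. Qed.

Lemma cabsB z w : cabs (z - w) = cabs (w - z).
Proof. by rewrite -cabsN opprB. Qed.

Lemma cabsR (r : R) : cabs r%:C%C = `|r|.
Proof. by rewrite /cabs /Normc.normc /= expr0n addr0 sqrtr_sqr. Qed.

Lemma cabs_sum I (s : seq I) (P : pred I) (F : I -> K) :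
  cabs (\sum_(i <- s | P i) F i) <= \sum_(i <- s | P i) cabs (F i).
Proof.
elim/big_ind2: _ => [|z1 z2 w1 w2 h1 h2|//]; first by rewrite cabs0.
by apply: le_trans (cabsD _ _) _; rewrite lerD.
Qed.

Lemma cabs_Re z : `|complex.Re z| <= cabs z.
Proof.
by rewrite -[leLHS]sqrtr_sqr; case: z => a b; apply: ler_wsqrtr; rewrite lerDl sqr_ge0.
Qed.

Lemma cabs_Im z : `|complex.Im z| <= cabs z.
Proof.
by rewrite -[leLHS]sqrtr_sqr; case: z => a b; apply: ler_wsqrtr; rewrite lerDr sqr_ge0.
Qed.

Lemma cabs_ReIm z : cabs z <= `|complex.Re z| + `|complex.Im z|.
Proof.
rewrite -(@ler_pXn2r _ 2) ?nnegrE ?cabs_ge0 ?addr_ge0 // cabs_sqr.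
rewrite sqrrD !real_normK ?num_real // addrAC lerDl.
by rewrite mulrn_wge0 // mulr_ge0.
Qed.

Lemma squeeze0 (a b : nat -> R) : (forall n, `|a n| <= b n) ->
  b @ \oo --> (0 : R) -> a @ \oo --> (0 : R).
Proof.
move=> ab /cvgr0Pnorm_lt b0; apply/cvgr0Pnorm_lt => e /b0.
by apply: filterS => n; apply: le_lt_trans; exact: le_trans (ab n) (ler_norm _).
Qed.

(** Tested on real and imaginary parts, so that comparison and completeness come
    from the real line. *)
Definition clim u l :=
  (fun n => complex.Re (u n)) @ \oo --> complex.Re l /\
  (fun n => complex.Im (u n)) @ \oo --> complex.Im l.

Lemma clim_unique u l l' : clim u l -> clim u l' -> l = l'.
Proof.
move=> [r i] [r' i'].
have := cvg_unique (@Rhausdorff R) r r'; have := cvg_unique (@Rhausdorff R) i i'.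
by case: l l' {r i r' i'} => a b [c d] /= -> ->.
Qed.

Lemma clim_cst l : clim (fun=> l) l.
Proof. by split; exact: cvg_cst. Qed.

Lemma climD u v l m : clim u l -> clim v m -> clim (fun n => u n + v n) (l + m).
Proof.
move=> [a b] [c d]; split.
  rewrite raddfD; under eq_fun do rewrite raddfD; exact: cvgD a c.
rewrite raddfD; under eq_fun do rewrite raddfD; exact: cvgD b d.
Qed.

Lemma climM u v l m : clim u l -> clim v m -> clim (fun n => u n * v n) (l * m).
Proof.
have ReM (z w : K) : complex.Re (z * w) = complex.Re z * complex.Re w - complex.Im z * complex.Im w.
  by case: z w => ? ? [].
have ImM (z w : K) : complex.Im (z * w) = complex.Re z * complex.Im w + complex.Im z * complex.Re w.
  by case: z w => ? ? [].
move=> [a b] [c d]; split.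
  rewrite ReM; under eq_fun do rewrite ReM.
  by apply: cvgB; [exact: cvgM a c|exact: cvgM b d].
rewrite ImM; under eq_fun do rewrite ImM.
by apply: cvgD; [exact: cvgM a d|exact: cvgM b c].
Qed.

Lemma climZ c u l : clim u l -> clim (fun n => c * u n) (c * l).
Proof. exact/climM/clim_cst. Qed.

Lemma clim_conj u l : clim u l -> clim (fun n => (u n)^*%C) l^*%C.
Proof.
have ReC (z : K) : complex.Re z^*%C = complex.Re z by case: z.
have ImC (z : K) : complex.Im z^*%C = - complex.Im z by case: z.
move=> [a b]; split.
  by rewrite ReC; under eq_fun do rewrite ReC.
by rewrite ImC; under eq_fun do rewrite ImC; exact: cvgN.
Qed.

Lemma clim_cabs u l : clim u l -> (fun n => cabs (u n)) @ \oo --> cabs l.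
Proof.
move=> [a b].
have E z : cabs z = Num.sqrt (complex.Re z ^+ 2 + complex.Im z ^+ 2) by case: z.
rewrite E; under eq_fun do rewrite E.
apply: (@continuous_cvg _ _ _ _ _ _ (@Num.sqrt R)); first exact: sqrt_continuous.
by apply: cvgD; under eq_fun do rewrite expr2; rewrite expr2; exact: cvgM.
Qed.

Lemma clim_cabs_le u l M : clim u l -> (forall n, cabs (u n) <= M) -> cabs l <= M.
Proof.
move=> /clim_cabs ul le; rewrite -(cvg_lim (@Rhausdorff R) ul).
by apply: limr_le; [exact: cvgP ul|exact: nearW].
Qed.

Lemma climP u l : clim u l <->
  (fun n => cabs (u n - l)) @ \oo --> (0 : R).
Proof.
split=> [ul|h].
  have := clim_cabs (climD ul (clim_cst (- l))).
  by rewrite subrr cabs0.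
have Re0 (f : K -> R) : (forall z, `|f z| <= cabs z) ->
    {morph f : x y / x - y} -> (fun n => f (u n)) @ \oo --> f l.
  move=> fle fB; apply/subr_cvg0.
  by apply: squeeze0 h => n; rewrite -fB fle.
split; apply: Re0; [exact: cabs_Re| |exact: cabs_Im|].
  by move=> x y; rewrite raddfB.
by move=> x y; rewrite raddfB.
Qed.

Lemma clim_sandwich u l (b : nat -> R) :
  (forall n, cabs (u n - l) <= b n) -> b @ \oo --> (0 : R) -> clim u l.
Proof.
move=> ub b0; apply/climP; apply: squeeze0 b0 => n.
by rewrite ger0_norm ?cabs_ge0.
Qed.

Definition climit u : K :=
  Complex (limn (fun n => complex.Re (u n))) (limn (fun n => complex.Im (u n))).

Lemma clim_sum I (r : seq I) (f : I -> nat -> K) (l : I -> K) :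
  (forall i, clim (f i) (l i)) ->
  clim (fun N => \sum_(i <- r) f i N) (\sum_(i <- r) l i).
Proof.
move=> h; elim: r => [|i r IH].
  by rewrite big_nil; under eq_fun do rewrite big_nil; exact: clim_cst.
by rewrite big_cons; under eq_fun do rewrite big_cons; exact: climD.
Qed.

End complex_limits.

(** * Series with nonnegative terms *)
Section real_sums.
Variable R : realType.
Implicit Types (a b : nat -> R).

(** For nonnegative [a], this says both that the series converges and that its
    sum is at most [M]. *)
Definition sumle a (M : R) := forall n, \sum_(j < n) a j <= M.

Definition rsum a : R := limn (fun n => \sum_(j < n) a j).

Lemma psum_mono a m n : (forall j, 0 <= a j) -> (m <= n)%N ->
  \sum_(j < m) a j <= \sum_(j < n) a j.
Proof.
move=> a0 mn; rewrite -!(big_mkord xpredT a) (big_cat_nat (leq0n m) mn) /= lerDl.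
by rewrite sumr_ge0.
Qed.

Lemma sumle_ge0 a M : sumle a M -> 0 <= M.
Proof. by move=> /(_ 0%N); rewrite big_ord0. Qed.

Lemma le_sumle a b M : (forall j, b j <= a j) -> sumle a M -> sumle b M.
Proof. by move=> ab h n; apply: le_trans (h n); apply: ler_sum. Qed.

Lemma sumleZ a c M : 0 <= c -> sumle a M -> sumle (fun j => c * a j) (c * M).
Proof. by move=> c0 h n; rewrite -mulr_sumr ler_wpM2l. Qed.

Lemma rsum_cvg a M : (forall j, 0 <= a j) -> sumle a M ->
  (fun n => \sum_(j < n) a j) @ \oo --> rsum a.
Proof.
move=> a0 h; apply: (@nondecreasing_is_cvgn R) => [m n mn|]; first exact: psum_mono.
by exists M => _ [n _ <-].
Qed.

Lemma rsum_le a M : (forall j, 0 <= a j) -> sumle a M -> rsum a <= M.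
Proof.
move=> a0 h; apply: limr_le; first exact: cvgP (rsum_cvg a0 h).
exact: nearW.
Qed.

Lemma sumle_rsum a M : (forall j, 0 <= a j) -> sumle a M -> sumle a (rsum a).
Proof.
move=> a0 h n; apply: nondecreasing_cvgn_le; last exact: cvgP (rsum_cvg a0 h).
by move=> {}m {}n mn; exact: psum_mono.
Qed.

Lemma rsum_ge0 a M : (forall j, 0 <= a j) -> sumle a M -> 0 <= rsum a.
Proof. by move=> a0 h; exact: sumle_ge0 (sumle_rsum a0 h). Qed.

Lemma le_term_rsum a M j : (forall j, 0 <= a j) -> sumle a M -> a j <= rsum a.
Proof.
move=> a0 h; apply: le_trans (sumle_rsum a0 h j.+1).
by rewrite big_ord_recr /= lerDr sumr_ge0.
Qed.

(** Double sums are estimated on finite rectangles, where the order of summation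
    can be exchanged; this lets one of the two ranges tend to infinity. *)
Lemma sum_rsum_le I (r : seq I) (f : I -> nat -> R) (B : I -> R) M :
  (forall i j, 0 <= f i j) -> (forall i, sumle (f i) (B i)) ->
  (forall n, \sum_(i <- r) \sum_(j < n) f i j <= M) ->
  \sum_(i <- r) rsum (f i) <= M.
Proof.
move=> f0 fB h.
have cv : (fun n => \sum_(i <- r) \sum_(j < n) f i j) @ \oo --> \sum_(i <- r) rsum (f i).
  elim: r {h} => [|i r IH].
    by rewrite big_nil; under eq_fun do rewrite big_nil; exact: cvg_cst.
  rewrite big_cons; under eq_fun do rewrite big_cons.
  by apply: cvgD IH; exact: rsum_cvg (fB i).
rewrite -(cvg_lim _ cv) //; apply: limr_le; [exact: cvgP cv|exact: nearW].
Qed.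

Lemma sumle_tail a M e : (forall j, 0 <= a j) -> sumle a M -> 0 < e ->
  exists J, forall m n, (J <= m)%N -> \sum_(m <= j < n) a j <= e.
Proof.
move=> a0 h e0; have cv := rsum_cvg a0 h.
have /cvgrPdist_lt /(_ _ e0)[J _ hJ] := cv.
exists J => m n Jm; have [mn|nm] := leqP m n; last first.
  by rewrite big_geq ?ltW // ltnW.
have /= := hJ m Jm; rewrite ger0_norm; last first.
  by rewrite subr_ge0; exact: (sumle_rsum a0 h m).
have : \sum_(j < n) a j <= rsum a by exact: (sumle_rsum a0 h n).
rewrite -!(big_mkord xpredT a) (big_cat_nat (leq0n m) mn) /=.
by move=> *; lra.
Qed.

(** Cauchy-Schwarz by induction: adding one pair [(x, y)] creates the cross term
    [2 x y S], which is at most [x^2 B + y^2 A] because [S^2 <= A B]. *)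
Lemma finite_CS I (r : seq I) (a b : I -> R) :
  (forall i, 0 <= a i) -> (forall i, 0 <= b i) ->
  (\sum_(i <- r) a i * b i) ^+ 2 <=
  (\sum_(i <- r) a i ^+ 2) * (\sum_(i <- r) b i ^+ 2).
Proof.
move=> a0 b0; elim: r => [|i r]; first by rewrite !big_nil expr2 !mul0r.
rewrite !big_cons.
set S := \sum_(j <- r) _; set A := \sum_(j <- r) _; set B := \sum_(j <- r) _.
have S0 : 0 <= S by apply: sumr_ge0 => *; rewrite mulr_ge0.
have A0 : 0 <= A by apply: sumr_ge0 => *; rewrite sqr_ge0.
have B0 : 0 <= B by apply: sumr_ge0 => *; rewrite sqr_ge0.
move: (a i) (b i) (a0 i) (b0 i) => x y x0 y0 h.
suff : 2 * (x * y) * S <= x ^+ 2 * B + y ^+ 2 * A.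
  by move: h; rewrite !expr2 => h1 h2; nra.
rewrite -(@ler_pXn2r _ 2) ?nnegrE //; last 2 first.
  by rewrite !mulr_ge0.
  by rewrite addr_ge0 // mulr_ge0 // sqr_ge0.
apply: (@le_trans _ _ ((2 * (x * y)) ^+ 2 * (A * B))).
  by rewrite exprMn ler_wpM2l // sqr_ge0.
rewrite -subr_ge0.
rewrite (_ : _ - _ = (x ^+ 2 * B - y ^+ 2 * A) ^+ 2); last by ring.
exact: sqr_ge0.
Qed.

Lemma cabs_CS I (r : seq I) (a b : I -> R[i]) :
  cabs (\sum_(i <- r) a i * b i) ^+ 2 <=
  (\sum_(i <- r) cabs (a i) ^+ 2) * (\sum_(i <- r) cabs (b i) ^+ 2).
Proof.
apply: le_trans (finite_CS r (fun i => cabs_ge0 (a i)) (fun i => cabs_ge0 (b i))).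
rewrite ler_pXn2r ?nnegrE ?cabs_ge0 ?sumr_ge0 // => [|i _]; last by rewrite mulr_ge0 ?cabs_ge0.
by apply: le_trans (cabs_sum _ _ _) _; under eq_bigr do rewrite cabsM.
Qed.

End real_sums.

(** * The pairing of square summable sequences *)
Section square_summable.
Variable R : realType.
Local Notation K := R[i].
Implicit Types (a b : nat -> K).

Lemma abs_summable_clim a M : sumle (fun j => cabs (a j)) M ->
  clim (fun n => \sum_(j < n) a j) (climit (fun n => \sum_(j < n) a j)).
Proof.
move=> h.
have cv (f : K -> R) : (forall z, `|f z| <= cabs z) -> f 0 = 0 ->
    {morph f : x y / x + y} -> cvgn (fun n => f (\sum_(j < n) a j)).
  move=> fle f0 fD.
  rewrite (_ : (fun n => _) = series (f \o a)); last first.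
    apply/funext => n; rewrite /series /= big_mkord.
    by rewrite (big_morph f fD f0).
  refine (@normed_cvg R R (f \o a) _); refine (@series_le_cvg R _ _ (fun j => normr_ge0 (f (a j)))
    (fun j => cabs_ge0 (a j)) (fun j => fle (a j)) _).
  have cv := rsum_cvg (fun j => cabs_ge0 (a j)) h.
  rewrite (_ : series _ = fun n => \sum_(j < n) cabs (a j)); first exact: cvgP cv.
  by apply/funext => n; rewrite /series /= big_mkord.
split.
  by apply: cv; [exact: cabs_Re|by []|move=> x y; rewrite raddfD].
by apply: cv; [exact: cabs_Im|by []|move=> x y; rewrite raddfD].
Qed.

Definition sq a j : R := cabs (a j) ^+ 2.

Lemma sq_ge0 a j : 0 <= sq a j. Proof. exact: sqr_ge0. Qed.

(** Bilinear rather than sesquilinear: it serves both as an inner product, with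
    an explicit conjugate, and to expand linear forms. *)
Definition cdot a b : K := climit (fun n => \sum_(j < n) a j * b j).

Lemma cdot_clim a b A B : sumle (sq a) A -> sumle (sq b) B ->
  clim (fun n => \sum_(j < n) a j * b j) (cdot a b).
Proof.
move=> hA hB; refine (@abs_summable_clim (fun j => a j * b j) ((A + B) / 2) _) => n.
apply: (@le_trans _ _ ((\sum_(j < n) sq a j + \sum_(j < n) sq b j) / 2)).
  rewrite -big_split /= mulr_suml; apply: ler_sum => j _.
  rewrite cabsM /sq ler_pdivlMr // -subr_ge0.
  have := sqr_ge0 (cabs (a j) - cabs (b j)).
  by rewrite sqrrB => h; lra.
by rewrite ler_pM2r ?invr_gt0 // lerD.
Qed.

Lemma cdotE a b A B l : sumle (sq a) A -> sumle (sq b) B ->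
  clim (fun n => \sum_(j < n) a j * b j) l -> cdot a b = l.
Proof. by move=> hA hB; exact: clim_unique (cdot_clim hA hB). Qed.

Lemma cdot_le a b A B : sumle (sq a) A -> sumle (sq b) B ->
  cabs (cdot a b) ^+ 2 <= A * B.
Proof.
move=> hA hB; have A0 := sumle_ge0 hA; have B0 := sumle_ge0 hB.
rewrite -[leRHS]sqr_sqrtr ?mulr_ge0 //.
rewrite ler_pXn2r ?nnegrE ?cabs_ge0 ?sqrtr_ge0 //.
apply: (clim_cabs_le (cdot_clim hA hB)) => n.
rewrite -(@ler_pXn2r _ 2) ?nnegrE ?cabs_ge0 ?sqrtr_ge0 // sqr_sqrtr ?mulr_ge0 //.
apply: le_trans (cabs_CS _ _ _) _.
by apply: ler_pM (hA n) (hB n); apply: sumr_ge0 => *; exact: sqr_ge0.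
Qed.

Lemma sumle_sq_lin c a b A B : sumle (sq a) A -> sumle (sq b) B ->
  sumle (sq (fun j => c * a j + b j)) (2 * (cabs c ^+ 2 * A + B)).
Proof.
move=> hA hB n.
apply: (@le_trans _ _ (2 * (cabs c ^+ 2 * \sum_(j < n) sq a j + \sum_(j < n) sq b j))).
  rewrite mulr_sumr -big_split /= mulr_sumr; apply: ler_sum => j _.
  rewrite /sq -exprMn -cabsM.
  have := cabsD (c * a j) (b j).
  have := cabs_ge0 (c * a j + b j).
  move: (cabs (c * a j + b j)) (cabs (c * a j)) (cabs (b j)) => x y z x0 xyz.
  have : x ^+ 2 <= (y + z) ^+ 2 by rewrite ler_pXn2r ?nnegrE // (le_trans x0).
  have := sqr_ge0 (y - z).
  by rewrite !expr2 => *; nra.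
by rewrite ler_pM2l // lerD // ler_wpM2l // sqr_ge0.
Qed.

Lemma cdot_linl c a b d A B D : sumle (sq a) A -> sumle (sq b) B -> sumle (sq d) D ->
  cdot (fun j => c * a j + b j) d = c * cdot a d + cdot b d.
Proof.
move=> hA hB hD; apply: (cdotE (sumle_sq_lin c hA hB) hD).
rewrite (_ : (fun n => _) = fun n =>
    c * \sum_(j < n) a j * d j + \sum_(j < n) b j * d j).
  exact: climD (climZ c (cdot_clim hA hD)) (cdot_clim hB hD).
apply/funext => n; rewrite mulr_sumr -big_split /=.
by apply: eq_bigr => j _; rewrite mulrDl mulrA.
Qed.

Lemma cdotC a b : cdot a b = cdot b a.
Proof. by rewrite /cdot; under eq_fun do under eq_bigr do rewrite mulrC. Qed.

Lemma sumle_sq_conj a A : sumle (sq a) A -> sumle (sq (fun j => (a j)^*%C)) A.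
Proof. by apply: le_sumle => j; rewrite /sq cabs_conj. Qed.

Lemma cdot_conj a b A B : sumle (sq a) A -> sumle (sq b) B ->
  cdot (fun j => (a j)^*%C) (fun j => (b j)^*%C) = (cdot a b)^*%C.
Proof.
move=> hA hB; apply: (cdotE (sumle_sq_conj hA) (sumle_sq_conj hB)).
rewrite (_ : (fun n => _) = fun n => (\sum_(j < n) a j * b j)^*%C).
  exact: clim_conj (cdot_clim hA hB).
by apply/funext => n; rewrite rmorph_sum; apply: eq_bigr => j _; rewrite rmorphM.
Qed.

Lemma cdot_self a A : sumle (sq a) A ->
  cdot a (fun j => (a j)^*%C) = (rsum (sq a))%:C%C.
Proof.
move=> hA; apply: (cdotE hA (sumle_sq_conj hA)).
have E n : \sum_(j < n) a j * (a j)^*%C = (\sum_(j < n) sq a j)%:C%C.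
  by rewrite rmorph_sum; apply: eq_bigr => j _; exact: mul_conj.
split; under eq_fun do rewrite E /=; last exact: cvg_cst.
exact: rsum_cvg (sq_ge0 a) hA.
Qed.

End square_summable.

(** * Greedy orthonormalization *)
Section linear_forms.
Variables (R : realType) (E : lmodType R[i]).

Definition lin_form (f : E -> R[i]) :=
  forall c x y, f (c *: x + y) = c * f x + f y.

Variable f : E -> R[i].
Hypothesis fL : lin_form f.

Lemma lin_form0 : f 0 = 0.
Proof.
by have := fL (-1) 0 0; rewrite scaler0 addr0 mulN1r addNr.
Qed.

Lemma lin_formZ c x : f (c *: x) = c * f x.
Proof. by have := fL c x 0; rewrite !addr0 lin_form0 addr0. Qed.

Lemma lin_formD x y : f (x + y) = f x + f y.
Proof. by have := fL 1 x y; rewrite scale1r mul1r. Qed.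

Lemma lin_formB x y : f (x - y) = f x - f y.
Proof. by rewrite addrC -scaleN1r fL mulN1r addrC. Qed.

Lemma lin_form_sum I (r : seq I) (c : I -> R[i]) (x : I -> E) :
  f (\sum_(i <- r) c i *: x i) = \sum_(i <- r) c i * f (x i).
Proof.
elim: r => [|i r IH]; first by rewrite !big_nil lin_form0.
by rewrite !big_cons fL IH.
Qed.

End linear_forms.

Lemma le_four_of_half (R : realFieldType) (s r : R) :
  0 < s -> s - s / 2 < r -> s <= 4 * r.
Proof. by move=> *; lra. Qed.

Section hermitian_form.
Variables (R : realType) (E : lmodType R[i]) (D : set E).
Variables (ip : E -> E -> R[i]) (h2 : E -> R).
Hypothesis D0 : D 0.
Hypothesis DL : forall c x y, D x -> D y -> D (c *: x + y).
Hypothesis ipL : forall c x y z, D x -> D y -> D z ->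
  ip (c *: x + y) z = c * ip x z + ip y z.
Hypothesis ipC : forall x y, D x -> D y -> ip y x = (ip x y)^*%C.
Hypothesis ipS : forall x, D x -> ip x x = (h2 x)%:C%C.
Hypothesis h2_ge0 : forall x, D x -> 0 <= h2 x.

Lemma subspace_sum I (r : seq I) (c : I -> R[i]) (x : I -> E) :
  (forall i, D (x i)) -> D (\sum_(i <- r) c i *: x i).
Proof.
move=> Dx; elim: r => [|i r IH]; first by rewrite big_nil.
by rewrite big_cons; exact: DL.
Qed.

Lemma subspaceB x y : D x -> D y -> D (x - y).
Proof. by move=> Dx Dy; rewrite addrC -scaleN1r; exact: DL. Qed.

Lemma ip0l z : D z -> ip 0 z = 0.
Proof.
move=> Dz; have := ipL (-1) D0 D0 Dz.
by rewrite scaler0 addr0 mulN1r addNr.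
Qed.

Lemma ip0r z : D z -> ip z 0 = 0.
Proof. by move=> Dz; rewrite (ipC D0 Dz) ip0l // conjc0. Qed.

Lemma ip_suml I (r : seq I) (c : I -> R[i]) (x : I -> E) z :
  (forall i, D (x i)) -> D z ->
  ip (\sum_(i <- r) c i *: x i) z = \sum_(i <- r) c i * ip (x i) z.
Proof.
move=> Dx Dz; elim: r => [|i r IH]; first by rewrite !big_nil ip0l.
by rewrite !big_cons ipL ?IH //; exact: subspace_sum.
Qed.

Lemma ip_sumr I (r : seq I) (c : I -> R[i]) (x : I -> E) z :
  (forall i, D (x i)) -> D z ->
  ip z (\sum_(i <- r) c i *: x i) = \sum_(i <- r) (c i)^*%C * ip z (x i).
Proof.
move=> Dx Dz; rewrite (ipC (subspace_sum _ _ Dx) Dz) ip_suml // rmorph_sum.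
by apply: eq_bigr => i _; rewrite rmorphM (ipC (Dx i) Dz).
Qed.

Lemma ipBl x y z : D x -> D y -> D z -> ip (x - y) z = ip x z - ip y z.
Proof.
by move=> Dx Dy Dz; rewrite addrC -scaleN1r ipL // mulN1r addrC.
Qed.

(** Null vectors are allowed: the greedy process outputs [0] once nothing is left
    to approximate. *)
Definition orthonormal (e : nat -> E) N :=
  [/\ forall i, D (e i),
      forall i j, (i < N)%N -> (j < N)%N -> i != j -> ip (e i) (e j) = 0 &
      forall i, (i < N)%N -> e i = 0 \/ ip (e i) (e i) = 1].

Definition proj (e : nat -> E) N x := \sum_(i < N) ip x (e i) *: e i.
Definition res (e : nat -> E) N x := x - proj e N x.

Section orthonormal_theory.
Variables (e : nat -> E) (N : nat).
Hypothesis eN : orthonormal e N.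

Lemma orthonormalD i : D (e i). Proof. by case: eN. Qed.

Lemma projD x : D (proj e N x).
Proof. by apply: subspace_sum => i; exact: orthonormalD. Qed.

Lemma resD x : D x -> D (res e N x).
Proof. by move=> Dx; apply: subspaceB => //; exact: projD. Qed.

Lemma ip_unit x i : D x -> (i < N)%N -> ip x (e i) * ip (e i) (e i) = ip x (e i).
Proof.
move=> Dx iN; case: eN => _ _ /(_ i iN)[->|->]; last by rewrite mulr1.
by rewrite ip0r // mul0r.
Qed.

Lemma ip_combo (c : nat -> R[i]) j : (j < N)%N ->
  ip (\sum_(i < N) c i *: e i) (e j) = c j * ip (e j) (e j).
Proof.
move=> jN; rewrite ip_suml => [|i|]; try exact: orthonormalD.
rewrite (bigD1 (Ordinal jN)) //= big1 ?addr0 // => i ij.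
case: eN => _ /(_ i j (ltn_ord i) jN) -> //; last by rewrite mulr0.
Qed.

Lemma ip_res x j : D x -> (j < N)%N -> ip (res e N x) (e j) = 0.
Proof.
move=> Dx jN; rewrite ipBl //; try exact: orthonormalD; try exact: projD.
by rewrite (ip_combo (fun i => ip x (e i))) // ip_unit // subrr.
Qed.

Lemma ip_res_self x : D x -> ip (res e N x) x = (h2 (res e N x))%:C%C.
Proof.
move=> Dx; have Dr := resD Dx; have Dp := projD x.
rewrite -ipS // {3}/res.
rewrite (ipC (subspaceB Dx Dp) Dr) ipBl // rmorphB /= -(ipC Dx Dr) -(ipC Dp Dr).
rewrite [X in _ - X]ip_sumr // => [|i]; last exact: orthonormalD.
by rewrite big1 ?subr0 // => i _; rewrite ip_res ?mulr0.
Qed.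

Lemma h2_res x : D x ->
  h2 (res e N x) = h2 x - \sum_(i < N) cabs (ip x (e i)) ^+ 2.
Proof.
move=> Dx; apply: complexI; rewrite -ip_res_self //.
rewrite rmorphB /= -ipS // rmorph_sum /= ipBl //; last exact: projD.
congr (_ - _); rewrite ip_suml // => [|i]; last exact: orthonormalD.
apply: eq_bigr => i _; rewrite -mul_conj -ipC //; exact: orthonormalD.
Qed.

Lemma bessel x : D x -> \sum_(i < N) cabs (ip x (e i)) ^+ 2 <= h2 x.
Proof. by move=> Dx; rewrite -subr_ge0 -h2_res // h2_ge0 //; exact: resD. Qed.

Lemma h2_combo (c : nat -> R[i]) :
  h2 (\sum_(i < N) c i *: e i) <= \sum_(i < N) cabs (c i) ^+ 2.
Proof.
have De i : D (e i) by exact: orthonormalD.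
rewrite -lecR -ipS; last exact: subspace_sum.
rewrite ip_sumr //; last exact: subspace_sum.
rewrite rmorph_sum /=; apply: ler_sum => i _.
rewrite ip_combo // -mul_conj mulrCA mulrA.
case: eN => _ _ /(_ i (ltn_ord i))[->|->]; last by rewrite mulr1.
by rewrite ip0l // mulr0 mulcJ_ge0.
Qed.

(** On the combination [z] of the [e i] with coefficients the conjugates of
    [f (e i)], the bound on [f] reads [S^2 <= t S], where [S] is the sum to be
    estimated. *)
Lemma bessel_form (f : E -> R[i]) t : lin_form f ->
  (forall x, D x -> cabs (f x) ^+ 2 <= t * h2 x) ->
  0 <= t -> \sum_(i < N) cabs (f (e i)) ^+ 2 <= t.
Proof.
move=> fL ft t0; set S := \sum_(i < N) _.
have De i : D (e i) by exact: orthonormalD.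
have S0 : 0 <= S by apply: sumr_ge0 => i _; rewrite sqr_ge0.
pose z := \sum_(i < N) (f (e i))^*%C *: e i.
have Dz : D z by exact: subspace_sum.
have fz : f z = S%:C%C.
  rewrite (lin_form_sum fL) rmorph_sum; apply: eq_bigr => i _.
  by rewrite mulrC mul_conj.
have hz : h2 z <= S.
  apply: le_trans (h2_combo (fun i => (f (e i))^*%C)) _.
  by under eq_bigr do rewrite cabs_conj.
have := ft _ Dz; rewrite fz cabsR ger0_norm // => h.
have {h}: S * S <= t * S by rewrite -expr2 (le_trans h) // ler_wpM2l.
have [->//|Sn0] := eqVneq S 0.
by rewrite ler_pM2r // lt_neqAle eq_sym Sn0.
Qed.

End orthonormal_theory.

Section greedy.
Variables (B : set E) (C : R).
Hypothesis BD : B `<=` D.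
Hypothesis B0 : B !=set0.
Hypothesis BC : forall x, B x -> h2 x <= C.

(** A residual of largest norm on [B] need not exist; the factor [4] leaves room for a
    vector that nearly attains the supremum. *)
Let worst (p : E -> E) y :=
  B y /\ forall x, B x -> h2 (x - p x) <= 4 * h2 (y - p y).

(** The recursion runs on the list of the vectors built so far, and each step
    appends the normalized residual of a worst approximated element of [B]. *)
Let gram_schmidt_rec : exists e y : nat -> E, forall N,
  e N = ((Num.sqrt (h2 (res e N (y N))))^-1)%:C%C *: res e N (y N) /\
  y N = xget 0 (worst (proj e N)).
Proof.
pose lproj (l : seq E) x := \sum_(v <- l) ip x v *: v.
pose pick l := xget 0 (worst (lproj l)).
pose step l : E := let z := pick l - lproj l (pick l) in
  ((Num.sqrt (h2 z))^-1)%:C%C *: z.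
pose steps := fix steps N := if N is M.+1 then rcons (steps M) (step (steps M)) else [::].
pose e N := step (steps N).
have lprojE N : lproj (steps N) = proj e N.
  apply/funext => x; have -> : steps N = mkseq e N.
    by elim: N => //= N IH; rewrite mkseqS -IH.
  rewrite /lproj /mkseq big_map /proj -(big_mkord xpredT (fun i => ip x (e i) *: e i)).
  by rewrite /index_iota subn0.
exists e, (pick \o steps) => N; split; last by rewrite /= /pick lprojE.
by rewrite {1}/e /step lprojE.
Qed.

Section recursion.
Variables e y : nat -> E.
Hypothesis eE : forall N, e N = ((Num.sqrt (h2 (res e N (y N))))^-1)%:C%C *: res e N (y N).
Hypothesis yE : forall N, y N = xget 0 (worst (proj e N)).

Let yD N : D (y N).
Proof. by rewrite yE; case: xgetP => [z _ [/BD]|]. Qed.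

Let eD N : D (e N).
Proof.
elim/ltn_ind: N => N IH; rewrite eE -[X in D X]addr0; apply: DL => //.
by apply: subspaceB => //; apply: subspace_sum => i; exact: IH.
Qed.

Let yP N : orthonormal e N -> B (y N) /\
  forall x, B x -> h2 (res e N x) <= 4 * h2 (res e N (y N)).
Proof.
move=> eN; rewrite yE; case: xgetP => [//|no].
exfalso; case: B0 => b Bb.
pose A := [set h2 (res e N x) | x in B].
have A0 : has_sup A.
  split; first by exists (h2 (res e N b)); exists b.
  exists C => _ [x Bx <-]; rewrite (h2_res eN (BD Bx)).
  by apply: le_trans (BC Bx); rewrite gerBl sumr_ge0 // => i _; exact: sqr_ge0.
have leA x : B x -> h2 (res e N x) <= sup A.
  by move=> Bx; apply: sup_upper_bound => //; exists x.
have [s0|s0] := ltP 0 (sup A).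
  have [|_ [z Bz <-] hz] := sup_adherent (eps := sup A / 2) _ A0.
    by rewrite divr_gt0.
  apply: (no z); split=> // x Bx.
  by apply: le_trans (leA _ Bx) (le_four_of_half s0 hz).
apply: (no b); split=> // x Bx.
apply: le_trans (leA _ Bx) (le_trans s0 _).
by rewrite mulr_ge0 // h2_ge0 //; apply: (resD eN); exact: BD.
Qed.

Let e_next N : orthonormal e N -> orthonormal e N.+1.
Proof.
move=> eN; have [_ eo en] := eN.
have Dr := resD eN (yD N).
have oN j : (j < N)%N -> ip (e N) (e j) = 0.
  move=> jN; rewrite eE -[_ *: _]addr0 ipL //.
  by rewrite (ip_res eN) // mulr0 ip0l // addr0.
split=> // [i j|i].
  rewrite ltnS leq_eqVlt => /predU1P[->|iN];
    rewrite ltnS leq_eqVlt => /predU1P[->|jN].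
  - by rewrite eqxx.
  - by move=> _; exact: oN.
  - by move=> _; rewrite (ipC (eD N) (eD i)) oN // conjc0.
  - exact: eo.
rewrite ltnS leq_eqVlt => /predU1P[->|]; last exact: en.
set z := res e N (y N) in Dr.
have := eE N; rewrite -/z.
have [z0 ->|z0 ->] := eqVneq (h2 z) 0.
  by left; rewrite z0 sqrtr0 invr0 scale0r.
right; have Dcz c : D (c *: z) by rewrite -[_ *: _]addr0; exact: DL.
have ZL c w : D w -> ip (c *: z) w = c * ip z w.
  by move=> Dw; rewrite -[_ *: _]addr0 ipL // ip0l // addr0.
rewrite ZL // (ipC (Dcz _) Dr) ZL // conjcM conjc_real ipS // conjc_real.
rewrite -!rmorphM; congr (_%:C%C).
rewrite mulrA -expr2 exprVn sqr_sqrtr ?h2_ge0 // mulVf //.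
Qed.

Lemma greedy_rec N : orthonormal e N /\ exists2 z, B z & forall x, B x ->
    h2 (res e N x) <= 4 * cabs (ip z (e N)) ^+ 2.
Proof.
have eN : orthonormal e N.
  by elim: N => [|N]; [split|exact: e_next].
have [By hy] := yP eN.
split=> //; exists (y N) => // x /hy /le_trans; apply.
rewrite ler_pM2l //.
have Dr := resD eN (yD N).
have -> : ip (y N) (e N) = (Num.sqrt (h2 (res e N (y N))))%:C%C.
  rewrite (ipC (eD N) (yD _)) eE -[_ *: _]addr0 ipL //.
  rewrite ip0l // addr0 (ip_res_self eN) // conjcM !conjc_real.
  rewrite -rmorphM; congr (_%:C%C).
  have h0 := h2_ge0 Dr; rewrite -{2}[h2 _]sqr_sqrtr //.
  have [->|r0] := eqVneq (Num.sqrt (h2 (res e N (y N)))) 0; first by rewrite expr2 !mulr0.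
  by rewrite expr2 mulKf.
by rewrite cabsR ger0_norm ?sqrtr_ge0 // sqr_sqrtr ?h2_ge0.
Qed.

End recursion.

(** Choosing a worst approximated element at each step bounds the residuals of all
    of [B] by a single coefficient on the newest vector. Totality of the basis
    thus reduces to the decay of coefficients, and no completion is needed. *)
Lemma greedy_orthonormalization : exists e, forall N, orthonormal e N /\
  exists2 z, B z & forall x, B x ->
    h2 (res e N x) <= 4 * cabs (ip z (e N)) ^+ 2.
Proof.
have [e [y ey]] := gram_schmidt_rec.
by exists e; apply: (@greedy_rec e y) => N; have [] := ey N.
Qed.

End greedy.

End hermitian_form.

(** * Pre-Hilbert spaces given by square summable systems of forms *)
Section square_summable_system.
Variables (R : realType) (E : lmodType R[i]) (D B : set E).
Variables (G : nat -> E -> R[i]) (s : nat -> R) (S : R).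
Hypothesis D0 : D 0.
Hypothesis DL : forall c x y, D x -> D y -> D (c *: x + y).
Hypothesis GL : forall j, lin_form (G j).
Hypothesis sS : sumle (fun j => s j ^+ 2) S.
Hypothesis BD : B `<=` D.
Hypothesis B0 : B 0.
Hypothesis DB : forall x, D x -> exists (c : R[i]) b, B b /\ x = c *: b.
Hypothesis BG : forall x j, B x -> cabs (G j x) <= s j.

(** The square norm pulled back from square summable sequences along
    [x |-> (G j x)_j]. The set [B] stands for the unit ball of a norm for which
    the forms [G j] have norms at most [s j]; with respect to that norm the
    pullback is of Hilbert-Schmidt type. *)
Definition hilbert_sq (x : E) : R := rsum (sq (G^~ x)).
Local Notation h2 := hilbert_sq.
Let ip (x y : E) : R[i] := cdot (G^~ x) (fun j => (G j y)^*%C).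

Let sB x : B x -> sumle (sq (G^~ x)) S.
Proof.
move=> Bx; apply: le_sumle sS => j.
by rewrite /sq ler_pXn2r ?nnegrE ?cabs_ge0 ?BG // (le_trans (cabs_ge0 _) (BG _ Bx)).
Qed.

Lemma hilbert_sumle x : D x -> sumle (sq (G^~ x)) (h2 x).
Proof.
move=> /DB[c [b [Bb ->]]].
apply: (sumle_rsum (M := cabs c ^+ 2 * S)) => [j|]; first exact: sq_ge0.
apply: le_sumle (sumleZ (sqr_ge0 (cabs c)) (sB Bb)) => j.
by rewrite /sq (lin_formZ (GL j)) cabsM exprMn.
Qed.

Let hermL c x y z : D x -> D y -> D z -> ip (c *: x + y) z = c * ip x z + ip y z.
Proof.
move=> Dx Dy Dz.
rewrite -(cdot_linl c (hilbert_sumle Dx) (hilbert_sumle Dy) (sumle_sq_conj (hilbert_sumle Dz))).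
by congr cdot; apply/funext => j; rewrite GL.
Qed.

Let hermC x y : D x -> D y -> ip y x = (ip x y)^*%C.
Proof.
move=> Dx Dy.
rewrite -(cdot_conj (hilbert_sumle Dx) (sumle_sq_conj (hilbert_sumle Dy))) cdotC.
by congr cdot; apply/funext => j; rewrite conjcK.
Qed.

Let hermS x : D x -> ip x x = (h2 x)%:C%C.
Proof. by move=> Dx; exact: cdot_self (hilbert_sumle Dx). Qed.

Lemma hilbert_ge0 x : D x -> 0 <= h2 x.
Proof. by move=> Dx; exact: sumle_ge0 (hilbert_sumle Dx). Qed.

Lemma hilbert_le x M : sumle (sq (G^~ x)) M -> h2 x <= M.
Proof. by apply: rsum_le; exact: sq_ge0. Qed.

Lemma cabs_le_hilbert j x : D x -> cabs (G j x) ^+ 2 <= h2 x.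
Proof. by move=> Dx; exact: le_term_rsum (sq_ge0 _) (hilbert_sumle Dx). Qed.

Definition bounded_form (f : E -> R[i]) (t : R) :=
  [/\ lin_form f, 0 <= t & forall x, D x -> cabs (f x) ^+ 2 <= t * h2 x].

Lemma bounded_form_coord j : bounded_form (G j) 1.
Proof.
split=> // x Dx; rewrite mul1r; exact: cabs_le_hilbert.
Qed.

Section basis.
Variable e : nat -> E.
Hypothesis eP : forall N, orthonormal D ip e N /\
  exists2 z, B z & forall x, B x ->
    h2 (res ip e N x) <= 4 * cabs (ip z (e N)) ^+ 2.

Let eN N : orthonormal D ip e N. Proof. by have [] := eP N. Qed.

Let eD i : D (e i). Proof. by have [] := eN 0. Qed.

Lemma bessel_bounded f t : bounded_form f t -> sumle (fun i => cabs (f (e i)) ^+ 2) t.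
Proof.
move=> [fL t0 ft] N; exact: (bessel_form D0 DL hermL hermC hermS (eN N) fL ft t0).
Qed.

Let h2e i : h2 (e i) <= 1.
Proof.
have [_ _ /(_ i (ltnSn i))[->|e1]] := eN i.+1; rewrite -lecR -hermS //.
  by rewrite (ip0l D0 hermL D0) ler01.
by rewrite e1.
Qed.

(** Coefficients on the basis tend to [0] uniformly on [B]: the coordinates [G j]
    with [j >= J] are small on [B] because [s] is square summable, and each of
    the finitely many others is square summable along the basis. *)
Let ip_basis_small eps : 0 < eps -> exists N0, forall N z, (N0 <= N)%N -> B z ->
  cabs (ip z (e N)) ^+ 2 <= eps.
Proof.
move=> eps0; have S0 := sumle_ge0 sS.
have [|J hJ] := sumle_tail (e := eps / 4) (fun j => sqr_ge0 (s j)) sS.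
  by rewrite divr_gt0.
pose a N := \sum_(j < J) cabs (G j (e N)) ^+ 2.
have aJ : sumle a J%:R.
  move=> N; rewrite /a exchange_big /= -[leRHS]mulr1 mulr_natl -[X in _ *+ X]card_ord -sumr_const.
  by apply: ler_sum => j _; exact: bessel_bounded (bounded_form_coord j) N.
have a0 N : 0 <= a N by apply: sumr_ge0 => j _; exact: sqr_ge0.
have [|N0 hN0] := sumle_tail (e := eps / (4 * (S + 1))) a0 aJ.
  by rewrite divr_gt0 ?mulr_gt0 ?ltr_wpDl.
exists N0 => N z N0N Bz.
have {hN0} aN : a N <= eps / (4 * (S + 1)).
  by have := hN0 N N.+1 N0N; rewrite big_nat1.
have Dz := BD Bz.
have cl := cdot_clim (hilbert_sumle Dz) (sumle_sq_conj (hilbert_sumle (eD N))).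
rewrite -[leRHS]sqr_sqrtr ?(ltW eps0) // ler_pXn2r ?nnegrE ?cabs_ge0 ?sqrtr_ge0 //.
have := clim_cabs cl; rewrite -/(ip z (e N)) => cv.
rewrite -(cvg_lim _ cv) //; apply: limr_le; first exact: cvgP cv.
exists J => // n Jn.
rewrite -(@ler_pXn2r _ 2) ?nnegrE ?cabs_ge0 ?sqrtr_ge0 // sqr_sqrtr ?(ltW eps0) //.
rewrite -(big_mkord xpredT (fun j => G j z * (G j (e N))^*%C)).
rewrite (big_cat_nat (leq0n J) Jn) /=.
set u := \sum_(0 <= j < J) _; set v := \sum_(J <= j < n) _.
have hu : cabs u ^+ 2 <= eps / 4.
  apply: le_trans (cabs_CS _ _ _) _; rewrite !big_mkord.
  apply: (@le_trans _ _ (S * a N)).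
    apply: ler_pM; try by apply: sumr_ge0 => *; exact: sqr_ge0.
      exact: sB Bz J.
    by under eq_bigr do rewrite cabs_conj.
  apply: le_trans (ler_wpM2l S0 aN) _.
  rewrite mulrCA ler_pM2l // invfM mulrCA ler_piMr ?invr_ge0 //.
  by rewrite ler_pdivrMr ?mul1r ?lerDl ?ltr_wpDl.
have hv : cabs v ^+ 2 <= eps / 4.
  apply: le_trans (cabs_CS _ _ _) _; rewrite -[leRHS]mulr1.
  apply: ler_pM; try by apply: sumr_ge0 => *; exact: sqr_ge0.
    apply: le_trans (hJ J n (leqnn J)); apply: ler_sum => j _.
    by rewrite ler_pXn2r ?nnegrE ?cabs_ge0 ?BG // (le_trans (cabs_ge0 _) (BG _ Bz)).
  apply: le_trans (h2e N); apply: le_trans (hilbert_sumle (eD N) n).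
  rewrite -(big_mkord xpredT (sq (G^~ (e N)))) [leRHS](big_cat_nat (leq0n J) Jn) /=.
  rewrite /sq; under eq_bigr do rewrite cabs_conj.
  by rewrite lerDr sumr_ge0 // => j _; exact: sqr_ge0.
have := cabsD u v; have := cabs_ge0 (u + v); have := cabs_ge0 u; have := cabs_ge0 v.
move: (cabs u) (cabs v) (cabs (u + v)) hu hv => a1 b1 c1 hu hv b10 a10 c10 h.
have := sqr_ge0 (a1 - b1).
rewrite !expr2 in hu hv *; nra.
Qed.

(** By greediness, residuals on [B] are bounded by coefficients, which tend to
    [0]: the basis is total. *)
Let res_cvg0 x : D x -> (fun N => h2 (res ip e N x)) @ \oo --> (0 : R).
Proof.
move=> Dx; have [c [b [Bb xE]]] := DB Dx; have Db := BD Bb.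
have Dr y N : D y -> D (res ip e N y) by move=> Dy; exact: (resD D0 DL (eN N)).
have hres N : h2 (res ip e N x) = cabs c ^+ 2 * h2 (res ip e N b).
  have Z : D (c *: b) by rewrite -xE.
  rewrite !(h2_res D0 DL hermL hermC hermS (eN N)) // xE mulrBr mulr_sumr; congr (_ - _).
    apply: complexI; rewrite -hermS // -{1}[c *: b]addr0 hermL //.
    rewrite (ip0l D0 hermL Z) addr0 (hermC Z Db) -{1}[c *: b]addr0 hermL //.
    rewrite (ip0l D0 hermL Db) addr0 conjcM hermS // conjc_real.
    by rewrite mulrA mul_conj -rmorphM.
  apply: eq_bigr => i _; rewrite -exprMn -cabsM -{1}[c *: b]addr0 hermL //.
  by rewrite (ip0l D0 hermL (eD i)) addr0.
apply/cvgr0Pnorm_lt => eps eps0.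
have c1 : 0 < cabs c ^+ 2 + 1 by rewrite ltr_wpDl ?sqr_ge0.
have [|N0 hN0] := ip_basis_small (eps := eps / (5 * (cabs c ^+ 2 + 1))).
  by rewrite divr_gt0 // mulr_gt0.
exists N0 => // N /= N0N; rewrite ger0_norm ?hilbert_ge0 ?hres //; last exact: Dr.
have [_ [z Bz /(_ _ Bb) hz]] := eP N.
have := hN0 N z N0N Bz.
rewrite ler_pdivlMr ?mulr_gt0 // => h.
have : cabs c ^+ 2 * h2 (res ip e N b) <= (cabs c ^+ 2 + 1) * (4 * cabs (ip z (e N)) ^+ 2).
  by apply: ler_pM => //; [exact: sqr_ge0|exact/hilbert_ge0/Dr|rewrite lerDl].
move=> /le_lt_trans; apply.
move: h c1; set a := cabs c ^+ 2; set w := cabs (ip z (e N)) ^+ 2.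
have : 0 <= w by exact: sqr_ge0.
by move: a w => a w w0 h a1; nra.
Qed.

Let form_expansion f t x : bounded_form f t -> D x ->
  clim (fun N => \sum_(i < N) ip x (e i) * f (e i)) (f x).
Proof.
move=> [fL t0 ft] Dx.
apply: (clim_sandwich (b := fun N => Num.sqrt (t * h2 (res ip e N x)))) => [N|].
  rewrite -(lin_form_sum fL) cabsB -(lin_formB fL) -/(proj ip e N x).
  rewrite -(@ler_pXn2r _ 2) ?nnegrE ?cabs_ge0 ?sqrtr_ge0 //.
  have Dr : D (res ip e N x) by exact: (resD D0 DL (eN N)).
  by rewrite sqr_sqrtr ?ft // mulr_ge0 // hilbert_ge0.
rewrite -[X in _ --> X](sqrtr0 R).
apply: (@continuous_cvg _ _ _ _ _ _ (@Num.sqrt R)); first exact: sqrt_continuous.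
rewrite -[X in _ --> X](mulr0 t).
by apply: cvgM; [exact: cvg_cst|exact: res_cvg0].
Qed.

Lemma form_bound f t F x : bounded_form f t ->
  sumle (fun i => cabs (f (e i)) ^+ 2) F -> D x -> cabs (f x) ^+ 2 <= h2 x * F.
Proof.
move=> bf hF Dx; have h0 := hilbert_ge0 Dx; have F0 := sumle_ge0 hF.
rewrite -[leRHS]sqr_sqrtr ?mulr_ge0 // ler_pXn2r ?nnegrE ?cabs_ge0 ?sqrtr_ge0 //.
apply: (clim_cabs_le (form_expansion bf Dx)) => N.
rewrite -(@ler_pXn2r _ 2) ?nnegrE ?cabs_ge0 ?sqrtr_ge0 // sqr_sqrtr ?mulr_ge0 //.
apply: le_trans (cabs_CS _ _ _) _.
apply: ler_pM (hF N); try by apply: sumr_ge0 => *; exact: sqr_ge0.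
exact: (bessel D0 DL hermL hermC hermS hilbert_ge0 (eN N) Dx).
Qed.

(** The vector representing [f] has coefficients the conjugates of [f (e i)] and
    may lie outside of [E], in the completion; these are the conjugates of the
    values that the [G j] would take on it. *)
Definition riesz (f : E -> R[i]) j : R[i] :=
  cdot (fun i => f (e i)) (fun i => (G j (e i))^*%C).

Let coordL2 j : sumle (sq (fun i => (G j (e i))^*%C)) 1.
Proof.
by apply: sumle_sq_conj; exact: bessel_bounded (bounded_form_coord j).
Qed.

(** Up to conjugation the inner sums are the values of the [G j] at one vector
    [z] of [D], whose square norm is known by orthonormality. *)
Let synth_le (c : nat -> R[i]) N J :
  \sum_(j < J) cabs (\sum_(i < N) c i * (G j (e i))^*%C) ^+ 2 <=
  \sum_(i < N) cabs (c i) ^+ 2.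
Proof.
pose z := \sum_(i < N) (c i)^*%C *: e i.
have Dz : D z by exact: (subspace_sum D0 DL).
apply: (@le_trans _ _ (\sum_(j < J) sq (G^~ z) j)).
  apply: ler_sum => j _; rewrite /sq /z (lin_form_sum (GL j)).
  rewrite -[X in _ <= X ^+ 2]cabs_conj rmorph_sum /=.
  by under [in leRHS]eq_bigr do rewrite conjcM conjcK.
apply: le_trans (hilbert_sumle Dz J) _.
apply: le_trans (h2_combo D0 DL hermL hermC hermS (eN N) (fun i => (c i)^*%C)) _.
by under eq_bigr do rewrite cabs_conj.
Qed.

Let riesz_clim f t j : bounded_form f t ->
  clim (fun N => \sum_(i < N) f (e i) * (G j (e i))^*%C) (riesz f j).
Proof. by move=> bf; exact: cdot_clim (bessel_bounded bf) (coordL2 j). Qed.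

(** The bound does not depend on [J], hence passes to infinite sums. *)
Let riesz_tail f t N J eps : bounded_form f t ->
  (forall m, \sum_(N <= i < m) cabs (f (e i)) ^+ 2 <= eps) ->
  \sum_(j < J) cabs (riesz f j - \sum_(i < N) f (e i) * (G j (e i))^*%C) ^+ 2 <= eps.
Proof.
move=> bf tl.
pose u j M := \sum_(i < M) f (e i) * (G j (e i))^*%C - \sum_(i < N) f (e i) * (G j (e i))^*%C.
have cv : (fun M => \sum_(j < J) cabs (u j M) ^+ 2) @ \oo -->
    \sum_(j < J) cabs (riesz f j - \sum_(i < N) f (e i) * (G j (e i))^*%C) ^+ 2.
  elim: J => [|J IH].
    by rewrite big_ord0; under eq_fun do rewrite big_ord0; exact: cvg_cst.
  rewrite big_ord_recr; under eq_fun do rewrite big_ord_recr.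
  apply: cvgD IH _; rewrite expr2; under eq_fun do rewrite expr2.
  have h := clim_cabs (climD (riesz_clim J bf) (clim_cst (- \sum_(i < N) f (e i) * (G J (e i))^*%C))).
  exact: (cvgM h h).
rewrite -(cvg_lim _ cv) //; apply: limr_le; first exact: cvgP cv.
exists N => // M NM.
pose c i := if (i < N)%N then 0 else f (e i).
have uE j : u j M = \sum_(i < M) c i * (G j (e i))^*%C.
  rewrite /u -!(big_mkord xpredT (fun i => f (e i) * (G j (e i))^*%C)).
  rewrite -(big_mkord xpredT (fun i => c i * (G j (e i))^*%C)).
  rewrite !(big_cat_nat (leq0n N) NM) /= addrAC subrr add0r.
  rewrite [X in _ = X + _]big_nat_cond [X in _ = X + _]big1 ?add0r => [|i]; last first.
    by rewrite andbT /c => /andP[_ ->]; rewrite mul0r.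
  by rewrite !big_nat; apply: eq_bigr => i /andP[Ni _]; rewrite /c ltnNge Ni.
under eq_bigr do rewrite uE.
apply: le_trans (synth_le _ _ _) _; apply: le_trans (tl M).
rewrite -(big_mkord xpredT (fun i => cabs (c i) ^+ 2)) (big_cat_nat (leq0n N) NM) /=.
rewrite [X in X + _]big_nat_cond [X in X + _]big1 ?add0r => [|i]; last first.
  by rewrite andbT /c => /andP[_ ->]; rewrite cabs0 expr0n.
by rewrite !big_nat; apply: ler_sum => i /andP[Ni _]; rewrite /c ltnNge Ni.
Qed.

Lemma riesz_le f t : bounded_form f t -> sumle (sq (riesz f)) t.
Proof.
move=> bf J; rewrite /sq.
apply: le_trans (@riesz_tail f t 0 J t bf _) => [|m].
  by apply: ler_sum => j _; rewrite big_ord0 subr0.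
by rewrite big_mkord; exact: bessel_bounded bf m.
Qed.

Lemma riesz_linear c f g t u : bounded_form f t -> bounded_form g u ->
  forall j, riesz (fun x => c * f x + g x) j = c * riesz f j + riesz g j.
Proof.
move=> bf bg j.
exact: cdot_linl (bessel_bounded bf) (bessel_bounded bg) (coordL2 j).
Qed.

Lemma riesz_expansion f t x : bounded_form f t -> D x -> cdot (G^~ x) (riesz f) = f x.
Proof.
move=> bf Dx; have h0 := hilbert_ge0 Dx; have hx := hilbert_sumle Dx.
have cf := form_expansion bf Dx.
apply: clim_unique cf.
apply/climP; apply/cvgr0Pnorm_lt => eps eps0.
have h1 : 0 < h2 x + 1 by rewrite ltr_wpDl.
have [|N0 hN0] := sumle_tail (e := eps ^+ 2 / (2 * (h2 x + 1)))
    (fun i => sqr_ge0 (cabs (f (e i)))) (bessel_bounded bf).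
  by rewrite divr_gt0 ?mulr_gt0 // exprn_gt0.
exists N0 => // N /= N0N; rewrite ger0_norm ?cabs_ge0 // cabsB.
pose y j := \sum_(i < N) f (e i) * (G j (e i))^*%C.
have -> : \sum_(i < N) ip x (e i) * f (e i) = cdot (G^~ x) y.
  have yl2 : sumle (sq y) (\sum_(i < N) cabs (f (e i)) ^+ 2).
    by move=> J; exact: (synth_le (fun i => f (e i)) N J).
  apply/esym/(cdotE hx yl2).
  have := clim_sum (index_enum 'I_N) (fun i : 'I_N =>
    climM (cdot_clim hx (sumle_sq_conj (hilbert_sumle (eD i)))) (clim_cst (f (e i)))).
  rewrite (_ : (fun n => _) = (fun n => \sum_(j < n) G j x * y j)) //.
  apply/funext => n; under [RHS]eq_bigr do rewrite mulr_sumr.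
  rewrite exchange_big /=; apply: eq_bigr => i _; rewrite mulr_suml.
  by apply: eq_bigr => j _; rewrite mulrAC mulrA.
have yl2 : sumle (sq y) (\sum_(i < N) cabs (f (e i)) ^+ 2).
    by move=> J; exact: (synth_le (fun i => f (e i)) N J).
have -> : cdot (G^~ x) (riesz f) - cdot (G^~ x) y = cdot (G^~ x) (fun j => -1 * y j + riesz f j).
  rewrite [RHS]cdotC (cdot_linl (-1) yl2 (riesz_le bf) hx) !(cdotC _ (G^~ x)).
  by rewrite mulN1r addrC.
rewrite -(@ltr_pXn2r _ 2) ?nnegrE ?cabs_ge0 ?(ltW eps0) //.
have d2 : sumle (sq (fun j => -1 * y j + riesz f j)) (eps ^+ 2 / (2 * (h2 x + 1))).
  move=> J; rewrite /sq; under eq_bigr do rewrite mulN1r addrC.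
  by apply: (riesz_tail _ bf) => m; exact: hN0.
apply: le_lt_trans (cdot_le hx d2) _.
rewrite mulrA ltr_pdivrMr ?mulr_gt0 // mulrC ltr_pM2l ?exprn_gt0 //.
lra.
Qed.

End basis.

Lemma hilbert_basis_exists : exists e : nat -> E, forall N, orthonormal D ip e N /\
  exists2 z, B z & forall x, B x ->
    h2 (res ip e N x) <= 4 * cabs (ip z (e N)) ^+ 2.
Proof.
apply: (greedy_orthonormalization D0 DL hermL hermC hermS hilbert_ge0 (C := S) BD).
  by exists 0.
by move=> x Bx; exact/hilbert_le/sB.
Qed.

(** Bessel and Parseval for bounded forms, in a form that does not mention the
    inner product. *)
Lemma square_summable_basis : exists e : nat -> E,
  [/\ forall i, D (e i),
      forall f t, bounded_form f t -> sumle (fun i => cabs (f (e i)) ^+ 2) t &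
      forall f t F x, bounded_form f t ->
        sumle (fun i => cabs (f (e i)) ^+ 2) F -> D x ->
        cabs (f x) ^+ 2 <= h2 x * F].
Proof.
have [e eP] := hilbert_basis_exists; exists e; split.
- by move=> i; have [[]] := eP 0.
- exact: bessel_bounded.
- exact: form_bound.
Qed.

(** Riesz representation, linear in the form. A form is represented through its
    values on a basis lying in [D], so only its restriction to [D] matters. *)
Lemma square_summable_riesz : exists Y : (E -> R[i]) -> nat -> R[i],
  [/\ forall f t, bounded_form f t -> sumle (sq (Y f)) t,
      forall c f g t u, bounded_form f t -> bounded_form g u ->
        forall j, Y (fun x => c * f x + g x) j = c * Y f j + Y g j,
      forall f g, {in D, f =1 g} -> Y f = Y g &
      forall f t x, bounded_form f t -> D x -> cdot (G^~ x) (Y f) = f x].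
Proof.
have [e eP] := hilbert_basis_exists; exists (riesz e); split.
- exact: riesz_le.
- exact: riesz_linear.
- move=> f g fg; apply/funext => j; rewrite /riesz; congr cdot; apply/funext => i.
  by apply: fg; rewrite inE; have [[]] := eP 0.
- exact: riesz_expansion.
Qed.

End square_summable_system.

(** * The Hahn-Banach theorem for complex seminorms *)
Section hahn_banach.
Variables (R : realType) (E : lmodType R[i]).
Implicit Types (p q : E -> R) (x y z : E).

Definition sublinear q :=
  (forall x y, q (x + y) <= q x + q y) /\
  (forall (r : R) x, 0 < r -> q (r%:C%C *: x) <= r * q x).

Section sublinear_theory.
Variable q : E -> R.
Hypothesis qs : sublinear q.

Lemma sublinear0 : q 0 = 0.
Proof.
case: qs => _ qZ; have := qZ 2 0 (ltr0Sn _ 1); rewrite scaler0 => h2.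
have := qZ 2^-1 0; rewrite scaler0 invr_gt0 => /(_ (ltr0Sn _ 1)) h.
by lra.
Qed.

Lemma sublinearN x : - q (- x) <= q x.
Proof. by rewrite lerNl -subr_ge0 opprK -sublinear0 -(addNr x); exact: qs.1. Qed.

Lemma sublinearZ (r : R) x : 0 < r -> q (r%:C%C *: x) = r * q x.
Proof.
case: qs => _ qZ r0; apply/eqP; rewrite eq_le qZ //=.
have := qZ r^-1 (r%:C%C *: x); rewrite invr_gt0 => /(_ r0).
rewrite scalerA -rmorphM mulVf ?gt_eqF // scale1r.
by rewrite ler_pdivlMl.
Qed.

(** Lowering [q] makes it additive in the direction [y], so that a minimal
    sublinear functional, which cannot be lowered, is additive. *)
Definition lowered y x : R :=
  inf [set q (x + t%:C%C *: y) - t * q y | t in [set t | 0 <= t]].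

Let lowered_has_inf y x :
  has_inf [set q (x + t%:C%C *: y) - t * q y | t in [set t | 0 <= t]].
Proof.
split; first by exists (q (x + 0%:C%C *: y) - 0 * q y); exists 0 => /=.
exists (- q (- x)) => _ [t t0 <-].
have [->|tn0] := eqVneq t 0.
  by rewrite scale0r addr0 mul0r subr0; exact: sublinearN.
have {}t0 : 0 < t by rewrite lt_neqAle eq_sym tn0.
rewrite -(sublinearZ _ t0); have := qs.1 (x + t%:C%C *: y) (- x).
by rewrite addrAC subrr add0r => h; lra.
Qed.

Lemma lowered_le y x t : 0 <= t -> lowered y x <= q (x + t%:C%C *: y) - t * q y.
Proof. by move=> t0; apply: ge_inf; [have [] := lowered_has_inf y x|exists t]. Qed.

Lemma le_lowered y x m :
  (forall t, 0 <= t -> m <= q (x + t%:C%C *: y) - t * q y) -> m <= lowered y x.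
Proof.
move=> h; apply: lb_le_inf; first by have [] := lowered_has_inf y x.
by move=> _ [t t0 <-]; exact: h.
Qed.

Lemma lowered_le_self y x : lowered y x <= q x.
Proof.
by have := @lowered_le y x 0 (lexx 0); rewrite scale0r addr0 mul0r subr0.
Qed.

Lemma lowered_le1 y x : lowered y x <= q (x + y) - q y.
Proof. by have := @lowered_le y x 1 ler01; rewrite scale1r mul1r. Qed.

Lemma lowered_sublinear y : sublinear (lowered y).
Proof.
split=> [x1 x2|r x r0].
  rewrite -lerBlDr; apply: le_lowered => t1 t10; rewrite lerBlDr [leRHS]addrC -lerBlDr.
  apply: le_lowered => t2 t20; rewrite lerBlDr.
  apply: le_trans (lowered_le y _ (addr_ge0 t10 t20)) _.
  rewrite mulrDl opprD rmorphD scalerDl.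
  have := qs.1 (x1 + t1%:C%C *: y) (x2 + t2%:C%C *: y).
  rewrite addrACA => h; lra.
rewrite -ler_pdivrMl //; apply: le_lowered => t t0.
rewrite ler_pdivrMl // mulrBr -sublinearZ // scalerDr scalerA -rmorphM mulrA.
by apply: lowered_le; rewrite mulr_ge0 // ltW.
Qed.

End sublinear_theory.

(** Zorn's lemma applies because the pointwise infimum of a chain of sublinear
    functionals below [p] is sublinear; it is finite, being at least
    [- p (- x)]. *)
Lemma minimal_sublinear p : sublinear p -> exists q, [/\ sublinear q,
  forall x, q x <= p x &
  forall q', sublinear q' -> (forall x, q' x <= q x) -> q' = q].
Proof.
move=> ps; pose T := {q : E -> R | sublinear q /\ forall x, q x <= p x}.
pose le (a b : T) := `[< forall x, sval b x <= sval a x >].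
have [a|a b c /asboolP ab /asboolP bc||A tot|t tmin] := @Zorn T le.
- exact/asboolP.
- by apply/asboolP => x; exact: le_trans (bc x) (ab x).
- move=> [a ha] [b hb] /asboolP ab /asboolP ba; apply: eq_exist; apply/funext => x.
  by apply/eqP; rewrite eq_le; apply/andP; split; [exact: ba|exact: ab].
- have [[a0 Aa0]|A0] := pselect (A !=set0); last first.
    exists (exist _ p (conj ps (fun x => lexx (p x)))) => s As; apply/asboolP.
    by case: A0; exists s.
  pose V x := [set sval a x | a in A].
  have V0 x : V x !=set0 by exists (sval a0 x), a0.
  have Vb x : has_lbound (V x).
    exists (- p (- x)) => _ [a _ <-]; case: (svalP a) => sa ap.
    by apply: le_trans (sublinearN sa x); rewrite lerN2.
  pose m x := inf (V x).
  have mle x a : A a -> m x <= sval a x by move=> Aa; apply: ge_inf => //; exists a.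
  have lem x r : (forall a, A a -> r <= sval a x) -> r <= m x.
    by move=> h; apply: lb_le_inf => // _ [a Aa <-]; exact: h.
  have ms : sublinear m.
    split=> [x y|r x r0].
      rewrite -lerBlDr; apply: (lem x) => a Aa; rewrite lerBlDr [leRHS]addrC -lerBlDr.
      apply: (lem y) => b Ab; rewrite lerBlDr.
      have [/asboolP ab|/asboolP ba] := tot a b Aa Ab.
        apply: le_trans (mle _ _ Ab) _; apply: le_trans ((svalP b).1.1 x y) _.
        by rewrite addrC lerD2l; exact: ab.
      apply: le_trans (mle _ _ Aa) _; apply: le_trans ((svalP a).1.1 x y) _.
      by rewrite addrC lerD2r; exact: ba.
    rewrite -ler_pdivrMl //; apply: (lem x) => a Aa; rewrite ler_pdivrMl //.
    by apply: le_trans (mle _ _ Aa) _; exact: (svalP a).1.2.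
  have mp x : m x <= p x.
    by apply: le_trans (mle _ _ Aa0) _; exact: (svalP a0).2.
  by exists (exist _ m (conj ms mp)) => a Aa; apply/asboolP => x; exact: mle.
exists (sval t); case: (svalP t) => ts tp; split=> // q' q's q't.
have q'p x : q' x <= p x by apply: le_trans (q't x) (tp x).
by have /(_ (asboolT q't)) <- := tmin (exist _ q' (conj q's q'p)).
Qed.

Lemma minimal_sublinear_add q : sublinear q ->
  (forall q', sublinear q' -> (forall x, q' x <= q x) -> q' = q) ->
  forall x y, q (x + y) = q x + q y.
Proof.
move=> qs qmin x y; apply/eqP; rewrite eq_le qs.1 /= -lerBrDr.
rewrite -{1}(qmin _ (lowered_sublinear qs y) (lowered_le_self qs y)).
exact: lowered_le1.
Qed.

(** Minimizing below [p] lowered in the direction [z] forces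
    [u (- z) <= p 0 - p z], that is, [p z <= u z]. *)
Lemma real_hahn_banach p z : sublinear p -> exists u : E -> R,
  [/\ forall x y, u (x + y) = u x + u y,
      forall (r : R) x, u (r%:C%C *: x) = r * u x,
      forall x, u x <= p x & p z <= u z].
Proof.
move=> ps; have [u [us up umin]] := minimal_sublinear (lowered_sublinear ps z).
have uD := minimal_sublinear_add us umin.
have uN x : u (- x) = - u x.
  by apply/eqP; rewrite -addr_eq0 -uD addNr sublinear0.
exists u; split=> // [r x|x|].
- have [r0|r0|->] := ltgtP r 0; last by rewrite scale0r mul0r sublinear0.
    by rewrite -[r]opprK rmorphN scaleNr uN (sublinearZ us) ?oppr_gt0 // [in RHS]mulNr.
  exact: sublinearZ.
- exact: le_trans (up x) (lowered_le_self ps z x).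
- rewrite -lerN2 -uN; apply: le_trans (up _) _; apply: le_trans (lowered_le1 ps _ _) _.
  by rewrite addNr sublinear0 // sub0r.
Qed.

(** A real functional [u] is the real part of the complex form
    [u x - i u (i x)]. Rotating [x] so that this form takes a nonnegative value
    bounds its modulus by [p x]. *)
Theorem hahn_banach p z :
  (forall x y, p (x + y) <= p x + p y) ->
  (forall c x, p (c *: x) = cabs c * p x) ->
  exists u : E -> R[i], [/\ lin_form u, forall x, cabs (u x) <= p x &
    u z = (p z)%:C%C].
Proof.
move=> pD pZ.
have ps : sublinear p.
  by split=> // r x r0; rewrite pZ cabsR ger0_norm // ltW.
have [u [uD uZ up uz]] := real_hahn_banach z ps.
pose w x : R[i] := Complex (u x) (- u ('i%C *: x)).
have wD x y : w (x + y) = w x + w y.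
  by rewrite /w scalerDr !uD opprD.
have wr (r : R) x : w (r%:C%C *: x) = r%:C%C * w x.
  rewrite /w scalerA mulrC -scalerA !uZ; apply/eqP; rewrite eq_complex /=.
  by rewrite !mul0r subr0 addr0 mulrN !eqxx.
have wi x : w ('i%C *: x) = 'i%C * w x.
  have uN v : u (- v) = - u v by have := uZ (-1) v; rewrite rmorphN scaleN1r mulN1r.
  rewrite /w scalerA -expr2 sqr_i scaleN1r uN opprK.
  by apply/eqP; rewrite eq_complex /=; apply/andP; split; apply/eqP; ring.
have wZ c x : w (c *: x) = c * w x.
  rewrite {1}[c]complexE scalerDl wD wr -scalerA wi wr mulrA -mulrDl.
  by rewrite -complexE.
have wL : lin_form w by move=> c x y; rewrite wD wZ.
have wp x : cabs (w x) <= p x.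
  have [w0|w0] := eqVneq (w x) 0.
    rewrite w0 cabs0; have := pD x (- x).
    have -> : p (- x) = p x by rewrite -scaleN1r pZ cabsN -[1]/(1%:C%C) cabsR normr1 mul1r.
    by rewrite subrr (sublinear0 ps); lra.
  have aw0 : cabs (w x) != 0 by apply: contra_neq w0; exact: cabs_eq0.
  pose c : R[i] := (cabs (w x))%:C%C / w x.
  have cw : w (c *: x) = (cabs (w x))%:C%C by rewrite wZ /c divfK.
  have ux : u (c *: x) = cabs (w x) by have := congr1 (@complex.Re R) cw.
  rewrite -ux; apply: le_trans (up _) _; rewrite pZ.
  suff -> : cabs c = 1 by rewrite mul1r.
  apply/eqP; rewrite -(inj_eq (mulIf aw0)) mul1r -cabsM /c divfK //.
  by rewrite cabsR ger0_norm ?cabs_ge0.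
exists w; split=> //.
have uzp : u z = p z by apply/eqP; rewrite eq_le up uz.
have p0 : 0 <= p z by apply: le_trans (wp z); exact: cabs_ge0.
(* [|w z| <= p z = u z] leaves no room for an imaginary part. *)
have im0 : u ('i%C *: z) = 0.
  apply/eqP; rewrite -sqrf_eq0 eq_le sqr_ge0 andbT.
  have : cabs (w z) ^+ 2 <= p z ^+ 2 by rewrite ler_pXn2r ?nnegrE ?cabs_ge0.
  have -> : cabs (w z) ^+ 2 = u z ^+ 2 + (- u ('i%C *: z)) ^+ 2 by rewrite cabs_sqr.
  by rewrite uzp sqrrN; lra.
by rewrite /w uzp im0 oppr0.
Qed.

End hahn_banach.

(** * Sums over countable types *)
Section countable_sums.
Variable R : realType.

Lemma sum_iota n (F : nat -> R) : \sum_(j <- iota 0 n) F j = \sum_(j < n) F j.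
Proof. by rewrite -(big_mkord xpredT F) /index_iota subn0. Qed.

Lemma ler_sum_subset (J : eqType) (l l' : seq J) (a : J -> R) :
  (forall j, 0 <= a j) -> uniq l -> uniq l' -> {subset l <= l'} ->
  \sum_(j <- l) a j <= \sum_(j <- l') a j.
Proof.
move=> a0 ul ul' ll'; rewrite (perm_big [seq j <- l' | j \in l]) /=.
  rewrite big_filter [leRHS](bigID (mem l)) /= lerDl.
  exact: sumr_ge0.
apply: uniq_perm => // [|j]; first by rewrite filter_uniq.
by rewrite mem_filter /=; have [/ll'->|] := boolP (j \in l).
Qed.

(** Codes that denote no index contribute [0], the default value in [oapp]. *)
Lemma sumle_pickle (J : countType) (a : J -> R) M :
  (forall l, uniq l -> \sum_(j <- l) a j <= M) ->
  sumle (fun n => oapp a 0 (pickle_inv n)) M.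
Proof.
move=> h N; rewrite -(big_mkord xpredT (fun n => oapp a 0 (pickle_inv n))) -big_pmap.
by apply: h; rewrite (pmap_uniq pickle_invK) // iota_uniq.
Qed.

Lemma sumle_pair (a : nat * nat -> R) (b : nat -> R) M :
  (forall x, 0 <= a x) -> (forall k, sumle (fun i => a (k, i)) (b k)) ->
  sumle b M -> sumle (fun n => oapp a 0 (pickle_inv n)) M.
Proof.
move=> a0 ab bM; apply: sumle_pickle => l ul.
pose L := (\max_(x <- l) maxn x.1 x.2).+1.
have lL x : x \in l -> (x.1 < L)%N /\ (x.2 < L)%N.
  move=> xl; have := leq_bigmax_seq x xl isT (F := fun x : nat * nat => maxn x.1 x.2).
  by rewrite geq_max /L !ltnS => /andP.
apply: le_trans (bM L).
pose l' : seq (nat * nat) := [seq (k, i) | k <- iota 0 L, i <- iota 0 L].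
apply: (@le_trans _ _ (\sum_(x <- l') a x)).
  apply: (@ler_sum_subset (nat * nat)%type) => //.
    by apply: allpairs_uniq; rewrite ?iota_uniq // => -[? ?] [? ?] _ _ [-> ->].
  move=> [k i] /lL[/= kL iL]; apply/allpairsPdep; exists k, i.
  by rewrite !mem_iota.
rewrite big_allpairs sum_iota.
by apply: ler_sum => k _; apply: le_trans (ab k L); rewrite sum_iota.
Qed.

Lemma sumle_half : sumle (fun k => (2^-1 : R) ^+ k.+1) 1.
Proof.
move=> n; suff -> : \sum_(k < n) (2^-1 : R) ^+ k.+1 = 1 - 2^-1 ^+ n.
  by rewrite gerBl exprn_ge0.
elim: n => [|n IH]; first by rewrite big_ord0 expr0 subrr.
rewrite big_ord_recr /= IH exprS; set x := _ ^+ n.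
by lra.
Qed.

End countable_sums.

(** * Expansions in a scale of Hilbert-Schmidt inclusions *)
Section nuclear_expansion.
Variables (R : realType) (E : lmodType R[i]).
Variables (X : nat -> set E) (nrm : nat -> E -> R).
Variables (G : nat -> nat -> E -> R[i]) (s : nat -> nat -> R) (S : nat -> R).
Variables (p : E -> R) (C : nat -> R).
Hypothesis X0 : forall k, X k 0.
Hypothesis XL : forall k c x y, X k x -> X k y -> X k (c *: x + y).
Hypothesis XS : forall k, X k `<=` X k.+1.
Hypothesis Xcover : forall x, exists k, X k x.
Hypothesis nrm_ge0 : forall k x, X k x -> 0 <= nrm k x.
Hypothesis nrmZ : forall k c x, X k x -> nrm k (c *: x) = cabs c * nrm k x.
Hypothesis GL : forall k j, lin_form (G k j).
Hypothesis Gnrm : forall k j x, X k x -> cabs (G k j x) <= s k j * nrm k x.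
Hypothesis s_ge0 : forall k j, 0 <= s k j.
Hypothesis sS : forall k, sumle (fun j => s k j ^+ 2) (S k).
Hypothesis nrmG : forall k x M, X k x -> sumle (sq (G k ^~ x)) M ->
  nrm k.+1 x ^+ 2 <= M.
Hypothesis pD : forall x y, p (x + y) <= p x + p y.
Hypothesis pZ : forall c x, p (c *: x) = cabs c * p x.
Hypothesis C_ge0 : forall k, 0 <= C k.
Hypothesis pC : forall k x, X k x -> p x <= C k * nrm k x.

Let B k : set E := [set x | X k x /\ nrm k x <= 1].
Local Notation h := (fun k => hilbert_sq (G k)).

Let S0 k : 0 <= S k. Proof. exact: sumle_ge0 (sS k). Qed.

Let p_ge0 x : 0 <= p x.
Proof.
have pN : p (- x) = p x by rewrite -scaleN1r pZ cabsN -[1]/(1%:C%C) cabsR normr1 mul1r.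
have p0 : p 0 = 0 by rewrite -(scale0r 0) pZ cabs0 mul0r.
by have := pD x (- x); rewrite pN subrr p0; lra.
Qed.

Let nrm0 k : nrm k 0 = 0.
Proof. by rewrite -(scale0r 0) nrmZ // cabs0 mul0r. Qed.

Let BX k : B k `<=` X k. Proof. by move=> x []. Qed.

Let B0 k : B k 0. Proof. by split; rewrite ?nrm0. Qed.

Let XB k x : X k x -> exists (c : R[i]) b, B k b /\ x = c *: b.
Proof.
move=> Xx; have [n0|n0] := eqVneq (nrm k x) 0.
  by exists 1, x; rewrite scale1r; split=> //; split; rewrite ?n0.
exists (nrm k x)%:C%C, ((nrm k x)^-1%:C%C *: x); split; last first.
  by rewrite scalerA -rmorphM mulfV // scale1r.
split; first by rewrite -[_ *: _]addr0; exact: XL.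
by rewrite nrmZ // cabsR ger0_norm ?invr_ge0 ?nrm_ge0 // mulVf.
Qed.

Let BG k x j : B k x -> cabs (G k j x) <= s k j.
Proof.
move=> [Xx nx]; apply: le_trans (Gnrm j Xx) _.
by rewrite ler_piMr.
Qed.

Let hG k x : X k x -> sumle (sq (G k ^~ x)) (h k x).
Proof. exact: (hilbert_sumle (GL k) (sS k) (@XB k) (@BG k)). Qed.

Let nrm_h k x : X k x -> nrm k.+1 x ^+ 2 <= h k x.
Proof. by move=> Xx; apply: nrmG => //; exact: hG. Qed.

Let h_nrm k x : X k x -> h k x <= S k * nrm k x ^+ 2.
Proof.
move=> Xx; apply: hilbert_le; rewrite mulrC.
apply: le_sumle (sumleZ (sqr_ge0 _) (sS k)) => j.
rewrite -exprMn mulrC /sq ler_pXn2r ?nnegrE ?cabs_ge0 ?Gnrm //.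
by rewrite mulr_ge0 // nrm_ge0.
Qed.

Let bases : exists e : nat -> nat -> E, forall k,
  [/\ forall i, X k (e k i),
      forall f t, bounded_form (X k) (G k) f t -> sumle (fun i => cabs (f (e k i)) ^+ 2) t &
      forall f t F x, bounded_form (X k) (G k) f t ->
        sumle (fun i => cabs (f (e k i)) ^+ 2) F -> X k x ->
        cabs (f x) ^+ 2 <= h k x * F].
Proof.
have /choice[e eP] : forall k, exists e : nat -> E,
  [/\ forall i, X k (e i),
      forall f t, bounded_form (X k) (G k) f t -> sumle (fun i => cabs (f (e i)) ^+ 2) t &
      forall f t F x, bounded_form (X k) (G k) f t ->
        sumle (fun i => cabs (f (e i)) ^+ 2) F -> X k x ->
        cabs (f x) ^+ 2 <= h k x * F].
  by move=> k; exact: (square_summable_basis (X0 k) (@XL k) (GL k) (sS k) (@BX k) (B0 k) (@XB k) (@BG k)).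
by exists e.
Qed.

Section with_bases.
Variable e : nat -> nat -> E.
Hypothesis eX : forall k i, X k (e k i).
Hypothesis eB : forall k f t, bounded_form (X k) (G k) f t ->
  sumle (fun i => cabs (f (e k i)) ^+ 2) t.
Hypothesis eF : forall k f t F x, bounded_form (X k) (G k) f t ->
  sumle (fun i => cabs (f (e k i)) ^+ 2) F -> X k x -> cabs (f x) ^+ 2 <= h k x * F.

Let nrm_bounded_form k f U : lin_form f -> 0 <= U ->
  (forall x, X k x -> cabs (f x) ^+ 2 <= U * nrm k.+1 x ^+ 2) ->
  bounded_form (X k) (G k) f U.
Proof.
move=> fL U0 fU; split=> // x Xx; apply: le_trans (fU x Xx) _.
by rewrite ler_wpM2l // nrm_h.
Qed.

Let nrm_form_bound k f U F x : lin_form f -> 0 <= U ->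
  (forall x, X k x -> cabs (f x) ^+ 2 <= U * nrm k.+1 x ^+ 2) ->
  sumle (fun i => cabs (f (e k i)) ^+ 2) F -> X k x ->
  cabs (f x) ^+ 2 <= S k * nrm k x ^+ 2 * F.
Proof.
move=> fL U0 fU hF Xx.
apply: le_trans (eF (nrm_bounded_form fL U0 fU) hF Xx) _.
by rewrite ler_wpM2r ?h_nrm // (sumle_ge0 hF).
Qed.

(** At level [k + 2] the norms of the basis vectors of level [k] are bounded by
    the forms [G k.+1], and each of these, being bounded for the pre-Hilbert
    structure of level [k], is square summable along the basis. *)
Let nrm_basis k : sumle (fun i => nrm k.+2 (e k i) ^+ 2) (S k.+1).
Proof.
move=> m; apply: (@le_trans _ _ (\sum_(i < m) h k.+1 (e k i))).
  by apply: ler_sum => i _; exact/nrm_h/XS.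
apply: (sum_rsum_le (B := fun i : 'I_m => h k.+1 (e k i))) => [i j|i|n].
- exact: sq_ge0.
- exact/hG/XS.
- rewrite exchange_big /=; apply: le_trans (sS k.+1 n).
  apply: ler_sum => j _; apply: eB.
  apply: nrm_bounded_form => // [|x Xx]; first exact: sqr_ge0.
  rewrite -exprMn ler_pXn2r ?nnegrE ?cabs_ge0 //.
    by apply: Gnrm; exact: XS.
  by rewrite mulr_ge0 // nrm_ge0 //; exact: XS.
Qed.

Let pi k := C k.+2 ^+ 2 * S k.+1.

Let pi_ge0 k : 0 <= pi k. Proof. by rewrite mulr_ge0 ?sqr_ge0. Qed.

Let p_basis k : sumle (fun i => p (e k i) ^+ 2) (pi k).
Proof.
apply: le_sumle (sumleZ (sqr_ge0 _) (nrm_basis k)) => i.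
have X2 : X k.+2 (e k i) by exact/XS/XS.
by rewrite -exprMn ler_pXn2r ?nnegrE ?pC // mulr_ge0 // nrm_ge0.
Qed.

(** Rescaling the basis of level [k] by [eps k] brings the sum of the
    [p (e k i)^2] below [2^-(k+1)], so that the vectors of all levels together
    have square summable seminorms. *)
Let eps k : R := Num.sqrt (2^-1 ^+ k.+1 / (pi k + 1)).

Let eps2 k : eps k ^+ 2 = 2^-1 ^+ k.+1 / (pi k + 1).
Proof. by rewrite sqr_sqrtr // divr_ge0 ?exprn_ge0 // addr_ge0. Qed.

Let eps2_ge0 k : 0 <= eps k ^+ 2. Proof. exact: sqr_ge0. Qed.

Let eps2_gt0 k : 0 < eps k ^+ 2.
Proof. by rewrite eps2 divr_gt0 ?exprn_gt0 // ltr_wpDl. Qed.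

Let psi n : E := oapp (fun ki : nat * nat => (eps ki.1)%:C%C *: e ki.1 ki.2) 0 (pickle_inv n).

Let psi_pickle k i : psi (pickle (k, i)) = (eps k)%:C%C *: e k i.
Proof. by rewrite /psi pickleK_inv. Qed.

Let p_psi : sumle (fun n => p (psi n) ^+ 2) 1.
Proof.
pose a ki := eps ki.1 ^+ 2 * p (e ki.1 ki.2) ^+ 2.
have -> : (fun n => p (psi n) ^+ 2) = (fun n => oapp a 0 (pickle_inv n)).
  apply/funext => n; rewrite /psi; case: pickle_inv => [ki|] /=.
    by rewrite pZ cabsR ger0_norm ?sqrtr_ge0 // exprMn.
  by rewrite -(scale0r 0) pZ cabs0 mul0r expr0n.
apply: (sumle_pair (b := fun k => 2^-1 ^+ k.+1)) => [x|k|].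
- by rewrite mulr_ge0 ?sqr_ge0.
- apply: (@le_sumle _ (fun i => eps k ^+ 2 * p (e k i) ^+ 2)) => //= n.
  apply: le_trans (sumleZ (ltW (eps2_gt0 k)) (p_basis k) n) _.
  rewrite eps2 mulrAC ler_pdivrMr ?ltr_wpDl //.
  by rewrite ler_pM2l ?exprn_gt0 // lerDl.
- exact: sumle_half.
Qed.

Local Notation E' := (E -> R[i]).
(** The forms dominated by multiples of [p], with unit ball [B']. Evaluations at
    the [psi n] form a square summable system on this space, and applying Riesz
    representation to the evaluation at a point [x] yields the coefficients of
    [x] along [psi]. *)
Let D' : set E' := [set u | lin_form u /\ exists2 c : R, 0 <= c & forall x, cabs (u x) <= c * p x].
Let B' : set E' := [set u | lin_form u /\ forall x, cabs (u x) <= p x].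
Let G' n (u : E') : R[i] := u (psi n).

Let combE c (u v : E') x : (c *: u + v) x = c * u x + v x.
Proof. by []. Qed.

Let zeroE x : (0 : E') x = 0. Proof. by []. Qed.

Let lin_form_comb c (u v : E') : lin_form u -> lin_form v -> lin_form (c *: u + v).
Proof. by move=> uL vL a x y; rewrite !combE uL vL; ring. Qed.

Let D'0 : D' 0.
Proof.
split; first by move=> c x y; rewrite !zeroE mulr0 addr0.
by exists 0 => // x; rewrite zeroE cabs0 mul0r.
Qed.

Let D'L c (u v : E') : D' u -> D' v -> D' (c *: u + v).
Proof.
move=> [uL [a a0 ua]] [vL [b b0 vb]]; split; first exact: lin_form_comb.
exists (cabs c * a + b); first by rewrite addr_ge0 // mulr_ge0 // cabs_ge0.
move=> x; rewrite combE; apply: le_trans (cabsD _ _) _.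
by rewrite mulrDl lerD // cabsM -mulrA ler_wpM2l // cabs_ge0.
Qed.

Let G'L n : lin_form (G' n). Proof. by []. Qed.

Let B'D : B' `<=` D'.
Proof. by move=> u [uL up]; split=> //; exists 1 => // x; rewrite mul1r. Qed.

Let B'0 : B' 0.
Proof. by split=> [c x y|x]; rewrite !zeroE ?mulr0 ?addr0 // cabs0. Qed.

Let D'B u : D' u -> exists (c : R[i]) b, B' b /\ u = c *: b.
Proof.
move=> [uL [a a0 ua]]; exists (a + 1)%:C%C, ((a + 1)^-1%:C%C *: u).
have a1 : 0 < a + 1 by rewrite ltr_wpDl.
split; last by rewrite scalerA -rmorphM mulfV ?scale1r // gt_eqF.
split; first by have := lin_form_comb (a + 1)^-1%:C%C uL D'0.1; rewrite addr0.
move=> x; rewrite -[_ *: u]addr0 combE zeroE addr0 cabsM cabsR ger0_norm ?invr_ge0 ?(ltW a1) //.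
rewrite ler_pdivrMl //; apply: le_trans (ua x) _.
by rewrite ler_wpM2r // lerDl.
Qed.

Let B'G u n : B' u -> cabs (G' n u) <= p (psi n).
Proof. by move=> [_]; apply. Qed.

Local Notation h' := (hilbert_sq G').

Let h'G u : D' u -> sumle (sq (G' ^~ u)) (h' u).
Proof. exact: (hilbert_sumle G'L p_psi D'B B'G). Qed.

Let form_basis_sum u k : D' u -> sumle (fun i => cabs (u (e k i)) ^+ 2) (h' u / eps k ^+ 2).
Proof.
move=> Du n; rewrite ler_pdivlMr // mulr_suml.
pose l := [seq pickle (k, i : nat) | i <- iota 0 n].
pose L := (\max_(m <- l) m).+1.
apply: (@le_trans _ _ (\sum_(m <- l) sq (G' ^~ u) m)).
  rewrite big_map sum_iota; apply: ler_sum => i _.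
  rewrite /sq /G' psi_pickle (lin_formZ Du.1) cabsM exprMn mulrC cabsR.
  by rewrite ger0_norm ?sqrtr_ge0.
apply: le_trans (h'G Du L).
rewrite -(big_mkord xpredT (sq (G' ^~ u))); apply: ler_sum_subset.
- exact: sq_ge0.
- rewrite map_inj_uniq ?iota_uniq // => i j /(pcan_inj pickleK_inv).
  by case.
- exact: iota_uniq.
- move=> m ml; rewrite mem_index_iota /= ltnS.
  exact: (leq_bigmax_seq (F := id) m ml isT).
Qed.

(** A form dominated by [p] is controlled on level [k] by its values on the
    basis of that level, which up to the factor [eps k] are among its values at
    the [psi n]. *)
Let ev_bound k x u : X k x -> D' u ->
  cabs (u x) ^+ 2 <= S k * nrm k x ^+ 2 / eps k ^+ 2 * h' u.
Proof.
move=> Xx Du; have [uL [a a0 ua]] := Du.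
rewrite mulrAC -mulrA; apply: (nrm_form_bound (U := (a * C k.+1) ^+ 2)) => //.
- exact: sqr_ge0.
- move=> z Xz; rewrite -exprMn ler_pXn2r ?nnegrE ?cabs_ge0 //; last first.
    by rewrite !mulr_ge0 // nrm_ge0 //; exact: XS.
  apply: le_trans (ua z) _; rewrite -mulrA ler_wpM2l // pC //; exact: XS.
- exact: form_basis_sum.
Qed.

Let ev_bounded_form k x : X k x ->
  bounded_form D' G' (fun u : E' => u x) (S k * nrm k x ^+ 2 / eps k ^+ 2).
Proof.
move=> Xx; split=> // [|u Du]; last exact: ev_bound.
by apply: divr_ge0 => //; apply: mulr_ge0 => //; exact: sqr_ge0.
Qed.

Section with_riesz.
Variable Y : (E' -> R[i]) -> nat -> R[i].
Hypothesis Yle : forall f t, bounded_form D' G' f t -> sumle (sq (Y f)) t.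
Hypothesis YL : forall c f g t u, bounded_form D' G' f t -> bounded_form D' G' g u ->
  forall j, Y (fun x => c * f x + g x) j = c * Y f j + Y g j.
Hypothesis Yext : forall f g, {in D', f =1 g} -> Y f = Y g.
Hypothesis Yexp : forall f t u, bounded_form D' G' f t -> D' u ->
  cdot (G' ^~ u) (Y f) = f u.

Let y j x : R[i] := Y (fun u : E' => u x) j.

Let yL j : lin_form (y j).
Proof.
move=> c x z; have [k Xx] := Xcover x; have [l Xz] := Xcover z.
rewrite /y -(YL _ (ev_bounded_form Xx) (ev_bounded_form Xz)).
by congr (_ j); apply: Yext => u; rewrite inE => -[uL _]; rewrite uL.
Qed.

Let y_sum k x : X k x -> sumle (sq (y ^~ x)) (S k * nrm k x ^+ 2 / eps k ^+ 2).
Proof. by move=> Xx; exact: Yle (ev_bounded_form Xx). Qed.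

Let y_expansion u x : D' u -> cdot (G' ^~ u) (y ^~ x) = u x.
Proof. by move=> Du; have [k Xx] := Xcover x; exact: Yexp (ev_bounded_form Xx) Du. Qed.

Let T k := S k.+2 * S k.+1 / eps k.+2 ^+ 2.

Let T0 k : 0 <= T k. Proof. by apply: divr_ge0 => //; exact: mulr_ge0. Qed.

Let y_basis k J n : \sum_(i < n) \sum_(j < J) cabs (y j (e k i)) ^+ 2 <= T k.
Proof.
apply: (@le_trans _ _ (\sum_(i < n) (S k.+2 / eps k.+2 ^+ 2) * nrm k.+2 (e k i) ^+ 2)).
  apply: ler_sum => i _; rewrite mulrAC.
  by apply: y_sum; apply/XS/XS.
rewrite -mulr_sumr /T [leRHS]mulrAC ler_wpM2l //; last exact: nrm_basis.
by apply: divr_ge0.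
Qed.

Let y_basis1 k j : sumle (fun i => cabs (y j (e k i)) ^+ 2) (T k).
Proof.
move=> n; apply: le_trans (y_basis k j.+1 n); apply: ler_sum => i _.
by rewrite big_ord_recr /= lerDr sumr_ge0 // => m _; exact: sqr_ge0.
Qed.

Let A k j := rsum (fun i => cabs (y j (e k i)) ^+ 2).

Let A_ge0 k j : 0 <= A k j.
Proof. by apply: rsum_ge0 (y_basis1 k j) => i; exact: sqr_ge0. Qed.

Let A_sum k : sumle (A k) (T k).
Proof.
move=> J; apply: (sum_rsum_le (B := fun=> T k)) => [j i|j|n]; first exact: sqr_ge0.
  exact: y_basis1.
by rewrite exchange_big; exact: y_basis.
Qed.

(** Reading the form [y j] on the basis of level [k] bounds it by a sequence
    [A k] that is summable in [j]. *)
Let y_A k j x : X k x -> cabs (y j x) ^+ 2 <= S k * nrm k x ^+ 2 * A k j.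
Proof.
move=> Xx; apply: (nrm_form_bound (U := S k.+1 / eps k.+1 ^+ 2)) => //.
- by apply: divr_ge0.
- move=> z Xz; have Xz1 := XS Xz.
  apply: le_trans (le_term_rsum j (sq_ge0 (y ^~ z)) (y_sum Xz1)) _.
  by rewrite mulrAC; apply: rsum_le (y_sum Xz1); exact: sq_ge0.
- by apply: sumle_rsum (y_basis1 k j) => i; exact: sqr_ge0.
Qed.

(** These weights merge the sequences [A k] of all levels into a single summable
    sequence [W], at the price of a constant for each level. *)
Let eta k : R := 2^-1 ^+ k.+1 / (T k + 1).

Let eta_gt0 k : 0 < eta k.
Proof. by rewrite divr_gt0 ?exprn_gt0 // ltr_wpDl. Qed.

Let etaT k : eta k * T k <= 2^-1 ^+ k.+1.
Proof.
rewrite mulrAC ler_pdivrMr ?ltr_wpDl //.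
by rewrite ler_pM2l ?exprn_gt0 // lerDl.
Qed.

Let etaA0 j k : 0 <= eta k * A k j.
Proof. by rewrite mulr_ge0 // ltW. Qed.

Let etaA_sum j : sumle (fun k => eta k * A k j) 1.
Proof.
apply: le_sumle (sumle_half R) => k; apply: le_trans (etaT k).
rewrite ler_pM2l //; apply: le_trans (A_sum k j.+1).
by rewrite big_ord_recr /= lerDr sumr_ge0.
Qed.

Let W j := rsum (fun k => eta k * A k j).

Let W_sum : sumle W 1.
Proof.
move=> J; apply: (sum_rsum_le (B := fun=> 1)) => // n.
rewrite exchange_big /=; apply: le_trans (sumle_half R n).
apply: ler_sum => k _; rewrite -mulr_sumr; apply: le_trans (etaT k).
by rewrite ler_pM2l //; exact: A_sum.
Qed.

Let W_ge0 j : 0 <= W j. Proof. exact: rsum_ge0 (etaA0 j) (etaA_sum j). Qed.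

Let y_W k j x : X k x ->
  cabs (y j x) <= Num.sqrt (S k / eta k) * nrm k x * Num.sqrt (W j).
Proof.
move=> Xx; rewrite -(@ler_pXn2r _ 2) ?nnegrE ?cabs_ge0 //; last first.
  by rewrite !mulr_ge0 ?sqrtr_ge0 // nrm_ge0.
apply: le_trans (y_A j Xx) _.
rewrite !exprMn !sqr_sqrtr //; last by rewrite divr_ge0 // ltW.
rewrite -mulrA -[leRHS]mulrA -[leRHS]mulrA ler_wpM2l // mulrCA ler_wpM2l ?sqr_ge0 //.
rewrite ler_pdivlMl //.
exact: (le_term_rsum k (etaA0 j) (etaA_sum j)).
Qed.

(** By Hahn-Banach the seminorm of the remainder is the value at it of one form
    bounded by [p], and the expansions of all these forms at [x] converge at the
    same rate. *)
Let y_cvg x : (fun J => p (x - \sum_(j < J) y j x *: psi j)) @ \oo --> (0 : R).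
Proof.
have [k Xx] := Xcover x.
apply/cvgr0Pnorm_lt => d d0.
have [|J0 hJ0] := sumle_tail (e := (d / 2) ^+ 2) (sq_ge0 (y ^~ x)) (y_sum Xx).
  by rewrite exprn_gt0 // divr_gt0.
exists J0 => // J /= J0J; rewrite ger0_norm //.
apply: (@le_lt_trans _ _ (d / 2)); last by rewrite ltr_pdivrMr // ltr_pMr // ltr1n.
have [u [uL up uz]] := hahn_banach (x - \sum_(j < J) y j x *: psi j) pD pZ.
have B'u : B' u by [].
rewrite -[leLHS]ger0_norm // -cabsR -uz.
have cl := climD (cdot_clim (h'G (B'D B'u)) (y_sum Xx)) (clim_cst (- \sum_(j < J) u (psi j) * y j x)).
rewrite (y_expansion _ (B'D B'u)) in cl.
have -> : u (x - \sum_(j < J) y j x *: psi j) = u x - \sum_(j < J) u (psi j) * y j x.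
  rewrite (lin_formB uL) (lin_form_sum uL); congr (_ - _).
  by apply: eq_bigr => j _; rewrite mulrC.
have := clim_cabs cl => cv.
rewrite -(cvg_lim _ cv) //; apply: limr_le; first exact: cvgP cv.
exists J => // n Jn /=.
rewrite -(big_mkord xpredT (fun j => G' j u * y j x)).
rewrite -(big_mkord xpredT (fun j => u (psi j) * y j x)).
rewrite (big_cat_nat (leq0n J) Jn) /= addrAC subrr add0r.
rewrite -(@ler_pXn2r _ 2) ?nnegrE ?cabs_ge0 ?divr_ge0 ?(ltW d0) //.
apply: le_trans (cabs_CS _ _ _) _; rewrite -[leRHS]mul1r.
apply: ler_pM; try by apply: sumr_ge0 => *; exact: sqr_ge0.
  apply: le_trans (p_psi n).
  rewrite -(big_mkord xpredT (fun j => p (psi j) ^+ 2)) [leRHS](big_cat_nat (leq0n J) Jn) /=.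
  apply: (@le_trans _ _ (\sum_(J <= j < n) p (psi j) ^+ 2)).
    by apply: ler_sum => j _; rewrite ler_pXn2r ?nnegrE ?cabs_ge0 // up.
  by rewrite lerDr sumr_ge0 // => *; exact: sqr_ge0.
exact: hJ0.
Qed.

Lemma nuclear_expansion_riesz : exists (psi : nat -> E) (y : nat -> E -> R[i]) (b D : nat -> R),
  [/\ forall j, lin_form (y j) /\ 0 <= b j,
      forall k j x, X k x -> cabs (y j x) <= D k * nrm k x * b j,
      sumle (fun j => b j ^+ 2) 1, sumle (fun j => p (psi j) ^+ 2) 1 &
      forall x, (fun J => p (x - \sum_(j < J) y j x *: psi j)) @ \oo --> (0 : R)].
Proof.
exists psi, y, (fun j => Num.sqrt (W j)), (fun k => Num.sqrt (S k / eta k)).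
split=> [j|k j x|||//]; [by split|exact: y_W| |exact: p_psi].
by apply: le_sumle W_sum => j; rewrite sqr_sqrtr.
Qed.

End with_riesz.

Lemma nuclear_expansion_bases : exists (psi : nat -> E) (y : nat -> E -> R[i]) (b D : nat -> R),
  [/\ forall j, lin_form (y j) /\ 0 <= b j,
      forall k j x, X k x -> cabs (y j x) <= D k * nrm k x * b j,
      sumle (fun j => b j ^+ 2) 1, sumle (fun j => p (psi j) ^+ 2) 1 &
      forall x, (fun J => p (x - \sum_(j < J) y j x *: psi j)) @ \oo --> (0 : R)].
Proof.
have [Y [Y1 Y2 Y3 Y4]] := square_summable_riesz D'0 D'L G'L p_psi B'D B'0 D'B B'G.
exact: nuclear_expansion_riesz Y1 Y2 Y3 Y4.
Qed.

End with_bases.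

(** The setting covers an increasing union of normed spaces [X k] and, when every
    [X k] is the whole space, one space with a sequence of weaker and weaker
    norms. That a single sequence [b] serves all levels is the point: it lets one
    seminorm on the whole space control all the coefficients. *)
Theorem nuclear_expansion : exists (psi : nat -> E) (y : nat -> E -> R[i]) (b D : nat -> R),
  [/\ forall j, lin_form (y j) /\ 0 <= b j,
      forall k j x, X k x -> cabs (y j x) <= D k * nrm k x * b j,
      sumle (fun j => b j ^+ 2) 1, sumle (fun j => p (psi j) ^+ 2) 1 &
      forall x, (fun J => p (x - \sum_(j < J) y j x *: psi j)) @ \oo --> (0 : R)].
Proof.
have [e eP] := bases.
by apply: (@nuclear_expansion_bases e) => k; have [] := eP k.
Qed.

End nuclear_expansion.

(** * Nuclear maps from expansions *)
Section real_norm.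
Variable R : realType.
Local Notation K := R[i].

Lemma cauchy_clim (u : nat -> K) :
  (forall e : R, 0 < e -> exists N, forall n, (N <= n)%N -> cabs (u N - u n) < e) ->
  clim u (climit u).
Proof.
move=> uc.
have cv (f : K -> R) : (forall z, `|f z| <= cabs z) -> {morph f : x y / x - y} ->
    cvgn (fun n => f (u n)).
  move=> fle fB; apply: R_complete; apply/cauchyP => e e0.
  have [N hN] := uc _ e0; exists (f (u N)); exists N => // n /= Nn.
  by rewrite /ball /= -fB; apply: le_lt_trans (hN n Nn).
split; apply: cv; [exact: cabs_Re| |exact: cabs_Im|].
  by move=> x y; rewrite raddfB.
by move=> x y; rewrite raddfB.
Qed.

Lemma gt0_complexR (e : K) : 0 < e -> exists2 r : R, 0 < r & e = r%:C%C.
Proof.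
move=> e0; have eE : e = (complex.Re e)%:C%C by rewrite RRe_real // gtr0_real.
by exists (complex.Re e) => //; rewrite -ltcR -eE.
Qed.

Section normed.
Variable V : normedModType K.
Implicit Types x y : V.

Definition rnorm x : R := complex.Re `|x|.

Lemma rnormE x : `|x| = (rnorm x)%:C%C.
Proof. by rewrite /rnorm RRe_real // normr_real. Qed.

Lemma rnorm_ge0 x : 0 <= rnorm x.
Proof. by rewrite -lecR -rnormE normr_ge0. Qed.

Lemma rnormD x y : rnorm (x + y) <= rnorm x + rnorm y.
Proof. by rewrite -lecR rmorphD /= -!rnormE ler_normD. Qed.

Lemma rnormZ c x : rnorm (c *: x) = cabs c * rnorm x.
Proof. by apply: complexI; rewrite rmorphM /= -!rnormE normrZ. Qed.

Lemma rnormN x : rnorm (- x) = rnorm x.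
Proof. by rewrite /rnorm normrN. Qed.

Lemma rnormB x y : rnorm (x - y) = rnorm (y - x).
Proof. by rewrite -rnormN opprB. Qed.

Lemma rnorm0_eq0 x : rnorm x = 0 -> x = 0.
Proof. by move=> h; apply/eqP; rewrite -normr_eq0 rnormE h. Qed.

Lemma rnorm_sum I (r : seq I) (P : pred I) (F : I -> V) :
  rnorm (\sum_(i <- r | P i) F i) <= \sum_(i <- r | P i) rnorm (F i).
Proof.
elim/big_ind2: _ => [|x1 x2 y1 y2 h1 h2|//]; first by rewrite /rnorm normr0.
by apply: le_trans (rnormD _ _) _; rewrite lerD.
Qed.

Lemma cvg_rnorm (u : nat -> V) l :
  (fun n => rnorm (u n - l)) @ \oo --> (0 : R) -> u @ \oo --> l.
Proof.
move=> /cvgr0Pnorm_lt h; apply/cvgrPdistC_lt => e /gt0_complexR[r r0 ->].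
have := h _ r0; apply: filterS => n.
by rewrite ger0_norm ?rnorm_ge0 // rnormE ltcR.
Qed.

End normed.

Lemma cvg_complexR (u : nat -> R) (l : R) :
  u @ \oo --> l ->
  (fun n => (u n)%:C%C : (R[i] : numFieldType)) @ \oo --> (l%:C%C : (R[i] : numFieldType)).
Proof.
move=> /cvgrPdistC_lt h; apply/cvgrPdistC_lt => e /gt0_complexR[r r0 ->].
have := h _ r0; apply: filterS => n.
by rewrite -rmorphB normr_cabs cabsR ltcR.
Qed.

Lemma rnorm_series_cvg (B : completeNormedModType K) (u : nat -> B) (M : R) :
  sumle (fun j => rnorm (u j)) M -> cvgn (series u).
Proof.
move=> uM; apply: cauchy_cvg; apply/cauchy_seriesP => e /gt0_complexR[r r0 ->].
have [|J hJ] := sumle_tail (e := r / 2) (fun j => rnorm_ge0 (u j)) uM.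
  by rewrite divr_gt0.
exists ([set m | (J <= m)%N], setT); first by split; [exists J|exact: filterT].
move=> [m n] /= [Jm _]; rewrite rnormE ltcR.
apply: le_lt_trans (rnorm_sum _ _ _) _; apply: le_lt_trans (hJ m n Jm) _.
by rewrite ltr_pdivrMr // ltr_pMr // ltr1n.
Qed.

End real_norm.

Section extension.
Variables (R : realType) (E : lmodType R[i]) (q : seminorm E).
Variables (B : completeNormedModType R[i]) (hq : {linear E -> B}).
Hypothesis hqC : is_completion q hq.
Local Notation K := R[i].
Local Notation rq := (fun x => complex.Re (q x)).

Let rnorm_h x : rnorm (hq x) = rq x.
Proof. by rewrite /rnorm hqC.1. Qed.

Let approx b n : exists x, rnorm (hq x - b) < n.+1%:R^-1.
Proof.
have e0 : 0 < (n.+1%:R^-1)%:C%C :> K by rewrite ltcR invr_gt0.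
have [|z [bz [x _ xz]]] := hqC.2 (ball b (n.+1%:R^-1)%:C%C)°%classic _ (@open_interior _ _).
  by exists b; exact: nbhsx_ballx.
exists x; move: bz; rewrite -xz => /interior_subset.
by rewrite -ball_normE /= rnormE ltcR rnormB.
Qed.

Variables (f : E -> K) (c : R).
Hypothesis fL : lin_form f.
Hypothesis c0 : 0 <= c.
Hypothesis fq : forall x, cabs (f x) <= c * rq x.

Let f_dist x y : cabs (f x - f y) <= c * rnorm (hq x - hq y).
Proof. by rewrite -(lin_formB fL) -linearB rnorm_h; exact: fq. Qed.

(** Extension by density: the value at [b] is a limit along points of the image of
    [hq] approaching [b]. *)
Lemma extend_form : exists F : {linear B -> K^o},
  (forall x, F (hq x) = f x) /\ forall b, cabs (F b) <= c * rnorm b.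
Proof.
have /choice[X0 X0P] : forall b, exists X : nat -> E, forall n, rnorm (hq (X n) - b) < n.+1%:R^-1.
  by move=> b; have /choice[X XP] := approx b; exists X.
pose F b := climit (fun n => f (X0 b n)).
have Fclim0 b : clim (fun n => f (X0 b n)) (F b).
  apply: cauchy_clim => e e0.
  have ec : 0 < e / (2 * (c + 1)) by rewrite divr_gt0 // mulr_gt0 // ltr_wpDl.
  have [N _ hN] := near_infty_natSinv_lt (PosNum ec).
  exists N => n Nn; apply: le_lt_trans (f_dist _ _) _.
  have h1 := lt_trans (X0P b N) (hN N (leqnn N)).
  have h2 := lt_trans (X0P b n) (hN n Nn).
  rewrite /= in h1 h2.
  have h : rnorm (hq (X0 b N) - hq (X0 b n)) <= 2 * (e / (2 * (c + 1))).
    rewrite -[X in X - _](subrK b) -addrA.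
    apply: le_trans (rnormD _ _) _; rewrite [X in _ + X]rnormB.
    by rewrite mulr_natl mulr2n lerD // ltW.
  apply: le_lt_trans (ler_wpM2l c0 h) _.
  have c1 : 0 < c + 1 by rewrite ltr_wpDl.
  have -> : c * (2 * (e / (2 * (c + 1)))) = e * (c / (c + 1)).
    by field; rewrite gt_eqF.
  by rewrite gtr_pMr // ltr_pdivrMr // mul1r ltrDl.
have X0cvg b : (fun n => rnorm (hq (X0 b n) - b)) @ \oo --> (0 : R).
  apply: squeeze0 (@cvg_harmonic R) => n.
  by rewrite ger0_norm ?rnorm_ge0 // ltW.
have Fclim b x : (fun n => rnorm (hq (x n) - b)) @ \oo --> (0 : R) ->
    clim (fun n => f (x n)) (F b).
  move=> xb.
  have d0 : clim (fun n => f (x n) - f (X0 b n)) 0.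
    apply: (clim_sandwich (b := fun n => c * (rnorm (hq (x n) - b) + rnorm (hq (X0 b n) - b)))) => [n|].
      rewrite subr0; apply: le_trans (f_dist _ _) _; rewrite ler_wpM2l //.
      rewrite -[X in X - _](subrK b) -addrA; apply: le_trans (rnormD _ _) _.
      by rewrite lerD2l rnormB.
    rewrite -[X in _ --> X](mulr0 c); apply: cvgM; first exact: cvg_cst.
    by rewrite -[X in _ --> X](addr0 0); exact: cvgD.
  have := climD d0 (Fclim0 b); rewrite add0r.
  by under eq_fun do rewrite subrK.
have Flin : linear (F : B -> K^o).
  move=> a b b'; apply: clim_unique (climD (climZ a (Fclim0 b)) (Fclim0 b')).
  under eq_fun do rewrite -fL.
  apply: Fclim.
  apply: (@squeeze0 _ _ (fun n => cabs a * rnorm (hq (X0 b n) - b) + rnorm (hq (X0 b' n) - b'))) => [n|].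
    rewrite ger0_norm ?rnorm_ge0 // linearP.
    have -> : a *: hq (X0 b n) + hq (X0 b' n) - (a *: b + b') =
        a *: (hq (X0 b n) - b) + (hq (X0 b' n) - b').
      by rewrite opprD addrACA scalerBr.
    by apply: le_trans (rnormD _ _) _; rewrite rnormZ.
  rewrite (_ : 0 = cabs a * 0 + 0); last by rewrite mulr0 addr0.
  apply: cvgD => //.
  by apply: cvgM => //; exact: cvg_cst.
pose FL : {linear B -> K^o} := HB.pack_for {linear B -> K^o} (F : B -> K^o)
  (GRing.isLinear.Build _ _ _ _ (F : B -> K^o) Flin).
exists FL; split=> [x|b].
  apply: clim_unique (clim_cst (f x)); apply: Fclim.
  under eq_fun do rewrite subrr /rnorm normr0.
  exact: cvg_cst.
have cv : (fun n => cabs (f (X0 b n)) - c * n.+1%:R^-1) @ \oo --> cabs (F b).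
  rewrite (_ : cabs (F b) = cabs (F b) - c * 0); last by rewrite mulr0 subr0.
  apply: cvgB (clim_cabs (Fclim0 b)) _.
  by apply: cvgM (@cvg_harmonic R); exact: cvg_cst.
rewrite -[leLHS](cvg_lim _ cv) //; apply: limr_le; first exact: cvgP cv.
apply: nearW => n; rewrite lerBlDr -mulrDr.
apply: le_trans (fq _) _; rewrite ler_wpM2l // -rnorm_h.
rewrite -[X in rnorm X](subrK b) addrC; apply: le_trans (rnormD _ _) _.
by rewrite lerD2l ltW.
Qed.

End extension.

Section nuclear_from_expansion.
Variables (R : realType) (E : lmodType R[i]) (p q : seminorm E).
Local Notation K := R[i].
Local Notation rp := (fun x => complex.Re (p x)).
Local Notation rq := (fun x => complex.Re (q x)).
Variables (psi : nat -> E) (y : nat -> E -> K) (b : nat -> R).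
Hypothesis yL : forall j, lin_form (y j).
Hypothesis b0 : forall j, 0 <= b j.
Hypothesis yq : forall j x, cabs (y j x) <= b j * rq x.
Hypothesis b_sum : sumle (fun j => b j ^+ 2) 1.
Hypothesis p_sum : sumle (fun j => rp (psi j) ^+ 2) 1.
Hypothesis y_cvg : forall x,
  (fun J => rp (x - \sum_(j < J) y j x *: psi j)) @ \oo --> (0 : R).

Let rp_ge0 x : 0 <= rp x.
Proof. by have := seminorm_ge0 p x; rewrite lecE => /andP[]. Qed.

Let bp_sum : sumle (fun j => b j * rp (psi j)) 1.
Proof.
move=> n; rewrite -(@ler_pXn2r _ 2) ?nnegrE //; last first.
  by apply: sumr_ge0 => j _; exact: mulr_ge0.
apply: le_trans (finite_CS _ (fun j : 'I_n => b0 j) (fun j : 'I_n => rp_ge0 (psi j))) _.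
rewrite expr1n -[leRHS]mul1r; apply: ler_pM (b_sum n) (p_sum n).
  by apply: sumr_ge0 => *; exact: sqr_ge0.
by apply: sumr_ge0 => *; exact: sqr_ge0.
Qed.

(** The extended coefficient forms, divided by [b j], and the images of the
    [psi j], divided by [p (psi j)], are the two normalized factors; the weights
    [b j * p (psi j)] are summable by Cauchy-Schwarz. *)
Lemma nuclear_of_expansion (Bq Bp : completeNormedModType K)
    (hq : {linear E -> Bq}) (hp : {linear E -> Bp}) :
  is_completion q hq -> is_completion p hp ->
  exists2 T : {linear Bq -> Bp}, forall x, T (hq x) = hp x & nuclear_map T.
Proof.
move=> cq cp.
have rnorm_p x : rnorm (hp x) = rp x by rewrite /rnorm cp.1.
have /choice[F FP] : forall j, exists F : {linear Bq -> K^o},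
    (forall x, F (hq x) = y j x) /\ forall z, cabs (F z) <= b j * rnorm z.
  by move=> j; refine (extend_form cq (yL j) (b0 j) (yq j)).
have Tcv z : cvgn (series (fun j => F j z *: hp (psi j))).
  apply: (rnorm_series_cvg (M := rnorm z)) => n.
  apply: (@le_trans _ _ (\sum_(j < n) rnorm z * (b j * rp (psi j)))).
    apply: ler_sum => j _; rewrite rnormZ rnorm_p mulrA.
    by rewrite ler_wpM2r // mulrC; have [_] := FP j.
  by rewrite -mulr_sumr ler_piMr // rnorm_ge0.
pose T z := limn (series (fun j => F j z *: hp (psi j))).
have Tlin : linear T.
  move=> a z w; apply: cvg_lim; first exact: norm_hausdorff.
  rewrite (_ : series _ = a *: series (fun j => F j z *: hp (psi j)) +
      series (fun j => F j w *: hp (psi j))).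
    by apply: cvgD; [apply: cvgZr|]; exact: Tcv.
  apply/funext => n; rewrite /series /= !fctE scaler_sumr -big_split /=.
  by apply: eq_bigr => j _; rewrite linearP scalerDl scalerA.
pose TL : {linear Bq -> Bp} := HB.pack_for {linear Bq -> Bp} T
  (GRing.isLinear.Build _ _ _ _ T Tlin).
exists TL.
  move=> x; apply: cvg_lim; first exact: norm_hausdorff.
  apply: cvg_rnorm; apply: squeeze0 (y_cvg x) => n.
  rewrite ger0_norm ?rnorm_ge0 // rnormB -rnorm_p linearB.
  have -> // : series (fun j => F j (hq x) *: hp (psi j)) n = hp (\sum_(j < n) y j x *: psi j).
  rewrite /series /= big_mkord linear_sum; apply: eq_bigr => j _.
  by rewrite linearZ /=; have [-> _] := FP j.
pose lam k : K := (b k * rp (psi k))%:C%C.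
pose f k : {linear Bq -> K^o} := ((b k)^-1%:C%C : K) \*: F k.
pose v k : Bp := (rp (psi k))^-1%:C%C *: hp (psi k).
exists lam, f, v; split.
- have cv := rsum_cvg (fun j => mulr_ge0 (b0 j) (rp_ge0 (psi j))) bp_sum.
  have cvK := cvg_complexR cv.
  rewrite (_ : series _ = fun n => (\sum_(j < n) b j * rp (psi j))%:C%C).
    exact: cvgP cvK.
  apply/funext => n; rewrite /series /= big_mkord rmorph_sum.
  by apply: eq_bigr => j _; rewrite ger0_norm // ler0c mulr_ge0.
- move=> k z; have [_ Fz] := FP k.
  have -> : `|f k z| = (cabs ((b k)^-1%:C%C * F k z))%:C%C by [].
  rewrite rnormE lecR cabsM cabsR ger0_norm ?invr_ge0 //.
  have [bk0|bk0] := eqVneq (b k) 0; first by rewrite bk0 invr0 mul0r rnorm_ge0.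
  by rewrite ler_pdivrMl // lt_neqAle eq_sym bk0 b0.
- move=> k; rewrite rnormE -[1]/(1%:C%C) lecR /v rnormZ cabsR ger0_norm ?invr_ge0 //.
  rewrite rnorm_p; have [->|r0] := eqVneq (rp (psi k)) 0; first by rewrite mulr0.
  by rewrite mulVf.
- move=> z; rewrite (_ : (fun k => _) = (fun j => F j z *: hp (psi j))); first exact: Tcv.
  apply/funext => k; have [_ Fz] := FP k.
  have -> : f k z = (b k)^-1%:C%C * F k z :> K by [].
  rewrite /lam /v scalerA.
  have [bk0|bk0] := eqVneq (b k) 0.
    have -> : F k z = 0.
      by apply: cabs_eq0; apply/eqP; rewrite eq_le cabs_ge0 andbT (le_trans (Fz z)) // bk0 mul0r.
    by rewrite !(mulr0, mul0r) !scale0r.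
  have [r0|r0] := eqVneq (rp (psi k)) 0.
    have -> : hp (psi k) = 0 by apply: rnorm0_eq0; rewrite rnorm_p.
    by rewrite !scaler0.
  have bV : (b k)%:C%C * (b k)^-1%:C%C = 1 :> K by rewrite -rmorphM mulfV.
  have rV : (rp (psi k))%:C%C * (rp (psi k))^-1%:C%C = 1 :> K by rewrite -rmorphM mulfV.
  congr (_ *: _); rewrite rmorphM /= mulrACA -mulrA.
  by rewrite mulrA mulrA bV mul1r mulrAC rV mul1r.
Qed.

End nuclear_from_expansion.

(** * Seminorms and the topologies they generate *)
Section seminorm_real.
Variables (R : realType) (E : lmodType R[i]) (p : seminorm E).

Lemma seminormE x : p x = (complex.Re (p x))%:C%C.
Proof. by rewrite RRe_real // ger0_real // seminorm_ge0. Qed.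

Lemma seminormR_ge0 x : 0 <= complex.Re (p x).
Proof. by rewrite -lecR -seminormE seminorm_ge0. Qed.

Lemma seminormRD x y : complex.Re (p (x + y)) <= complex.Re (p x) + complex.Re (p y).
Proof. by rewrite -lecR rmorphD /= -!seminormE seminormD. Qed.

Lemma seminormRZ c x : complex.Re (p (c *: x)) = cabs c * complex.Re (p x).
Proof. by apply: complexI; rewrite rmorphM /= -!seminormE seminormZ. Qed.

Lemma seminormRB x y : `|complex.Re (p x) - complex.Re (p y)| <= complex.Re (p (x - y)).
Proof.
have h a b : complex.Re (p a) - complex.Re (p b) <= complex.Re (p (a - b)).
  by rewrite lerBlDr -{1}(subrK b a) seminormRD.
rewrite ler_norml h andbT lerNl opprB.
by apply: le_trans (h y x) _; rewrite -opprB seminormN.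
Qed.

End seminorm_real.

Section seminorm_constructions.
Variables (R : realType) (E : lmodType R[i]).

Lemma real_seminorm (f : E -> R) :
  (forall x y, f (x + y) <= f x + f y) ->
  (forall c x, f (c *: x) = cabs c * f x) ->
  exists g : seminorm E, forall x, complex.Re (g x) = f x.
Proof.
move=> fD fZ; pose F x : R[i] := (f x)%:C%C.
have FD x y : F (x + y) <= F x + F y by rewrite /F -rmorphD lecR.
have FZ c x : F (c *: x) = `|c| * F x by rewrite /F fZ normr_cabs rmorphM.
by exists (Seminorm FD FZ).
Qed.

End seminorm_constructions.

Section generated_topology.
Variables (R : realType) (E : lmodType R[i]) (P : set (seminorm E)).
Local Notation K := (R[i] : numFieldType).

Lemma lcs_continuous_le (q g : seminorm E) (C : R) : P g ->
  (forall x, complex.Re (q x) <= C * complex.Re (g x)) ->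
  continuous (q : lcs P -> K).
Proof.
move=> Pg qg x; apply/(@cvgrPdistC_lt K K _ _ (@nbhs_filter (lcs P) x)) => e /gt0_complexR[r r0 ->].
pose d := r / (`|C| + 1).
have C1 : 0 < `|C| + 1 by rewrite ltr_wpDl.
have d0 : 0 < d by rewrite divr_gt0.
exists [:: (g, d%:C%C)]; split.
  by rewrite /= mem_set // andbT ltcR.
move=> y /=; rewrite andbT seminormE ltcR => gy.
rewrite [q y]seminormE [q x]seminormE -rmorphB normr_cabs cabsR ltcR.
apply: le_lt_trans (seminormRB _ _ _) _; apply: le_lt_trans (qg _) _.
apply: (@le_lt_trans _ _ ((`|C| + 1) * complex.Re (g (y - x)))).
  rewrite ler_wpM2r ?seminormR_ge0 // (le_trans (ler_norm _)) // lerDl //.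
by rewrite -ltr_pdivlMl // mulrC.
Qed.

(** A continuous seminorm is less than [1] on a basic neighbourhood of [0];
    homogeneity turns this into a bound by the finitely many seminorms that
    define the neighbourhood. *)
Lemma continuous_lcs_le (q : seminorm (lcs P)) : continuous (q : lcs P -> K) ->
  exists l : seq (seminorm E * R), (forall ge, ge \in l -> P ge.1 /\ 0 < ge.2) /\
    forall x : E, complex.Re (q x) <= \sum_(ge <- l) complex.Re (ge.1 x) / ge.2.
Proof.
move=> qc; have := qc 0; move=> /cvgrPdistC_lt /(_ 1 ltr01)[s [vs hs]].
exists [seq (ge.1, complex.Re ge.2) | ge <- s]; split.
  move=> _ /mapP[[g e] gs ->] /=; have /andP[gP e0] := allP vs _ gs.
  by split; [exact: set_mem|move: e0 => /= /gt0_complexR[r r0 ->]].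
move=> x; rewrite big_map /=; set t := \sum_(_ <- _) _.
have t0 : 0 <= t.
  rewrite /t big_seq; apply: sumr_ge0 => -[g e] gs; rewrite divr_ge0 ?seminormR_ge0 //.
  by have /andP[_ /= /gt0_complexR[r /ltW r0 ->]] := allP vs _ gs.
(* [x / (t + d)] lies in the neighbourhood, also when [t = 0]. *)
apply/ler_addgt0Pr => d d0; have td : 0 < t + d by rewrite ltr_wpDl.
have q0 : q 0 = 0 by exact: seminorm0.
have : `|q ((t + d)^-1%:C%C *: (x : lcs P)) - q 0| < 1.
  apply: hs.
  apply/allP => -[g e] gs /=; rewrite subr0.
  have /andP[_ /= /gt0_complexR[r r0 eE]] := allP vs _ gs.
  rewrite eE seminormE ltcR seminormRZ cabsR ger0_norm ?invr_ge0 ?(ltW td) //.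
  rewrite ltr_pdivrMl // -ltr_pdivrMr //.
  apply: (@le_lt_trans _ _ t); last by rewrite ltrDl.
  rewrite /t; have -> : complex.Re (g x) / r = complex.Re (g x) / complex.Re e by rewrite eE.
  rewrite (big_rem (g, e)) //= lerDl big_seq; apply: sumr_ge0 => -[g' e'] /mem_rem gs'.
  rewrite divr_ge0 ?seminormR_ge0 //.
  by have /andP[_ /= /gt0_complexR[r' /ltW r'0 ->]] := allP vs _ gs'.
have q_ge0 : 0 <= complex.Re (q ((t + d)^-1%:C%C *: (x : lcs P))) by exact: seminormR_ge0.
rewrite q0 subr0 [q _]seminormE normr_cabs cabsR ger0_norm // -[1]/(1%:C%C) ltcR.
rewrite seminormRZ cabsR ger0_norm ?invr_ge0 ?(ltW td) // ltr_pdivrMl // mulr1.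
exact: ltW.
Qed.

Lemma lcs_hausdorff : (forall x : E, x != 0 -> exists2 g, P g & complex.Re (g x) != 0) ->
  hausdorff_space (lcs P).
Proof.
move=> sep x y xy; apply/eqP; apply: contraT => neq.
have [|g Pg gxy] := sep ((x : E) - y); first by rewrite subr_eq0.
have d0 : 0 < complex.Re (g ((x : E) - y)) / 2.
  by rewrite divr_gt0 // lt_neqAle eq_sym gxy seminormR_ge0.
set d := _ / 2 in d0.
have nb (z : lcs P) : nbhs z [set w : lcs P | complex.Re (g ((w : E) - z)) < d].
  exists [:: (g, d%:C%C)]; split; first by rewrite /= mem_set // andbT ltcR.
  by move=> w /=; rewrite andbT seminormE ltcR.
have [w [/= wx wy]] := xy _ _ (nb x) (nb y).
have : complex.Re (g ((x : E) - y)) < d + d.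
  rewrite -[X in X - _](subrK (w : E)) -addrA.
  apply: le_lt_trans (seminormRD _ _ _) _; rewrite ltrD //.
  by rewrite -opprB seminormN.
by rewrite -splitr ltxx.
Qed.

End generated_topology.

(** * The defining sequences and their weights *)
Section defining_sequence.
Variables (R : realType) (sigma : R).
Hypothesis sigma_gt1 : 1 < sigma.
Local Notation M := (Mseq sigma).
Implicit Types (tau delta r : R).

Lemma eventually_dominated (u v : nat -> R) (P : nat) :
  (forall p, 0 < v p) -> (forall p, (P <= p)%N -> u p <= v p) ->
  exists2 C : R, 0 < C & forall p, u p <= C * v p.
Proof.
move=> v0 uv; exists (1 + \sum_(j < P) `|u j| / v j).
  by rewrite ltr_pwDl // sumr_ge0 // => j _; rewrite divr_ge0 // ltW.
have S0 (s : seq 'I_P) (Q : pred 'I_P) : 0 <= \sum_(j <- s | Q j) `|u j| / v j.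
  by rewrite sumr_ge0 // => j _; rewrite divr_ge0 // ltW.
move=> p; have [Pp|pP] := leqP P p.
  by apply: le_trans (uv p Pp) _; rewrite ler_peMl ?(ltW (v0 p)) // lerDl.
rewrite -ler_pdivrMr //; apply: (@le_trans _ _ (`|u p| / v p)).
  by rewrite ler_wpM2r ?invr_ge0 ?(ltW (v0 p)) // ler_norm.
rewrite (bigD1 (Ordinal pP)) //= addrCA lerDl addr_ge0 //.
Qed.

Lemma MseqE tau p : (0 < p)%N -> M tau p = p%:R `^ (tau * p%:R `^ sigma).
Proof. by case: p. Qed.

Lemma MseqD a b p : M (a + b) p = M a p * M b p.
Proof.
case: p => [|p]; first by rewrite mulr1.
by rewrite /= mulrDl powRD // pnatr_eq0 implybT.
Qed.

Lemma nat_above (x : R) : exists N : nat, x <= N%:R.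
Proof. by exists (Num.truncn x).+1; rewrite ltW // truncnS_gt. Qed.

Lemma powR_unbounded (a A : R) : 0 < a -> exists N : nat,
  forall p : nat, (N <= p)%N -> A <= p%:R `^ a.
Proof.
move=> a0; have [N hN] := nat_above (`|A| `^ a^-1).
exists N => p Np; apply: le_trans (ler_norm A) _.
rewrite -{1}[`|A|]powRr1 // -[X in _ `^ X <= _](mulVf (lt0r_neq0 a0)) powRrM.
apply: ge0_ler_powR; rewrite ?nnegrE ?powR_ge0 ?(ltW a0) //.
by apply: le_trans hN _; rewrite ler_nat.
Qed.

(** Geometric growth is absorbed by any [delta > 0], because [p^sigma] exceeds
    every multiple of [p] when [sigma > 1]. *)
Lemma expr_le_Mseq (K delta : R) : 0 < delta ->
  exists2 C : R, 0 < C & forall p, K ^+ p <= C * M delta p.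
Proof.
move=> d0; have [m hm] := nat_above (`|K|).
have [N hN] := @powR_unbounded (sigma - 1) (m%:R / delta) ltac:(by rewrite subr_gt0).
apply: (@eventually_dominated _ _ (maxn 2 N)) => [p|p].
  exact: Mseq_gt0.
rewrite geq_max => /andP[p2 Np].
have p0 : (0 < p)%N by rewrite (leq_trans _ p2).
rewrite MseqE //; apply: (@le_trans _ _ (2 `^ (m%:R * p%:R))).
  apply: le_trans (ler_norm _) _; rewrite normrX powRrM powR_mulrn ?powR_ge0 //.
  apply: lerXn2r; rewrite ?nnegrE ?powR_ge0 //.
  apply: le_trans hm _; rewrite powR_mulrn // -natrX ler_nat.
  by rewrite ltnW // ltn_expl.
apply: (@le_trans _ _ (p%:R `^ (m%:R * p%:R))).
  by apply: ge0_ler_powR; rewrite ?nnegrE ?mulr_ge0 // ler_nat.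
rewrite ler_powR ?ler1n //.
have -> : (p%:R : R) `^ sigma = p%:R `^ (sigma - 1) * p%:R.
  rewrite -{3}[p%:R]powRr1 // -powRD ?subrK //.
  by rewrite pnatr_eq0 -lt0n p0 implybT.
by rewrite mulrA ler_wpM2r // mulrC -ler_pdivrMr // hN.
Qed.

(** With [tau' = tau r^2], one factor [r] absorbs the growth of the base, since
    eventually [p + 1 <= p^r], and the other that of the exponent, since
    eventually [(p + 1)^sigma <= r p^sigma]. *)
Lemma Mseq_shift tau tau' : 0 < tau -> tau < tau' ->
  exists2 C : R, 0 < C & forall p, M tau p.+1 <= C * M tau' p.
Proof.
move=> t0 tt'; pose r := Num.sqrt (tau' / tau).
have rho1 : 1 < tau' / tau by rewrite ltr_pdivlMr // mul1r.
have r1 : 1 < r by rewrite -sqrtr1 ltr_sqrt // (lt_trans ltr01).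
have r2 : tau * r * r = tau'.
  by rewrite -mulrA -expr2 sqr_sqrtr ?(ltW (lt_trans ltr01 rho1)) // mulrC divfK // gt_eqF.
have s0 : 0 < sigma by exact: lt_trans sigma_gt1.
have [N2 hN2] := @powR_unbounded (r - 1) 2 ltac:(by rewrite subr_gt0).
have c1 : 1 < r `^ sigma^-1.
  have p1 : 1 `^ sigma^-1 = 1 :> R by rewrite powR1.
  by rewrite -[ltLHS]p1; apply: gt0_ltr_powR; rewrite ?invr_gt0 ?nnegrE ?(ltW (lt_trans ltr01 r1)).
have [N1 hN1] := nat_above ((r `^ sigma^-1 - 1)^-1).
apply: (@eventually_dominated _ _ (maxn 1 (maxn N1 N2))) => [p|p].
  exact: Mseq_gt0.
rewrite !geq_max => /andP[p0 /andP[N1p N2p]].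
have pR : 0 < p%:R :> R by rewrite ltr0n.
rewrite !MseqE //.
have ha : p.+1%:R `^ sigma <= r * p%:R `^ sigma.
  have -> : r = (r `^ sigma^-1) `^ sigma by rewrite -powRrM mulVf ?gt_eqF // powRr1 // (ltW (lt_trans ltr01 r1)).
  rewrite -powRM ?powR_ge0 //; apply: ge0_ler_powR; rewrite ?nnegrE ?(ltW s0) ?mulr_ge0 ?powR_ge0 //.
  have : (r `^ sigma^-1 - 1)^-1 <= p%:R by apply: le_trans hN1 _; rewrite ler_nat.
  by rewrite -[X in X <= _]mul1r ler_pdivrMr ?subr_gt0 // mulrBr mulr1 lerBrDr mulrC => h; rewrite -natr1 addrC.
have hb : p.+1%:R <= p%:R `^ r :> R.
  rewrite -(mulr_powRB1 (ltW pR) (lt_trans ltr01 r1)).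
  apply: (@le_trans _ _ (p%:R * 2)); last by rewrite ler_pM2l // hN2.
  by rewrite -natrM ler_nat muln2 -addnn -addn1 leq_add2l.
apply: (@le_trans _ _ ((p%:R `^ r) `^ (tau * p.+1%:R `^ sigma))).
  by apply: ge0_ler_powR; rewrite ?nnegrE ?mulr_ge0 ?powR_ge0 ?(ltW t0).
rewrite -powRrM ler_powR ?ler1n // -r2 mulrCA -!mulrA ler_wpM2l ?(ltW t0) //.
by rewrite ler_wpM2l // (ltW (lt_trans ltr01 r1)).
Qed.

(** The weight is finite for [tau > 0] and is handled as a real number. *)
Definition rweight tau (r : R) : R := fine (expeR (Tfun sigma tau r)).

Lemma Tfun_fin_num tau r : 0 < tau -> 0 <= r -> Tfun sigma tau r \is a fin_num.
Proof.
rewrite /Tfun => t0; have [//|rn0 r0] := eqVneq r 0.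
have {r0 rn0}r0 : 0 < r by rewrite lt_neqAle eq_sym rn0.
have [C C0 hC] := expr_le_Mseq r t0.
rewrite fin_numE -ltNye -ltey; apply/andP; split.
  apply: (@lt_le_trans _ _ (ln (r ^+ 0 / M tau 0))%:E); first exact: ltNyr.
  by apply: ereal_sup_ubound; exists 0%N.
apply: (@le_lt_trans _ _ (ln C)%:E); last exact: ltry.
apply: ge_ereal_sup => _ [p _ <-]; rewrite lee_fin.
rewrite ler_ln ?posrE ?divr_gt0 ?exprn_gt0 ?Mseq_gt0 //.
by rewrite ler_pdivrMr ?Mseq_gt0.
Qed.

Lemma rweightE tau r : 0 < tau -> 0 <= r -> expeR (Tfun sigma tau r) = (rweight tau r)%:E.
Proof. by move=> t0 r0; rewrite /rweight -(fineK (Tfun_fin_num t0 r0)). Qed.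

Lemma rweight_gt0 tau r : 0 < tau -> 0 <= r -> 0 < rweight tau r.
Proof.
by move=> t0 r0; rewrite /rweight -(fineK (Tfun_fin_num t0 r0)) /= expR_gt0.
Qed.

Lemma expr_le_rweight tau r p : 0 < tau -> 0 <= r -> r ^+ p <= M tau p * rweight tau r.
Proof.
move=> t0 r0; have [->|rn0] := eqVneq r 0.
  have -> : rweight tau 0 = 1 by rewrite /rweight /Tfun eqxx /= expR0.
  rewrite mulr1; case: p => [|p]; first by rewrite expr0.
  by rewrite expr0n /= ltW // (Mseq_gt0 sigma tau p.+1).
have {rn0}rp : 0 < r by rewrite lt_neqAle eq_sym rn0.
rewrite mulrC -ler_pdivrMr ?Mseq_gt0 //.
rewrite -[leLHS]lnK ?posrE ?divr_gt0 ?exprn_gt0 ?Mseq_gt0 //.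
rewrite -lee_fin -rweightE // -[(expR _)%:E]/(expeR (ln (r ^+ p / M tau p))%:E).
rewrite lee_expeR /Tfun (gt_eqF rp).
by apply: ereal_sup_ubound; exists p.
Qed.

(** Together with [expr_le_rweight], this identifies the weight with the least [B]
    such that [r^p <= M_p B] for all [p]; all estimates on weights rest on these
    two facts. *)
Lemma rweight_le tau r B : 0 < tau -> 0 <= r ->
  (forall p, r ^+ p <= M tau p * B) -> rweight tau r <= B.
Proof.
move=> t0 r0 h; have B1 : 1 <= B by have := h 0%N; rewrite expr0 mul1r.
have B0 : 0 < B by exact: lt_le_trans B1.
rewrite -lee_fin -rweightE // -(lnK B0) -[(expR _)%:E]/(expeR (ln B)%:E) lee_expeR.
rewrite /Tfun; have [_|rn0] := eqVneq r 0; first by rewrite lee_fin ln_ge0.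
have {rn0}rp : 0 < r by rewrite lt_neqAle eq_sym rn0.
apply: ge_ereal_sup => _ [p _ <-]; rewrite lee_fin.
rewrite ler_ln ?posrE ?divr_gt0 ?exprn_gt0 ?Mseq_gt0 //.
by rewrite ler_pdivrMr ?Mseq_gt0 // mulrC.
Qed.

Lemma rweight_ge1 tau r : 0 < tau -> 0 <= r -> 1 <= rweight tau r.
Proof. by move=> t0 r0; have := expr_le_rweight 0 t0 r0; rewrite expr0 mul1r. Qed.

Lemma rweight_homo tau r r' : 0 < tau -> 0 <= r -> r <= r' -> rweight tau r <= rweight tau r'.
Proof.
move=> t0 r0 rr'; apply: rweight_le => // p.
apply: le_trans (expr_le_rweight p t0 (le_trans r0 rr')).
by apply: lerXn2r; rewrite // nnegrE (le_trans r0).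
Qed.

(** Multiplying by [r] amounts to shifting [p] in the supremum that defines the
    weight. *)
Lemma rweight_decay1 tau tau' : 0 < tau -> tau < tau' ->
  exists2 C : R, 0 < C & forall r, 0 <= r -> (1 + r) * rweight tau' r <= C * rweight tau r.
Proof.
move=> t0 tt'; have t'0 := lt_trans t0 tt'.
have [C C0 hC] := Mseq_shift t0 tt'.
exists (C + 1) => [|r r0]; first by rewrite addr_gt0.
have w0 := rweight_gt0 t0 r0.
have h1 : rweight tau' r <= rweight tau r.
  apply: rweight_le => // p; apply: le_trans (expr_le_rweight p t0 r0) _.
  by rewrite ler_pM2r // Mseq_homo // ltW.
rewrite mulrDl mul1r [leRHS]mulrDl mul1r addrC lerD //.
have [->|rn0] := eqVneq r 0.
  by rewrite mul0r mulr_ge0 ?(ltW C0) // ltW // rweight_gt0.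
have {rn0}rp : 0 < r by rewrite lt_neqAle eq_sym rn0.
rewrite -ler_pdivlMl //; apply: rweight_le => // p.
rewrite mulrCA ler_pdivlMl // -exprS.
apply: le_trans (expr_le_rweight p.+1 t0 r0) _.
by rewrite [leRHS]mulrCA mulrA ler_pM2r // hC.
Qed.

(** The interval from [tau] to [tau'] is cut in two at each step. *)
Lemma rweight_decay k tau tau' : 0 < tau -> tau < tau' ->
  exists2 C : R, 0 < C & forall r, 0 <= r -> (1 + r) ^+ k * rweight tau' r <= C * rweight tau r.
Proof.
elim: k tau tau' => [|k IH] tau tau' t0 tt'.
  have [C C0 hC] := rweight_decay1 t0 tt'; exists C => // r r0; rewrite expr0 mul1r.
  apply: le_trans (hC r r0); rewrite ler_peMl ?lerDl //.
  by rewrite ltW // rweight_gt0 // (lt_trans t0).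
have m1 : tau < (tau + tau') / 2 by rewrite midf_lt.
have m2 : (tau + tau') / 2 < tau' by rewrite midf_lt.
have [C C0 hC] := IH _ _ t0 m1.
have [D D0 hD] := rweight_decay1 (lt_trans t0 m1) m2.
exists (D * C) => [|r r0]; first by rewrite mulr_gt0.
rewrite exprSr -mulrA.
apply: le_trans (ler_wpM2l _ (hD r r0)) _; first by rewrite exprn_ge0 // addr_ge0.
by rewrite mulrCA -mulrA ler_pM2l // hC.
Qed.

End defining_sequence.

(** * Mixed derivatives and mean value estimates *)
Lemma continuous_dist (R : realType) (V : normedModType R) (f : V -> R) (x : V) (e : R) :
  {for x, continuous f} -> 0 < e ->
  exists2 d : R, 0 < d & forall y, `|x - y| < d -> `|f x - f y| < e.
Proof.
move=> /cvgrPdist_lt fc e0; have /nbhs_normP[d d0 hd] := fc e e0.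
by exists d => // y xy; exact: hd.
Qed.

Lemma mixed_difference_eq (R : realFieldType) (h A B a b c d : R) : h != 0 ->
  a - b - (c - d) = h * (h * A) -> a - c - (b - d) = h * (h * B) -> A = B.
Proof.
move=> h0 E1 E2; apply: (mulfI h0); apply: (mulfI h0).
by rewrite -E1 -E2; ring.
Qed.

Section directional_calculus.
Variables (R : realType) (n : nat).
Local Notation V := 'rV[R]_n.
Implicit Types (f : V -> R) (u v x y : V).

Lemma is_derive_line f v y (t : R) : derivable f (t *: v + y) v ->
  is_derive t 1 (fun t : R => f (t *: v + y)) ('D_v f (t *: v + y)).
Proof.
move=> df.
have E : (fun h : R => h^-1 *: (f (((h *: (1 : R) + t) : R) *: v + y) - f (t *: v + y))) =
    (fun h : R => h^-1 *: (f (h *: v + (t *: v + y)) - f (t *: v + y))).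
  by apply/funext => h; rewrite addrA -scalerDl /GRing.scale /= mulr1.
by split; rewrite /derivable /derive /= E.
Qed.

Lemma mean_value_line f v y (d : R) : 0 < d -> (forall x, derivable f x v) ->
  exists2 c, 0 < c < d & f (d *: v + y) - f y = d * 'D_v f (c *: v + y).
Proof.
move=> d0 df.
have dl (t : R) := is_derive_line (df (t *: v + y)).
have cont : {within `[0, d], continuous (fun t : R => f (t *: v + y))}.
  apply: continuous_subspaceT => t.
  by apply: differentiable_continuous; apply/derivable1_diffP; have [] := dl t.
have [c cd h] := MVT d0 (fun t _ => dl t) cont.
by exists c; [rewrite in_itv in cd|move: h; rewrite scale0r add0r subr0 mulrC].
Qed.

Lemma mean_value_ineq f v y (d K : R) : (forall x, derivable f x v) ->
  (forall t : R, (0 <= t <= d) || (d <= t <= 0) -> `|'D_v f (t *: v + y)| <= K) ->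
  `|f (d *: v + y) - f y| <= `|d| * K.
Proof.
move=> df h; have [d0|d0|->] := ltgtP d 0; last first.
- by rewrite scale0r add0r subrr !normr0 mul0r.
- have [c /andP[c0 cd] ->] := mean_value_line y d0 df.
  by rewrite normrM ler_wpM2l // h // (ltW c0) (ltW cd).
- have nd0 : 0 < - d by rewrite oppr_gt0.
  have [c /andP[c0 cd]] := mean_value_line (d *: v + y) nd0 df.
  rewrite addrA -scalerDl addNr scale0r add0r => e.
  rewrite -normrN opprB e normrM normrN ler_wpM2l // addrA -scalerDl h //.
  by apply/orP; right; rewrite lerDr (ltW c0) -lerBrDr sub0r (ltW cd).
Qed.

Lemma second_difference f u v x (h : R) : 0 < h ->
  (forall y, derivable f y u) -> (forall y, derivable ('D_u f) y v) ->
  exists a b : R, [/\ 0 < a < h, 0 < b < h &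
    f (h *: u + (h *: v + x)) - f (h *: u + x) - (f (h *: v + x) - f x) =
    h * (h * 'D_v ('D_u f) (b *: v + (a *: u + x)))].
Proof.
move=> h0 du duv.
have dg y : derivable (fun y => f (y + h *: v) - f y) y u.
  have E : (fun k : R => k^-1 *: (f (k *: u + y + h *: v) - f (k *: u + y) - (f (y + h *: v) - f y))) =
    (fun k : R => k^-1 *: (f (k *: u + (y + h *: v)) - f (y + h *: v)) - k^-1 *: (f (k *: u + y) - f y)).
    by apply/funext => k; rewrite -scalerBr addrA; congr (_ *: _); ring.
  by rewrite /derivable E; apply: is_cvgB; exact: du.
have Dg y : 'D_u (fun y => f (y + h *: v) - f y) y = 'D_u f (y + h *: v) - 'D_u f y.
  have E : (fun k : R => k^-1 *: (f (k *: u + y + h *: v) - f (k *: u + y) - (f (y + h *: v) - f y))) =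
    (fun k : R => k^-1 *: (f (k *: u + (y + h *: v)) - f (y + h *: v)) - k^-1 *: (f (k *: u + y) - f y)).
    by apply/funext => k; rewrite -scalerBr addrA; congr (_ *: _); ring.
  by rewrite /derive E limB //; exact: du.
have [a ah E1] := mean_value_line x h0 dg.
have [b bh E2] := mean_value_line (a *: u + x) h0 duv.
exists a, b; split=> //; move: E1; rewrite Dg [a *: u + x + _]addrC E2 => <-.
by rewrite /= -[h *: u + x + h *: v]addrA [x + h *: v]addrC.
Qed.

(** Schwarz's theorem: the second difference of [f] on a small parallelogram is
    [h^2] times a mixed derivative at a nearby point, for either order of
    derivation. *)
Lemma derive_commute f u v x :
  (forall y, derivable f y u) -> (forall y, derivable f y v) ->
  (forall y, derivable ('D_u f) y v) -> (forall y, derivable ('D_v f) y u) ->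
  {for x, continuous ('D_v ('D_u f))} -> {for x, continuous ('D_u ('D_v f))} ->
  'D_v ('D_u f) x = 'D_u ('D_v f) x.
Proof.
move=> du dv duv dvu c1 c2; apply/eqP; rewrite -subr_eq0 -normr_le0.
apply/ler_addgt0Pr => e e0; rewrite add0r.
have e2 : 0 < e / 2 by rewrite divr_gt0.
have [d1 d10 hd1] := continuous_dist c1 e2.
have [d2 d20 hd2] := continuous_dist c2 e2.
pose d := Num.min d1 d2; have d0 : 0 < d by rewrite lt_min d10.
pose h := d / (`|u| + `|v| + 1).
have k0 : 0 < `|u| + `|v| + 1 by rewrite ltr_wpDl ?addr_ge0.
have h0 : 0 < h by rewrite divr_gt0.
have near (a b : R) (w w' : V) : 0 < a < h -> 0 < b < h -> `|w| + `|w'| = `|u| + `|v| ->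
    `|x - (b *: w + (a *: w' + x))| < d.
  move=> /andP[a0 ah] /andP[b0 bh] ww.
  rewrite addrA opprD addrCA subrr addr0 normrN.
  apply: le_lt_trans (ler_normD _ _) _; rewrite !normrZ (gtr0_norm a0) (gtr0_norm b0).
  apply: (@le_lt_trans _ _ (h * (`|u| + `|v|))).
    by rewrite -ww mulrDr lerD // ler_wpM2r // ltW.
  rewrite /h mulrAC ltr_pdivrMr // ltr_pM2l // ltrDl //.
have [a [b [ah bh E1]]] := second_difference x h0 du duv.
have [a' [b' [a'h b'h E2]]] := second_difference x h0 dv dvu.
have EE : 'D_v ('D_u f) (b *: v + (a *: u + x)) = 'D_u ('D_v f) (b' *: u + (a' *: v + x)).
  have := E2; rewrite (addrCA (h *: v) (h *: u) x) => E3.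
  exact: mixed_difference_eq (lt0r_neq0 h0) E1 E3.
have d1d : d <= d1 by rewrite ge_min lexx.
have d2d : d <= d2 by rewrite ge_min lexx orbT.
have h1 := hd1 _ (lt_le_trans (near a b v u ah bh (addrC _ _)) d1d).
have h2 := hd2 _ (lt_le_trans (near a' b' u v a'h b'h erefl) d2d).
rewrite EE in h1.
apply: le_trans (ler_distD ('D_u ('D_v f) (b' *: u + (a' *: v + x))) _ _) _.
rewrite [leRHS]splitr; apply: lerD; first exact: ltW h1.
by rewrite distrC; exact: ltW h2.
Qed.

Lemma smooth_pderivs f s : smooth f -> smooth (pderivs s f).
Proof.
by move=> sf t; rewrite /pderivs -foldr_cat -/(pderivs (t ++ s) f); exact: sf.
Qed.

Lemma pderiv_commute f i j : smooth f -> pderiv i (pderiv j f) = pderiv j (pderiv i f).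
Proof.
move=> sf; apply/funext => x; apply: derive_commute.
- by move=> y; have [_] := sf [::]; apply.
- by move=> y; have [_] := sf [::]; apply.
- by move=> y; have [_] := sf [:: j]; apply.
- by move=> y; have [_] := sf [:: i]; apply.
- by have [c _] := sf [:: i; j]; exact: c.
- by have [c _] := sf [:: j; i]; exact: c.
Qed.

Lemma pderivs_insert f i s1 s2 : smooth f ->
  pderivs (s1 ++ i :: s2) f = pderiv i (pderivs (s1 ++ s2) f).
Proof.
move=> sf; elim: s1 => //= j s1 ->; rewrite pderiv_commute //.
exact: smooth_pderivs.
Qed.

(** Derivatives of multi-index order are taken in a fixed order of the
    coordinates, so that one more derivative has to be moved to its place. *)
Lemma pderivs_perm f s t : smooth f -> perm_eq s t -> pderivs s f = pderivs t f.
Proof.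
move=> sf; elim: s t => [|i s IH] t; first by rewrite perm_sym => /perm_nilP ->.
move=> st; have it : i \in t by rewrite -(perm_mem st) mem_head.
have [t1 [t2 tE]] : exists t1 t2, t = t1 ++ i :: t2.
  by case/splitPr: it => t1 t2; exists t1, t2.
rewrite tE pderivs_insert //= (IH (t1 ++ t2)) //.
by move: st; rewrite tE perm_sym -(cat1s i t2) perm_catCA /= perm_cons perm_sym.
Qed.

Definition mincr (b : {ffun 'I_n -> nat}) i : {ffun 'I_n -> nat} :=
  [ffun j => (b j + (j == i))%N].

Lemma count_mindex_seq (b : {ffun 'I_n -> nat}) j :
  count_mem j (mindex_seq b) = b j.
Proof.
rewrite /mindex_seq count_flatten sumnE !big_map.
rewrite [LHS](_ : _ = \sum_i count_mem j (nseq (b i) i))%N; last by rewrite [index_enum _]unlock.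
rewrite (bigD1 j) //=.
rewrite count_nseq /= eqxx mul1n big1 ?addn0 // => i ij.
by rewrite count_nseq /= (negbTE ij).
Qed.

Lemma mindex_seq_mincr b i : perm_eq (mindex_seq (mincr b i)) (i :: mindex_seq b).
Proof.
apply/allP => j _ /=; rewrite !count_mindex_seq ffunE.
by rewrite addnC (eq_sym i) eqxx.
Qed.

Lemma mabs_mincr b i : mabs (mincr b i) = (mabs b).+1.
Proof.
rewrite /mabs; under eq_bigr do rewrite ffunE.
rewrite big_split /= -addn1; congr (_ + _)%N.
by rewrite (bigD1 i) //= eqxx big1 ?addn0 // => j /negbTE ->.
Qed.

Lemma pderiv_mindex f b i : smooth f ->
  pderiv i (pderivs (mindex_seq b) f) = pderivs (mindex_seq (mincr b i)) f.
Proof. by move=> sf; rewrite (pderivs_perm sf (mindex_seq_mincr b i)). Qed.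

(** Going from [x] to [z] one coordinate at a time, with every coordinate moving
    away from [0], stays where the bound on the derivatives of [f] is assumed. For
    derivatives controlled by a radially increasing weight, the bound is then
    governed by the weight at [x]. *)
Lemma outward_increment f (x z : V) (d K : R) :
  (forall y i, derivable f y (delta_mx 0 i)) -> 0 <= d -> 0 <= K ->
  (forall i, `|z 0 i - x 0 i| <= d) ->
  (forall i, (0 <= x 0 i <= z 0 i) || (z 0 i <= x 0 i <= 0)) ->
  (forall y i, (forall j, `|x 0 j| <= `|y 0 j|) -> `|pderiv i f y| <= K) ->
  `|f z - f x| <= n%:R * (d * K).
Proof.
move=> df d0 K0 zx out fK.
pose w (l : seq 'I_n) : V := \row_i (if i \in l then z 0 i else x 0 i).
have step l : uniq l -> `|f (w l) - f x| <= (size l)%:R * (d * K).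
  elim: l => [_|i l IH /= /andP[il ul]].
    rewrite (_ : w [::] = x) ?subrr ?normr0 ?mul0r //.
    by apply/rowP => i; rewrite mxE.
  have wE : w (i :: l) = (z 0 i - x 0 i) *: delta_mx 0 i + w l.
    apply/rowP => j; rewrite !mxE inE eqxx /=.
    have [->|ji] := eqVneq j i; first by rewrite (negbTE il) mulr1 subrK.
    by rewrite mulr0 add0r.
  have inc : `|f (w (i :: l)) - f (w l)| <= d * K.
    rewrite wE; apply: (@le_trans _ _ (`|z 0 i - x 0 i| * K)); last by rewrite ler_wpM2r.
    apply: mean_value_ineq => [y|t ht]; first exact: df.
    apply: fK => j; rewrite !mxE eqxx /=.
    have [->|ji] := eqVneq j i; last first.
      rewrite mulr0 add0r; case: ifP => // _.
      by have /orP[/andP[a b]|/andP[a b]] := out j;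
        [rewrite !ger0_norm // (le_trans a)|rewrite !ler0_norm ?lerN2 // (le_trans a)].
    rewrite (negbTE il) mulr1.
    have /orP[/andP[a b]|/andP[a b]] := out i; have /orP[/andP[t1 t2]|/andP[t1 t2]] := ht.
    - by rewrite !ger0_norm ?addr_ge0 ?lerDr.
    - have t0 : t = 0 by apply/eqP; rewrite eq_le t2 (le_trans _ t1) // subr_ge0.
      by rewrite t0 add0r.
    - have t0 : t = 0 by apply/eqP; rewrite eq_le t1 (le_trans t2) // subr_le0.
      by rewrite t0 add0r.
    - by rewrite !ler0_norm ?lerN2 ?gerDr // -[leRHS](addr0 0) lerD.
  rewrite -[f (w (i :: l))](subrK (f (w l))) -addrA.
  apply: le_trans (ler_normD _ _) _.
  by rewrite /= -natr1 mulrDl mul1r [leLHS]addrC; apply: lerD => //; exact: IH.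
have := step (enum 'I_n) (enum_uniq _); rewrite size_enum_ord.
by rewrite (_ : w _ = z) //; apply/rowP => i; rewrite mxE mem_enum.
Qed.

End directional_calculus.

(** * Sums over multi-indices *)
Section product_sums.
Variable R : realType.

(** Finitely many multi-indices lie in a cube, over which the sum of the products
    is a product of sums. *)
Lemma sum_prod_le (I : finType) (a : nat -> R) (A : R) (l : seq {ffun I -> nat}) :
  (forall k, 0 <= a k) -> sumle a A -> uniq l ->
  \sum_(f <- l) \prod_i a (f i) <= A ^+ #|I|.
Proof.
move=> a0 aA ul; pose L := (\max_(f <- l) \max_i f i).+1.
have lL (f : {ffun I -> nat}) i : f \in l -> (f i < L)%N.
  move=> fl; rewrite /L ltnS; apply: leq_trans (leq_bigmax i) _.
  exact: (leq_bigmax_seq (F := fun f : {ffun I -> nat} => \max_i f i) f fl isT).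
pose emb (g : {ffun I -> 'I_L}) : {ffun I -> nat} := [ffun i => g i : nat].
have emb_inj : injective emb.
  by move=> g h /ffunP gh; apply/ffunP => i; apply: val_inj; have := gh i; rewrite !ffunE.
have P0 (f : {ffun I -> nat}) : 0 <= \prod_i a (f i) by exact: prodr_ge0.
apply: (@le_trans _ _ (\sum_(f <- [seq emb g | g <- index_enum {ffun I -> 'I_L}]) \prod_i a (f i))).
  apply: (ler_sum_subset P0 ul).
    by rewrite map_inj_uniq // index_enum_uniq.
  move=> f fl; apply/mapP; exists [ffun i => Ordinal (lL f i fl)].
    exact: mem_index_enum.
  by apply/ffunP => i; rewrite !ffunE.
rewrite big_map (eq_bigr (fun g : {ffun I -> 'I_L} => \prod_i a (g i))); last first.
  by move=> g _; apply: eq_bigr => i _; rewrite ffunE.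
rewrite -(bigA_distr_bigA (fun (i : I) (k : 'I_L) => a k)) prodr_const.
by apply: lerXn2r; rewrite ?nnegrE ?(sumle_ge0 aA) ?sumr_ge0.
Qed.

(** By comparison with the telescoping sequence [2 - 1 / n]. *)
Lemma sumle_inv_sqr : sumle (fun k => ((1 + k%:R : R)^-1) ^+ 2) 2.
Proof.
suff h n : \sum_(k < n.+1) ((1 + k%:R : R)^-1) ^+ 2 <= 2 - n.+1%:R^-1.
  by case=> [|n]; [rewrite big_ord0|apply: le_trans (h n) _; rewrite gerBl invr_ge0].
elim: n => [|n IH].
  by rewrite big_ord_recr big_ord0 /= add0r addr0 invr1 expr1n; lra.
rewrite big_ord_recr /=; apply: le_trans (lerD IH (lexx _)) _.
have n0 : 0 <= n%:R :> R by [].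
rewrite -[n.+2%:R]natr1 -[n.+1%:R]natr1; move: (n%:R) n0 => x x0.
rewrite -subr_ge0 [leRHS](_ : _ = ((x + 1) * (1 + (x + 1)) ^+ 2)^-1); last first.
  by field; rewrite !gt_eqF //; lra.
rewrite invr_ge0 mulr_ge0 ?sqr_ge0 //; lra.
Qed.

End product_sums.

(** * Square summable samplings of smooth functions *)
Section sampling.
Variables (R : realType) (n : nat) (sigma : R).
Hypothesis sigma_gt1 : 1 < sigma.
Local Notation M := (Mseq sigma).
Local Notation W := (rweight sigma).
Local Notation V := ('rV[R]_n -> R[i]).
Local Notation mindex := {ffun 'I_n -> nat}.
Implicit Types (phi : V) (x y z : 'rV[R]_n) (b : mindex).

Definition nrm tau phi : R := fine (Xnorm sigma tau phi).

Lemma euclid_norm_ge0 x : 0 <= euclid_norm x. Proof. exact: sqrtr_ge0. Qed.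

Lemma euclid_norm_coord x i : `|x 0 i| <= euclid_norm x.
Proof.
rewrite -sqrtr_sqr; apply: ler_wsqrtr.
by rewrite (bigD1 i) //= lerDl sumr_ge0 // => j _; exact: sqr_ge0.
Qed.

Lemma euclid_norm_homo x y : (forall i, `|x 0 i| <= `|y 0 i|) -> euclid_norm x <= euclid_norm y.
Proof.
move=> h; apply: ler_wsqrtr; apply: ler_sum => i _.
rewrite -(real_normK (num_real (x 0 i))) -(real_normK (num_real (y 0 i))).
by apply: lerXn2r; rewrite ?nnegrE ?h.
Qed.

Lemma weightE tau x : 0 < tau -> weight sigma tau x = (W tau (euclid_norm x))%:E.
Proof. by move=> t0; apply: rweightE => //; exact: euclid_norm_ge0. Qed.

Lemma nrm_ge0 tau phi : 0 <= nrm tau phi.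
Proof. exact/fine_ge0/Xnorm_ge0. Qed.

Lemma mderiv_le_nrm tau phi b x : 0 < tau -> (Xnorm sigma tau phi < +oo)%E ->
  W tau (euclid_norm x) * cabs (mderiv b phi x) <= M tau (mabs b) * nrm tau phi.
Proof.
move=> t0 fin.
have : ((W tau (euclid_norm x) * (cabs (mderiv b phi x) / M tau (mabs b)))%:E <= (nrm tau phi)%:E)%E.
  rewrite /nrm fineK ?ge0_fin_numE ?Xnorm_ge0 // EFinM -weightE //.
  by apply: ereal_sup_ubound; exists (b, x).
by rewrite lee_fin mulrA ler_pdivrMr ?Mseq_gt0 // [leRHS]mulrC.
Qed.

Lemma Xnorm_le tau phi (A : R) : 0 < tau ->
  (forall b x, W tau (euclid_norm x) * cabs (mderiv b phi x) <= M tau (mabs b) * A) ->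
  (Xnorm sigma tau phi <= A%:E)%E.
Proof.
move=> t0 h; apply: ge_ereal_sup => _ [[b x] _ <-].
by rewrite [_.1]/= [_.2]/= weightE // -EFinM lee_fin mulrA ler_pdivrMr ?Mseq_gt0 // [leRHS]mulrC.
Qed.

Lemma nrm_le tau phi (A : R) : 0 < tau ->
  (forall b x, W tau (euclid_norm x) * cabs (mderiv b phi x) <= M tau (mabs b) * A) ->
  nrm tau phi <= A.
Proof.
move=> t0 h; have hX := Xnorm_le t0 h.
rewrite -lee_fin /nrm fineK // ge0_fin_numE ?Xnorm_ge0 //.
exact: le_lt_trans hX (ltry _).
Qed.

Lemma MseqX (a : R) k p : M a p ^+ k = M (a * k%:R) p.
Proof.
elim: k => [|k IH]; last by rewrite exprS IH -MseqD -natr1 mulrDr mulr1 addrC.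
by rewrite expr0 mulr0; case: p => //= p; rewrite mul0r powRr0.
Qed.

(** Integers are enumerated with alternating signs, [0] occurring twice. *)
Definition zcode (k : nat) : R := (-1) ^+ odd k * (k./2)%:R.

Lemma normr_zcode k : `|zcode k| = (k./2)%:R.
Proof. by rewrite /zcode normrM normrX normrN1 expr1n mul1r normr_nat. Qed.

(** Rounding goes away from [0], where weights are larger. *)
Lemma zcode_outward (t : R) (m : nat) : (0 < m)%N -> exists k,
  `|zcode k / m%:R - t| <= m%:R^-1 /\
  ((0 <= t <= zcode k / m%:R) || (zcode k / m%:R <= t <= 0)).
Proof.
move=> m0; have mR : 0 < m%:R :> R by rewrite ltr0n.
have pos (s : R) : 0 <= s -> exists c : nat, s <= c%:R / m%:R /\ c%:R / m%:R - s <= m%:R^-1.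
  move=> s0; exists (Num.truncn (s * m%:R)).+1.
  have sm : 0 <= s * m%:R by rewrite mulr_ge0.
  have /andP[h1 h2] := truncn_itv sm.
  split; first by rewrite ler_pdivlMr // ltW.
  rewrite lerBlDr -[in leRHS](mulfK (lt0r_neq0 mR) s) -[X in _ <= X + _]mul1r -mulrDl.
  by rewrite ler_pM2r ?invr_gt0 // -natr1 addrC lerD2l.
have [t0|t0] := leP 0 t.
  have [c [h1 h2]] := pos t t0; exists c.*2.
  have -> : zcode c.*2 = c%:R by rewrite /zcode odd_double expr0 mul1r doubleK.
  by split; [rewrite ger0_norm // subr_ge0|apply/orP; left; apply/andP].
have [|c [h1 h2]] := pos (- t); first by rewrite oppr_ge0 ltW.
exists c.*2.+1.
have -> : zcode c.*2.+1 = - c%:R.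
  by rewrite /zcode /= odd_double /= expr1 mulN1r uphalf_double.
split; last by apply/orP; right; apply/andP; split; [rewrite mulNr lerNl|exact: ltW].
rewrite -normrN opprB mulNr opprK addrC ger0_norm; first by rewrite opprK in h2.
by rewrite -lerBlDr sub0r.
Qed.

Lemma zcode_growth (k m : nat) : (0 < m)%N ->
  1 + k%:R <= 2 * m%:R * (1 + `|zcode k / m%:R|) :> R.
Proof.
move=> m0; have mR : 0 < m%:R :> R by rewrite ltr0n.
rewrite normrM normr_zcode normfV normr_nat.
rewrite [leRHS](_ : _ = 2 * m%:R + 2 * (k./2)%:R); last by field; rewrite gt_eqF.
have m1 : 1 <= m%:R :> R by rewrite ler1n.
have : (k%:R : R) <= 1 + 2 * (k./2)%:R.
  rewrite -{1}[k]odd_double_half natrD -muln2 natrM mulrC lerD2r.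
  by rewrite -[leRHS]/(1%:R) ler_nat leq_b1.
lra.
Qed.

Section two_levels.
Variables tau tau' : R.
Hypotheses (tau_gt0 : 0 < tau) (tau_lt : tau < tau').

Let tau'_gt0 : 0 < tau'. Proof. exact: lt_trans tau_lt. Qed.

(** Derivatives of order [p] are sampled on a grid of step [1 / mesh p]; by
    [mesh_ge] this step is small enough for a variation bounded by derivatives
    of order [p + 1] to cost at most half of the norm. *)
Definition mesh p : nat := (Num.truncn (4 * n%:R * (M tau' p.+1 / M tau' p))).+1.

Lemma mesh_ge p : 4 * n%:R * M tau' p.+1 <= (mesh p)%:R * M tau' p.
Proof.
by rewrite -ler_pdivrMr ?Mseq_gt0 // ltW // -[X in X < _]mulrA /mesh truncnS_gt.
Qed.

(** Although the grid gets finer as [p] grows, [mesh p] is at most a multiple of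
    [M d p] for any [d > 0], which the gap between [tau] and [tau'] absorbs. *)
Lemma mesh_dominated : exists2 C : R, 0 < C & forall p,
  M tau p * ((mesh p)%:R * (1 + p%:R)) ^+ n <= C * M tau' p.
Proof.
(* Up to constants both [mesh p] and [1 + p] are at most [M d p], whence [2 n]
   increments [d]; adding [1] covers [n = 0]. *)
pose d := (tau' - tau) / (2 * n%:R + 1).
have n1 : 0 < 2 * n%:R + 1 :> R by rewrite ltr_wpDl ?mulr_ge0.
have d0 : 0 < d by rewrite divr_gt0 ?subr_gt0.
have [|C1 C10 h1] := Mseq_shift sigma_gt1 tau'_gt0 (_ : tau' < tau' + d); first by rewrite ltrDl.
have [C2 C20 h2] := expr_le_Mseq sigma_gt1 1 d0.
have [C3 C30 h3] := expr_le_Mseq sigma_gt1 2 d0.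
pose A := 4 * n%:R * C1 + C2.
have A0 : 0 < A by rewrite ltr_wpDl // !mulr_ge0 // ltW.
have hm p : (mesh p)%:R <= A * M d p.
  rewrite /mesh /A -natr1 [leRHS]mulrDl lerD //; last by have := h2 p; rewrite expr1n.
  have D0 : 0 <= 4 * n%:R * (M tau' p.+1 / M tau' p).
    by rewrite mulr_ge0 ?divr_ge0 ?mulr_ge0 // ltW // Mseq_gt0.
  have /andP[h _] := truncn_itv D0; apply: le_trans h _.
  rewrite -[leRHS]mulrA ler_wpM2l ?mulr_ge0 //.
  by rewrite ler_pdivrMr ?Mseq_gt0 // -mulrA -MseqD [d + _]addrC h1.
have hp p : 1 + p%:R <= C3 * M d p.
  apply: le_trans (h3 p); rewrite -natrX -(natrD _ 1) ler_nat add1n.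
  exact: ltn_expl.
clearbody A; exists ((A * C3) ^+ n) => [|p]; first by rewrite exprn_gt0 // mulr_gt0.
have M0 a : 0 < M a p by exact: Mseq_gt0.
apply: (@le_trans _ _ (M tau p * (A * C3 * M (d * 2%:R) p) ^+ n)).
  rewrite ler_pM2l //; apply: lerXn2r; rewrite ?nnegrE ?mulr_ge0 ?addr_ge0 ?(ltW (M0 _)) ?(ltW A0) ?(ltW C30) //.
  apply: (@le_trans _ _ ((A * M d p) * (C3 * M d p))).
    by apply: ler_pM => //; rewrite addr_ge0.
  by rewrite -MseqX expr2 mulrACA mulrA.
rewrite exprMn mulrCA ler_pM2l ?exprn_gt0 ?mulr_gt0 // MseqX -MseqD.
apply: Mseq_homo; rewrite -lerBrDl -mulrA -natrM natrM.
by rewrite /d mulrAC ler_pdivrMr // ler_pM2l ?subr_gt0 // lerDl.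
Qed.

(* For each coordinate, [false] carries the order of derivation and [true] the
   code of a grid point. *)
Local Notation index := {ffun 'I_n * bool -> nat}.

Definition sample_order (f : index) : mindex := [ffun i => f (i, false)].
Definition sample_point (f : index) : 'rV[R]_n :=
  \row_i (zcode (f (i, true)) / (mesh (mabs (sample_order f)))%:R).

(** The factor [2] makes up for the half of the norm that is lost when only grid
    points are considered. *)
Definition sample_scale (f : index) : R :=
  2 * W tau' (euclid_norm (sample_point f)) / M tau' (mabs (sample_order f)).

Definition sample (f : index) phi : R[i] :=
  (sample_scale f)%:C%C * mderiv (sample_order f) phi (sample_point f).

(** A bound on the norm of the form [sample f] for the level [tau]. *)
Definition sample_size (f : index) : R :=
  2 * W tau' (euclid_norm (sample_point f)) / W tau (euclid_norm (sample_point f)) *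
  (M tau (mabs (sample_order f)) / M tau' (mabs (sample_order f))).

Let W_gt0 t x : 0 < t -> 0 < W t (euclid_norm x).
Proof. by move=> t0; apply: rweight_gt0 => //; exact: euclid_norm_ge0. Qed.

Lemma sample_scale_ge0 f : 0 <= sample_scale f.
Proof. by rewrite divr_ge0 ?mulr_ge0 ?ltW ?W_gt0 ?Mseq_gt0. Qed.

Lemma sample_size_ge0 f : 0 <= sample_size f.
Proof.
rewrite mulr_ge0 ?divr_ge0 ?mulr_ge0 //; apply/ltW; do ?[exact: W_gt0|exact: Mseq_gt0].
Qed.

Lemma sample_le f phi : (Xnorm sigma tau phi < +oo)%E ->
  cabs (sample f phi) <= sample_size f * nrm tau phi.
Proof.
move=> fin; rewrite /sample cabsM cabsR ger0_norm ?sample_scale_ge0 //.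
have := mderiv_le_nrm (sample_order f) (sample_point f) tau_gt0 fin.
rewrite /sample_scale /sample_size.
set w := W tau _; set w' := W tau' _; set c := cabs _; set a := M tau _; set a' := M tau' _.
have w0 : 0 < w by exact: W_gt0.
have w'0 : 0 < w' by exact: W_gt0.
have a'0 : 0 < a' by exact: Mseq_gt0.
move: (nrm tau phi) => N h.
rewrite [leRHS](_ : _ = 2 * w' / a' * (a * N / w)); last by field; rewrite !gt_eqF.
rewrite ler_wpM2l ?divr_ge0 ?mulr_ge0 ?(ltW w'0) ?(ltW a'0) //.
by rewrite ler_pdivlMr // mulrC.
Qed.

Lemma sample_linear f c phi psi : csmooth phi -> csmooth psi ->
  sample f (c *: phi + psi) = c * sample f phi + sample f psi.
Proof.
move=> sp sq; rewrite /sample.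
have -> : mderiv (sample_order f) (c *: phi + psi) =
    c *: mderiv (sample_order f) phi + mderiv (sample_order f) psi.
  exact: cpderivs_lin.
rewrite [(_ + _) _](_ : _ = c * mderiv (sample_order f) phi (sample_point f) +
  mderiv (sample_order f) psi (sample_point f)) //.
by rewrite mulrDr mulrCA.
Qed.

(** Both gaps are used: the ratio of the weights beats the growth of the grid
    coordinates, and that of the sequences beats the fineness of the grid and
    the order of derivation. *)
Lemma sample_size_dominated : exists2 C : R, 0 < C & forall f,
  sample_size f <= C * \prod_i (1 + (f i)%:R)^-1.
Proof.
have [C C0 hC] := mesh_dominated.
have [D D0 hD] := rweight_decay sigma_gt1 n tau_gt0 tau_lt.
exists (2 * D * 2 ^+ n * C) => [|f]; first by rewrite !mulr_gt0 ?exprn_gt0.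
set p := mabs (sample_order f); set x := sample_point f.
have r0 := euclid_norm_ge0 x; set r := euclid_norm x in r0.
have P0 : 0 < \prod_i (1 + (f i)%:R) :> R by apply: prodr_gt0 => i _; rewrite ltr_pwDl.
have Ple : \prod_i (1 + (f i)%:R) <= (2 * (1 + r) * ((mesh p)%:R * (1 + p%:R))) ^+ n.
  rewrite (eq_bigr (fun i => 1 + (f (i.1, i.2))%:R)); last by case.
  rewrite -(pair_bigA _ (fun i c => 1 + (f (i, c))%:R)) /= -[X in _ ^+ X]card_ord -prodr_const.
  apply: ler_prod => i _; rewrite big_bool /= mulr_ge0 ?addr_ge0 //=.
  rewrite mulrA; apply: ler_pM; rewrite ?addr_ge0 //.
    apply: le_trans (zcode_growth (f (i, true)) (ltn0Sn _ : (0 < mesh p)%N)) _.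
    rewrite [leRHS]mulrAC ler_wpM2l ?mulr_ge0 // lerD2l.
    by have := euclid_norm_coord x i; rewrite mxE.
  rewrite lerD2l ler_nat /p /mabs (bigD1 i) //= ffunE; exact: leq_addr.
rewrite prodfV ler_pdivlMr //.
have w0 : 0 < W tau r by exact: rweight_gt0.
have w'0 : 0 < W tau' r by exact: rweight_gt0.
have a'0 : 0 < M tau' p by exact: Mseq_gt0.
have a0 : 0 < M tau p by exact: Mseq_gt0.
have m0 : 0 <= (mesh p)%:R * (1 + p%:R) :> R by rewrite mulr_ge0 ?addr_ge0.
apply: (@le_trans _ _ (sample_size f * (2 * (1 + r) * ((mesh p)%:R * (1 + p%:R))) ^+ n)).
  by rewrite ler_wpM2l // sample_size_ge0.
rewrite /sample_size -/p -/x -/r.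
have h1 := hD r r0; have h2 := hC p.
have r1 : 0 < (1 + r) ^+ n by rewrite exprn_gt0 // ltr_wpDr.
rewrite [(2 * (1 + r) * _) ^+ n]exprMn [(2 * (1 + r)) ^+ n]exprMn.
set u := (1 + r) ^+ n in h1 r1 *; set v := (_ * _) ^+ n in h2 *.
have -> : 2 * W tau' r / W tau r * (M tau p / M tau' p) * (2 ^+ n * u * v) =
   2 * 2 ^+ n * (u * W tau' r / W tau r) * (M tau p * v / M tau' p).
  by field; rewrite !gt_eqF.
have v0 : 0 <= v by rewrite exprn_ge0.
clearbody u v.
rewrite [leRHS](_ : _ = 2 * 2 ^+ n * D * C); last by ring.
apply: ler_pM.
- by rewrite !mulr_ge0 ?exprn_ge0 ?invr_ge0 ?(ltW r1) ?(ltW w0) ?(ltW w'0).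
- by rewrite divr_ge0 ?mulr_ge0 ?(ltW a0) ?(ltW a'0).
- by rewrite ler_pM2l ?mulr_gt0 ?exprn_gt0 // ler_pdivrMr.
- by rewrite ler_pdivrMr.
Qed.

Lemma sample_size_sumle : exists S, forall l : seq index, uniq l ->
  \sum_(f <- l) sample_size f ^+ 2 <= S.
Proof.
have [C C0 hC] := sample_size_dominated.
exists (C ^+ 2 * 2 ^+ #|{: 'I_n * bool}|) => l ul.
apply: (@le_trans _ _ (C ^+ 2 * \sum_(f <- l) \prod_i ((1 + (f i)%:R)^-1) ^+ 2)).
  rewrite mulr_sumr; apply: ler_sum => f _.
  rewrite prodrXl -exprMn; apply: lerXn2r; rewrite ?nnegrE ?sample_size_ge0 //.
  apply: mulr_ge0; first exact: ltW.
  apply: prodr_ge0 => i _.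
  by rewrite invr_ge0 addr_ge0.
rewrite ler_pM2l ?exprn_gt0 //.
apply: (@sum_prod_le R _ (fun k => ((1 + k%:R)^-1) ^+ 2)) => //.
exact: sumle_inv_sqr.
Qed.

(** A point [x] is compared with a grid point [z] further from the origin.
    The derivatives of next order bound the difference of the values by half of
    the norm, by the choice of the mesh. Since the norm is finite, this half can
    be moved to the left-hand side. *)
Lemma nrm_le_sample phi (A : R) : csmooth phi -> (Xnorm sigma tau' phi < +oo)%E ->
  (forall f, cabs (sample f phi) <= A) -> nrm tau' phi <= A.
Proof.
move=> [sr si] fin hA; set N := nrm tau' phi.
have N0 : 0 <= N by exact: nrm_ge0.
suff : N <= A / 2 + N / 2 by lra.
apply: nrm_le => // b x; set p := mabs b.
have a'0 : 0 < M tau' p by exact: Mseq_gt0.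
have /choice[k kP] : forall i, exists k : nat,
  `|zcode k / (mesh p)%:R - x 0 i| <= (mesh p)%:R^-1 /\
  ((0 <= x 0 i <= zcode k / (mesh p)%:R) || (zcode k / (mesh p)%:R <= x 0 i <= 0)).
  by move=> i; exact: zcode_outward.
pose f : index := [ffun ic => if ic.2 then k ic.1 else b ic.1].
have fb : sample_order f = b by apply/ffunP => i; rewrite !ffunE.
pose z := sample_point f.
have zE i : z 0 i = zcode (k i) / (mesh p)%:R by rewrite mxE ffunE fb.
have xz : euclid_norm x <= euclid_norm z.
  apply: euclid_norm_homo => i; rewrite zE; have [_ /orP[/andP[h1 h2]|/andP[h1 h2]]] := kP i.
    by rewrite !ger0_norm // (le_trans h1).
  by rewrite !ler0_norm ?lerN2 // (le_trans h1).
have wx0 : 0 < W tau' (euclid_norm x) by exact: W_gt0.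
have wxz : W tau' (euclid_norm x) <= W tau' (euclid_norm z).
  by apply: rweight_homo => //; exact: euclid_norm_ge0.
have hz : W tau' (euclid_norm x) * cabs (mderiv b phi z) <= A / 2 * M tau' p.
  have := hA f; rewrite /sample fb cabsM cabsR ger0_norm ?sample_scale_ge0 //.
  rewrite /sample_scale fb -/p -/z => h.
  rewrite -ler_pdivrMr // ler_pdivlMr //.
  apply: le_trans h.
  rewrite [leRHS](_ : _ = W tau' (euclid_norm z) * cabs (mderiv b phi z) / M tau' p * 2).
    by rewrite ler_pM2r // ler_pM2r ?invr_gt0 // ler_wpM2r // cabs_ge0.
  by move: (W _ _) (cabs _) (M _ _) => *; ring.
pose K := N * M tau' p.+1 / W tau' (euclid_norm x).
have K0 : 0 <= K by rewrite divr_ge0 ?(ltW wx0) // mulr_ge0 // ltW // Mseq_gt0.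
have hK y i : (forall j, `|x 0 j| <= `|y 0 j|) -> cabs (mderiv (mincr b i) phi y) <= K.
  move=> xy; have := mderiv_le_nrm (mincr b i) y tau'_gt0 fin.
  rewrite mabs_mincr -/p -/N => h; rewrite ler_pdivlMr // mulrC.
  apply: (@le_trans _ _ (W tau' (euclid_norm y) * cabs (mderiv (mincr b i) phi y))).
    rewrite ler_wpM2r ?cabs_ge0 //; apply: rweight_homo => //.
      exact: euclid_norm_ge0.
    exact: euclid_norm_homo.
  by rewrite [leRHS]mulrC.
have inc g (proj : R[i] -> R) : smooth g ->
    (forall w, `|proj w| <= cabs w) ->
    (forall b y, proj (mderiv b phi y) = pderivs (mindex_seq b) g y) ->
    `|proj (mderiv b phi z) - proj (mderiv b phi x)| <= n%:R * ((mesh p)%:R^-1 * K).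
  move=> sg pc pE; rewrite !pE; apply: outward_increment => //.
  - by move=> y i; have [_] := sg (mindex_seq b); apply.
  - by move=> i; rewrite zE; have [] := kP i.
  - by move=> i; rewrite zE; have [] := kP i.
  - move=> y i xy; rewrite pderiv_mindex // -pE.
    by apply: le_trans (pc _) _; exact: hK.
have incR := inc _ (@complex.Re R) sr (@cabs_Re R) (fun _ _ => erefl).
have incI := inc _ (@complex.Im R) si (@cabs_Im R) (fun _ _ => erefl).
have hd : cabs (mderiv b phi x) <= cabs (mderiv b phi z) + 2 * (n%:R * ((mesh p)%:R^-1 * K)).
  rewrite -[X in cabs X](subrK (mderiv b phi z)) addrC.
  apply: le_trans (cabsD _ _) _; rewrite lerD2l cabsB.
  (* The mean value estimate holds for real functions only; using it for the
     real and imaginary parts costs a factor [2], whence the [4] in [mesh]. *)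
  apply: le_trans (cabs_ReIm _) _; rewrite !raddfB /=.
  by rewrite mulr_natl mulr2n; exact: lerD.
apply: le_trans (ler_wpM2l (ltW wx0) hd) _; rewrite mulrDr mulrDr.
apply: lerD; first by rewrite [leRHS]mulrC.
have mp0 : 0 < (mesh p)%:R :> R by rewrite ltr0n.
rewrite [leLHS](_ : _ = (4 * n%:R * M tau' p.+1) * (N / 2 / (mesh p)%:R)); last first.
  by rewrite /K; field; rewrite !gt_eqF.
apply: (@le_trans _ _ ((mesh p)%:R * M tau' p * (N / 2 / (mesh p)%:R))).
  by rewrite ler_wpM2r ?mesh_ge // !divr_ge0.
by rewrite [leRHS](_ : _ = (mesh p)%:R * M tau' p * (N / 2 / (mesh p)%:R)) //; field; rewrite gt_eqF.
Qed.

End two_levels.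

Lemma Xnorm_anti tau tau' phi : 0 < tau -> tau <= tau' ->
  (Xnorm sigma tau phi < +oo)%E -> (Xnorm sigma tau' phi < +oo)%E /\ nrm tau' phi <= nrm tau phi.
Proof.
move=> t0 tt' fin; have t'0 := lt_le_trans t0 tt'.
have h b x : W tau' (euclid_norm x) * cabs (mderiv b phi x) <= M tau' (mabs b) * nrm tau phi.
  apply: (@le_trans _ _ (W tau (euclid_norm x) * cabs (mderiv b phi x))).
    rewrite ler_wpM2r ?cabs_ge0 // -lee_fin -!weightE //; exact: weight_anti.
  apply: le_trans (mderiv_le_nrm b x t0 fin) _.
  by rewrite ler_wpM2r ?nrm_ge0 // Mseq_homo.
split; last exact: nrm_le.
exact: le_lt_trans (Xnorm_le t'0 h) (ltry _).
Qed.

(** The inclusion of the level [tau] into the level [tau'] is of Hilbert-Schmidt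
    type. *)
Theorem sampling tau tau' : 0 < tau -> tau < tau' ->
  exists (G : nat -> V -> R[i]) (s : nat -> R) (S : R),
  [/\ forall j c phi psi, csmooth phi -> csmooth psi ->
        G j (c *: phi + psi) = c * G j phi + G j psi,
      forall j, 0 <= s j, sumle (fun j => s j ^+ 2) S,
      forall j phi, (Xnorm sigma tau phi < +oo)%E -> cabs (G j phi) <= s j * nrm tau phi &
      forall phi A, csmooth phi -> (Xnorm sigma tau phi < +oo)%E ->
        sumle (sq (G ^~ phi)) A -> nrm tau' phi ^+ 2 <= A].
Proof.
move=> t0 tt'; have [S hS] := sample_size_sumle t0 tt'.
pose G j phi : R[i] := oapp (fun f => sample tau' f phi) 0 (pickle_inv j).
pose s j : R := oapp (sample_size tau tau') 0 (pickle_inv j).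
exists G, s, S; split.
- move=> j c phi psi sp sq; rewrite /G; case: pickle_inv => [f|] /=.
    exact: sample_linear.
  by rewrite mulr0 addr0.
- by move=> j; rewrite /s; case: pickle_inv => [f|] //=; exact: sample_size_ge0.
- rewrite (_ : (fun j => _) = fun j => oapp (fun f => sample_size tau tau' f ^+ 2) 0 (pickle_inv j)).
    exact: sumle_pickle.
  by apply/funext => j; rewrite /s; case: pickle_inv => //=; rewrite expr0n.
- move=> j phi fin; rewrite /G /s; case: pickle_inv => [f|] /=.
    exact: sample_le.
  by rewrite mul0r -[leLHS]/(cabs (0 : R[i])) cabs0.
- move=> phi A sp fin hA; have A0 := sumle_ge0 hA.
  have [fin' _] := Xnorm_anti t0 (ltW tt') fin.
  rewrite -[leRHS]sqr_sqrtr //; apply: lerXn2r; rewrite ?nnegrE ?nrm_ge0 ?sqrtr_ge0 //.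
  apply: (nrm_le_sample t0 tt' sp fin') => f.
  rewrite -(@ler_pXn2r _ 2) ?nnegrE ?cabs_ge0 ?sqrtr_ge0 // [leRHS]sqr_sqrtr //.
  have := le_trans (le_term_rsum (pickle f) (sq_ge0 _) hA) (rsum_le (sq_ge0 _) hA).
  by rewrite /sq /G pickleK_inv.
Qed.

End sampling.

(** * Weights versus monomials *)
Section weights_versus_monomials.
Variables (R : realType) (n : nat) (sigma : R).
Hypothesis sigma_gt1 : 1 < sigma.
Local Notation M := (Mseq sigma).
Local Notation W := (rweight sigma).
Local Notation V := ('rV[R]_n -> R[i]).
Local Notation mindex := {ffun 'I_n -> nat}.
Implicit Types (phi : V) (x : 'rV[R]_n) (a b : mindex).

Lemma monom_le a x : `|monom a x| <= euclid_norm x ^+ mabs a.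
Proof.
rewrite /monom normr_prod /mabs expr_sum; apply: ler_prod => i _.
rewrite normr_ge0 normrX /=; apply: lerXn2r; rewrite ?nnegrE ?euclid_norm_ge0 //.
exact: euclid_norm_coord.
Qed.

Definition axis i p : mindex := [ffun j => if j == i then p else 0%N].

Lemma mabs_axis i p : mabs (axis i p) = p.
Proof.
rewrite /mabs (bigD1 i) //= ffunE eqxx big1 ?addn0 // => j ji.
by rewrite ffunE (negbTE ji).
Qed.

Lemma monom_axis i p x : monom (axis i p) x = x 0 i ^+ p.
Proof.
rewrite /monom (bigD1 i) //= ffunE eqxx big1 ?mulr1 // => j ji.
by rewrite ffunE (negbTE ji) expr0.
Qed.

Lemma euclid_norm_le_coord x (i0 : 'I_n) : exists i, euclid_norm x <= n%:R * `|x 0 i|.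
Proof.
case: (@Order.TotalTheory.arg_maxP _ _ _ i0 xpredT (fun i => `|x 0 i|)) => // i _ hi.
have n1 : 1 <= n%:R :> R by rewrite ler1n; case: (n) i0 => [[]|].
have n0 : 0 <= n%:R :> R by [].
exists i; rewrite -[leRHS]ger0_norm ?mulr_ge0 // -sqrtr_sqr; apply: ler_wsqrtr.
apply: (@le_trans _ _ (\sum_(j < n) `|x 0 i| ^+ 2)).
  apply: ler_sum => j _; rewrite -(real_normK (num_real (x 0 j))).
  by apply: lerXn2r; rewrite ?nnegrE //; exact: hi.
rewrite sumr_const card_ord -[leLHS]mulr_natl exprMn ler_wpM2r ?sqr_ge0 //.
by rewrite expr2 ler_peMr.
Qed.

Lemma bounded_MMP tau phi : bounded_MM sigma tau phi <->
  exists2 C : R, 0 < C & forall a b x,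
    `|monom a x| * cabs (mderiv b phi x) <= C * M tau (mabs a) * M tau (mabs b).
Proof.
split=> -[C C0 h]; exists C => // a b.
  move=> x; rewrite -lee_fin; apply: le_trans (h a b).
  apply: ereal_sup_ubound; exists x => //; congr (_%:E).
  by rewrite cabsM cabsR.
apply: ge_ereal_sup => _ [x _ <-]; rewrite lee_fin cabsM cabsR; exact: h.
Qed.

Lemma bounded_WM_real tau phi : 0 < tau -> bounded_WM sigma tau phi <->
  exists2 C : R, 0 < C & forall b x,
    W tau (euclid_norm x) * cabs (mderiv b phi x) <= C * M tau (mabs b).
Proof.
move=> t0; split=> -[C C0 h]; exists C => // b.
  move=> x; rewrite -lee_fin; apply: le_trans (h b).
  apply: ereal_sup_ubound; exists x => //.
  by rewrite weightE.
apply: ge_ereal_sup => _ [x _ <-]; rewrite weightE // -EFinM lee_fin; exact: h.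
Qed.

Lemma bounded_MM_of_WM tau phi : 0 < tau ->
  bounded_WM sigma tau phi -> bounded_MM sigma tau phi.
Proof.
move=> t0 /(bounded_WM_real _ t0)[C C0 h]; apply/bounded_MMP; exists C => // a b x.
have Ma : 0 < M tau (mabs a) by exact: Mseq_gt0.
apply: (@le_trans _ _ (M tau (mabs a) * W tau (euclid_norm x) * cabs (mderiv b phi x))).
  rewrite ler_wpM2r ?cabs_ge0 //; apply: le_trans (monom_le a x) _.
  by apply: expr_le_rweight => //; exact: euclid_norm_ge0.
rewrite -mulrA; apply: le_trans (ler_wpM2l (ltW Ma) (h b x)) _.
by rewrite mulrA [M tau (mabs a) * C]mulrC.
Qed.

(** Only the pure powers of a largest coordinate of [x] are needed. Passing from
    it to the Euclidean norm costs [n^p], which the increase of [tau] absorbs. *)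
Lemma bounded_WM_of_MM tau tau' phi : 0 < tau -> tau < tau' ->
  bounded_MM sigma tau phi -> bounded_WM sigma tau' phi.
Proof.
move=> t0 tt' /bounded_MMP[C C0 h]; have t'0 := lt_trans t0 tt'.
apply/(bounded_WM_real _ t'0).
have [|D D0 hD] := @expr_le_Mseq _ _ sigma_gt1 n%:R (tau' - tau).
  by rewrite subr_gt0.
exists (C * D + C) => [|b x]; first by rewrite addr_gt0 ?mulr_gt0.
set c := cabs _; have c_ge0 : 0 <= c by exact: cabs_ge0.
have Mb : 0 < M tau' (mabs b) by exact: Mseq_gt0.
have CD : 0 < C * D + C by rewrite addr_gt0 ?mulr_gt0.
have [c0|c0] := eqVneq c 0; first by rewrite c0 mulr0 mulr_ge0 // ltW.
have {c_ge0 c0} c0 : 0 < c by rewrite lt_neqAle eq_sym c0.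
rewrite -ler_pdivlMr //; apply: rweight_le => // [|p]; first exact: euclid_norm_ge0.
rewrite mulrA ler_pdivlMr // mulrCA mulrA.
apply: (@le_trans _ _ ((C * D + C) * M tau' p * M tau (mabs b))); last first.
  rewrite ler_pM2l ?mulr_gt0 ?Mseq_gt0 //; apply: Mseq_homo; exact: ltW.
have Mb0 : 0 < M tau (mabs b) by exact: Mseq_gt0.
have Mp0 : 0 < M tau' p by exact: Mseq_gt0.
case: p Mp0 => [|p] Mp0.
  have := h [ffun=> 0%N] b x; rewrite /monom big1 => [|i _]; last by rewrite ffunE expr0.
  have -> : mabs ([ffun=> 0%N] : mindex) = 0%N by rewrite /mabs big1 // => i _; rewrite ffunE.
  have M00 t : M t 0 = 1 by [].
  rewrite normr1 mul1r -/c M00 mulr1 => hx.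
  rewrite M00 mulr1; apply: le_trans hx _.
  by rewrite ler_pM2r // lerDr mulr_ge0 // ltW.
have [i0|no] := pselect (exists i0 : 'I_n, True); last first.
  have -> : euclid_norm x = 0.
    by rewrite /euclid_norm big1 ?sqrtr0 // => i _; case: no; exists i.
  by rewrite expr0n /= mul0r !mulr_ge0 // ltW.
case: i0 => i0 _; have [i hi] := euclid_norm_le_coord x i0.
have := h (axis i p.+1) b x; rewrite mabs_axis monom_axis normrX -/c => hx.
apply: (@le_trans _ _ (n%:R ^+ p.+1 * (`|x 0 i| ^+ p.+1 * c))).
  rewrite mulrA -exprMn ler_pM2r //; apply: lerXn2r => //.
    by rewrite nnegrE euclid_norm_ge0.
  by rewrite nnegrE mulr_ge0.
apply: le_trans (ler_wpM2l _ hx) _; first by rewrite exprn_ge0.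
rewrite !mulrA ler_pM2r //.
apply: (@le_trans _ _ (C * (D * M tau' p.+1))).
  have -> : M tau' p.+1 = M (tau' - tau) p.+1 * M tau p.+1 by rewrite -MseqD subrK.
  by rewrite (mulrA D) mulrA ler_pM2r ?Mseq_gt0 // mulrC ler_pM2l.
by rewrite mulrA ler_pM2r // lerDl ltW.
Qed.

Theorem SMM_roumieu_eq : SMM_roumieu n sigma = SWM_roumieu n sigma.
Proof.
apply/seteqP; split=> phi [sphi [tau t0 h]]; split=> //.
  by exists (tau + 1); [exact: addr_gt0|apply: bounded_WM_of_MM t0 _ h; rewrite ltrDl].
by exists tau => //; exact: bounded_MM_of_WM.
Qed.

Theorem SMM_beurling_eq : SMM_beurling n sigma = SWM_beurling n sigma.
Proof.
apply/seteqP; split=> phi [sphi h]; split=> // tau t0.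
  have t20 : 0 < tau / 2 by rewrite divr_gt0.
  apply: bounded_WM_of_MM t20 _ (h _ t20).
  by rewrite ltr_pdivrMr // ltr_pMr // ltr1n.
by apply: bounded_MM_of_WM => //; exact: h.
Qed.

End weights_versus_monomials.

(** * Nuclearity of the spaces *)
Section coefficient_gauge.
Variables (R : realType) (E : lmodType R[i]).
Variables (y : nat -> E -> R[i]) (b : nat -> R).
Hypothesis yL : forall j, lin_form (y j).
Hypothesis b0 : forall j, 0 <= b j.
Hypothesis yb : forall x, exists2 m : R, 0 <= m & forall j, cabs (y j x) <= m * b j.

(** The gauge is the least [m] with [|y j x| <= m (b j)] for all [j]. Any bound of
    that form, on any subspace, is a bound on this seminorm. *)
Lemma coefficient_gauge : exists g : seminorm E,
  (forall j x, cabs (y j x) <= complex.Re (g x) * b j) /\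
  forall x m, 0 <= m -> (forall j, cabs (y j x) <= m * b j) -> complex.Re (g x) <= m.
Proof.
pose A x := [set m : R | 0 <= m /\ forall j, cabs (y j x) <= m * b j].
pose f x := inf (A x).
have A0 x : A x !=set0 by have [m m0 h] := yb x; exists m.
have Ab x : has_lbound (A x) by exists 0 => m [].
have fle x m : 0 <= m -> (forall j, cabs (y j x) <= m * b j) -> f x <= m.
  by move=> m0 h; apply: ge_inf => //; split.
have f_ge0 x : 0 <= f x by apply: lb_le_inf => // m [].
have yf j x : cabs (y j x) <= f x * b j.
  have [bj0|bj0] := eqVneq (b j) 0.
    by have [m _ /(_ j)] := yb x; rewrite bj0 !mulr0.
  have bj : 0 < b j by rewrite lt_neqAle eq_sym bj0 b0.
  rewrite -ler_pdivrMr //; apply: lb_le_inf => // m [m0 /(_ j)].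
  by rewrite ler_pdivrMr.
have fD x z : f (x + z) <= f x + f z.
  apply: fle => [|j]; first exact: addr_ge0.
  rewrite (lin_formD (yL j)); apply: le_trans (cabsD _ _) _.
  by rewrite mulrDl lerD.
have fZle c x : f (c *: x) <= cabs c * f x.
  apply: fle => [|j]; first by rewrite mulr_ge0 ?cabs_ge0.
  by rewrite (lin_formZ (yL j)) cabsM -mulrA ler_wpM2l ?cabs_ge0.
have fZ c x : f (c *: x) = cabs c * f x.
  apply/eqP; rewrite eq_le fZle /=.
  have [->|c0] := eqVneq c 0; first by rewrite cabs0 mul0r.
  have ac : 0 < cabs c.
    by rewrite lt_neqAle cabs_ge0 andbT eq_sym; apply: contra_neq c0; exact: cabs_eq0.
  rewrite mulrC -ler_pdivlMr // mulrC.
  have -> : (cabs c)^-1 = cabs c^-1 by exact/esym/Normc.normcV.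
  by rewrite -{1}(scale1r x) -(mulVf c0) -scalerA.
have [g gE] := real_seminorm fD fZ.
by exists g; split=> [j x|x m]; rewrite gE; [exact: yf|exact: fle].
Qed.

End coefficient_gauge.

Section nuclear_criterion.
Variables (R : realType) (E : lmodType R[i]) (P : set (seminorm E)).
Local Notation K := (R[i] : numFieldType).
Variables (X : nat -> set E) (nm : nat -> E -> R).
Variables (G : nat -> nat -> E -> R[i]) (s : nat -> nat -> R) (S : nat -> R).
Hypothesis X0 : forall k, X k 0.
Hypothesis XL : forall k c x y, X k x -> X k y -> X k (c *: x + y).
Hypothesis XS : forall k, X k `<=` X k.+1.
Hypothesis Xcover : forall x, exists k, X k x.
Hypothesis nm_ge0 : forall k x, X k x -> 0 <= nm k x.
Hypothesis nmZ : forall k c x, X k x -> nm k (c *: x) = cabs c * nm k x.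
Hypothesis GL : forall k j, lin_form (G k j).
Hypothesis Gnm : forall k j x, X k x -> cabs (G k j x) <= s k j * nm k x.
Hypothesis s_ge0 : forall k j, 0 <= s k j.
Hypothesis sS : forall k, sumle (fun j => s k j ^+ 2) (S k).
Hypothesis nmG : forall k x M, X k x -> sumle (sq (G k ^~ x)) M ->
  nm k.+1 x ^+ 2 <= M.

(** Seminorms see the linear structure only, which [lcs P] shares with [E]. *)
Definition lcs_seminorm (q : seminorm E) : seminorm (lcs P) :=
  @Seminorm K (lcs P) (q : lcs P -> K) (seminormD q) (seminormZ q).

(** The dominating seminorm is the sum of [p] and of the gauge of the
    coefficients of an expansion with respect to [p]. *)
Lemma nuclear_domination (p : seminorm (lcs P)) :
  (forall k, exists2 C : R, 0 <= C & forall x, X k x -> complex.Re (p x) <= C * nm k x) ->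
  (forall q : seminorm E, (forall k, exists2 C : R, 0 <= C &
      forall x, X k x -> complex.Re (q x) <= C * nm k x) ->
    continuous (q : lcs P -> K)) ->
  exists q : seminorm (lcs P), [/\ continuous (q : lcs P -> K), forall x, p x <= q x &
    forall (Bq Bp : completeNormedModType K)
           (hq : {linear lcs P -> Bq}) (hp : {linear lcs P -> Bp}),
      is_completion q hq -> is_completion p hp ->
      exists2 T : {linear Bq -> Bp},
        forall x, T (hq x) = hp x & nuclear_map T].
Proof.
move=> pX qcont; have /choice[C hC] : forall k, exists C : R, 0 <= C /\
    forall x, X k x -> complex.Re (p x) <= C * nm k x.
  by move=> k; have [C C0 hC] := pX k; exists C.
have C0 k : 0 <= C k by have [] := hC k.
have pC k x : X k x -> complex.Re (p x) <= C k * nm k x by have [_] := hC k; apply.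
have [psi [y [b [D [yb yD b1 p1 ycv]]]]] := nuclear_expansion X0 XL XS Xcover nm_ge0 nmZ
  GL Gnm s_ge0 sS nmG (@seminormRD _ _ p) (@seminormRZ _ _ p) C0 pC.
have yL j : lin_form (y j) by have [] := yb j.
have b0 j : 0 <= b j by have [] := yb j.
have yD' k j x : X k x -> cabs (y j x) <= `|D k| * nm k x * b j.
  move=> Xx; apply: le_trans (yD k j x Xx) _; rewrite ler_wpM2r // ler_wpM2r ?nm_ge0 //.
  exact: ler_norm.
have [|g [yg gle]] := coefficient_gauge yL b0.
  move=> x; have [k Xx] := Xcover x; exists (`|D k| * nm k x) => [|j]; last exact: yD'.
  by rewrite mulr_ge0 // nm_ge0.
have [|c x|q qE] := @real_seminorm _ E (fun x => complex.Re (p x) + complex.Re (g x)).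
- move=> x z; rewrite addrACA; apply: lerD; exact: seminormRD.
- by rewrite (seminormRZ p) (seminormRZ g) mulrDr.
exists (lcs_seminorm q); split.
- apply: qcont => k; exists (C k + `|D k|) => [|x Xx]; first exact: addr_ge0.
  rewrite qE mulrDl; apply: lerD; first exact: pC.
  by apply: gle => [|j]; [rewrite mulr_ge0 // nm_ge0|exact: yD'].
- move=> x; rewrite -[lcs_seminorm q x]/(q x) [p x]seminormE [q x]seminormE lecR qE lerDl.
  exact: seminormR_ge0.
- move=> Bq Bp hq hp cq cp.
  apply: (@nuclear_of_expansion R (lcs P) p (lcs_seminorm q) psi y b yL b0 _ b1 p1 ycv Bq Bp hq hp cq cp).
  move=> j x; apply: le_trans (yg j x) _; rewrite mulrC ler_wpM2l //.
  rewrite -[lcs_seminorm q x]/(q x).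
  by rewrite qE lerDr; exact: seminormR_ge0.
Qed.

End nuclear_criterion.

Section nuclearity.
Variables (R : realType) (n : nat) (sigma : R).
Hypothesis sigma_gt1 : 1 < sigma.
Local Notation V := ('rV[R]_n -> R[i]).
Local Notation N := (@nrm R n sigma).
Local Notation finite tau phi := (Xnorm sigma tau phi < +oo)%E.
Implicit Types (phi psi : V).

Lemma nrmZ tau c phi : 0 < tau -> csmooth phi -> finite tau phi ->
  N tau (c *: phi) = cabs c * N tau phi.
Proof.
move=> t0.
have mz d f b x : csmooth f -> mderiv b (d *: f : V) x = d * mderiv b f x.
  move=> sf; have := cpderivs_lin d (mindex_seq b) sf (csmooth0 R n).
  rewrite cpderivs0 !addr0 => h; exact: (congr1 (fun g : V => g x) h).
have le d f : csmooth f -> finite tau f ->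
    finite tau (d *: f : V) /\ N tau (d *: f : V) <= cabs d * N tau f.
  move=> sf ff.
  have h b x : rweight sigma tau (euclid_norm x) * cabs (mderiv b (d *: f : V) x) <=
      Mseq sigma tau (mabs b) * (cabs d * N tau f).
    rewrite mz // cabsM mulrCA [leRHS]mulrCA ler_wpM2l ?cabs_ge0 //.
    exact: mderiv_le_nrm.
  split; last exact: nrm_le.
  exact: le_lt_trans (Xnorm_le sigma_gt1 t0 h) (ltry _).
move=> sf ff; apply/eqP; rewrite eq_le (le c phi sf ff).2 /=.
have [->|c0] := eqVneq c 0; first by rewrite cabs0 mul0r nrm_ge0.
have ac : 0 < cabs c.
  by rewrite lt_neqAle cabs_ge0 andbT eq_sym; apply: contra_neq c0; exact: cabs_eq0.
have scf : csmooth (c *: phi : V).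
  by have := csmooth_lin c sf (csmooth0 R n); rewrite addr0.
have [_] := le c^-1 (c *: phi) scf (le c phi sf ff).1.
rewrite scalerA mulVf // scale1r => h; apply: le_trans (ler_wpM2l (ltW ac) h) _.
by rewrite mulrA -cabsM mulfV // -[X in cabs X]/(1%:C%C) cabsR normr1 mul1r.
Qed.

Lemma mderiv0 phi x : mderiv [ffun=> 0%N] phi x = phi x.
Proof.
rewrite /mderiv /mindex_seq.
have -> : flatten [seq nseq ([ffun=> 0%N : nat] i) i | i <- enum 'I_n] = [::].
  by elim: (enum 'I_n) => //= i r ->; rewrite ffunE.
by rewrite /cpderivs /= /Rep /Imp; case: (phi x).
Qed.

Lemma nrm_separates tau phi : 0 < tau -> finite tau phi -> N tau phi = 0 -> phi = 0.
Proof.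
move=> t0 fin N0; apply/funext => x; apply: cabs_eq0; apply/eqP; rewrite eq_le cabs_ge0 andbT.
have := mderiv_le_nrm sigma_gt1 [ffun=> 0%N] x t0 fin; rewrite N0 mulr0 mderiv0.
by rewrite pmulr_rle0 ?rweight_gt0 ?euclid_norm_ge0.
Qed.

Lemma samplings (tau : nat -> R) : (forall k, 0 < tau k) -> (forall k, tau k < tau k.+1) ->
  exists (G : nat -> nat -> V -> R[i]) (s : nat -> nat -> R) (S : nat -> R), forall k,
  [/\ forall j c phi psi, csmooth phi -> csmooth psi ->
        G k j (c *: phi + psi) = c * G k j phi + G k j psi,
      forall j, 0 <= s k j, sumle (fun j => s k j ^+ 2) (S k),
      forall j phi, finite (tau k) phi -> cabs (G k j phi) <= s k j * N (tau k) phi &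
      forall phi A, csmooth phi -> finite (tau k) phi ->
        sumle (sq (G k ^~ phi)) A -> N (tau k.+1) phi ^+ 2 <= A].
Proof.
move=> t0 tS.
have /choice[G /choice[s /choice[S h]]] := fun k => @sampling R n sigma sigma_gt1 _ _ (t0 k) (tS k).
by exists G, s, S.
Qed.

Lemma finite_lin tau c phi psi : csmooth phi -> csmooth psi ->
  finite tau phi -> finite tau psi -> finite tau (c *: phi + psi)%R.
Proof.
move=> sf sg /bounded_WMP hf /bounded_WMP hg; apply/bounded_WMP.
exact: bounded_WM_lin.
Qed.

Lemma beurling_finite tau (phi : beurling n sigma) : 0 < tau -> finite tau (\val phi).
Proof. by move=> t0; have := beurling_fin_num phi t0; rewrite ge0_fin_numE ?Xnorm_ge0. Qed.

(** A continuous seminorm is bounded by the norm of one level [tau0]. The levels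
    [tau k] increase to [tau0] and stay below it, so that all their norms
    dominate it and are continuous themselves. *)
Theorem nuclear_beurling : nuclear_space (beurling_space n sigma).
Proof.
split.
  apply: lcs_hausdorff => phi phi0; exists (beurling_seminorm n sigma ltr01).
    by exists 1, ltr01.
  apply: contra_neq phi0 => /= h; apply: val_inj.
  by apply: (@nrm_separates 1) => //; exact: beurling_finite.
move=> p pc; have [l [lP pl]] := continuous_lcs_le pc.
have [tau0 [t00 [C C0 pC]]] : exists tau0, 0 < tau0 /\ exists2 C : R, 0 <= C &
    forall phi : beurling n sigma,
      \sum_(ge <- l) complex.Re (ge.1 phi) / ge.2 <= C * N tau0 (\val phi).
  elim: l lP {pl} => [_|[g e] l IH lP].
    by exists 1; split=> //; exists 0 => // phi; rewrite big_nil mul0r.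
  have [|t [t0 [C C0 hC]]] := IH; first by move=> ge gel; apply: lP; rewrite inE gel orbT.
  have [[u [u0 /= gE]] /= e0] := lP (g, e) (mem_head _ _).
  have m0 : 0 < Num.min t u by rewrite lt_min t0.
  exists (Num.min t u); split=> //; exists (e^-1 + C).
    by rewrite addr_ge0 // invr_ge0 ltW.
  move=> phi; rewrite big_cons /= mulrDl; apply: lerD.
    rewrite mulrC ler_wpM2l ?invr_ge0 ?(ltW e0) // gE /=.
    have [] := @Xnorm_anti _ _ _ sigma_gt1 (Num.min t u) u (\val phi) m0 _ (beurling_finite phi m0) => //.
    by rewrite ge_min lexx orbT.
  apply: le_trans (hC phi) _; rewrite ler_wpM2l //.
  have [] := @Xnorm_anti _ _ _ sigma_gt1 (Num.min t u) t (\val phi) m0 _ (beurling_finite phi m0) => //.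
  by rewrite ge_min lexx.
pose tau k : R := tau0 * (1 - 2^-1 ^+ k.+1).
have h1 k : (2^-1 : R) ^+ k.+1 < 1 by rewrite exprn_ilt1 // invf_lt1 // ltr1n.
have tau_gt0 k : 0 < tau k by rewrite mulr_gt0 // subr_gt0.
have tauS k : tau k < tau k.+1.
  rewrite ltr_pM2l // ltrD2l ltrN2 [ltLHS]exprS gtr_pMl ?exprn_gt0 //.
  by rewrite invf_lt1 // ltr1n.
have tau_le k : tau k <= tau0 by rewrite ger_pMr // gerBl exprn_ge0.
have [G [s [S GP]]] := samplings tau_gt0 tauS.
have fin k (phi : beurling n sigma) := beurling_finite phi (tau_gt0 k).
have sm (phi : beurling n sigma) := beurling_csmooth phi.
pose P := [set g : seminorm (beurling n sigma) |
  exists (t : R) (t0 : 0 < t), g = beurling_seminorm n sigma t0].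
pose nm k (phi : beurling n sigma) := N (tau k) (\val phi).
pose G' k j (phi : beurling n sigma) := G k j (\val phi).
apply: (@nuclear_domination R (beurling n sigma) P (fun=> setT) nm G' s S).
- by [].
- by [].
- by [].
- by move=> phi; exists 0%N.
- by move=> k phi _; exact: nrm_ge0.
- by move=> k c phi _; exact: nrmZ (sm phi) (fin k phi).
- by move=> k j c phi psi; have [GL _ _ _ _] := GP k; exact: GL (sm phi) (sm psi).
- by move=> k j phi _; have [_ _ _ Gn _] := GP k; exact: Gn.
- by move=> k j; have [_ s0 _ _ _] := GP k.
- by move=> k; have [_ _ sS _ _] := GP k.
- by move=> k phi A _; have [_ _ _ _ nG] := GP k; exact: nG.
- move=> k; exists C => // phi _; apply: le_trans (pl phi) (le_trans (pC phi) _).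
  rewrite ler_wpM2l //.
  by have [_] := Xnorm_anti sigma_gt1 (tau_gt0 k) (tau_le k) (fin k phi).
- move=> q hq; have [D D0 qD] := hq 0%N.
  apply: (@lcs_continuous_le _ _ _ q (beurling_seminorm n sigma (tau_gt0 0%N)) D).
    by exists (tau 0%N), (tau_gt0 0%N).
  by move=> phi; exact: qD.
Qed.

Lemma roumieu_csmooth (phi : roumieu n sigma) : csmooth (\val phi).
Proof. by have /set_mem[] := valP phi. Qed.

Lemma roumieu_finite (phi : roumieu n sigma) : exists2 tau, 0 < tau & finite tau (\val phi).
Proof. by have /set_mem[_ [tau t0 /bounded_WMP h]] := valP phi; exists tau. Qed.

(** The levels [1, 2, 3, ...] exhaust the space, and boundedness on each of them
    characterizes continuity for the inductive limit topology. *)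
Theorem nuclear_roumieu : nuclear_space (roumieu_space n sigma).
Proof.
have sm (phi : roumieu n sigma) := roumieu_csmooth phi.
split.
  apply: lcs_hausdorff => phi phi0.
  have [x phix] : exists x, (\val phi) x != 0.
    apply: contrapT => no; move/negP: phi0; apply; apply/eqP; apply: val_inj.
    apply/funext => x; apply: contrapT => h; apply: no; exists x; exact/eqP.
  have [|c psi|g gE] := @real_seminorm _ (roumieu n sigma) (fun psi : roumieu n sigma => cabs (\val psi x)).
  - by move=> u v; exact: cabsD.
  - by rewrite -cabsM.
  exists g; last first.
    by rewrite gE; apply: contra_neq phix; exact: cabs_eq0.
  move=> tau t0; exists 1 => psi [spsi fpsi].
  rewrite [g psi]seminormE lecR gE mul1r -[\val psi x]mderiv0.
  have r0 := euclid_norm_ge0 x.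
  have h := mderiv_le_nrm sigma_gt1 [ffun=> 0%N] x t0 fpsi.
  have m0 : mabs ([ffun=> 0%N] : {ffun 'I_n -> nat}) = 0%N.
    by rewrite /mabs big1 // => i _; rewrite ffunE.
  rewrite m0 [Mseq _ _ _]/= mul1r in h; apply: le_trans h.
  by rewrite ler_peMl ?cabs_ge0 // rweight_ge1.
move=> p pc; have [l [lP pl]] := continuous_lcs_le pc.
pose tau k : R := k.+1%:R.
have tau_gt0 k : 0 < tau k by rewrite ltr0n.
have tauS k : tau k < tau k.+1 by rewrite ltr_nat.
pose X k : set (roumieu n sigma) := [set phi | finite (tau k) (\val phi)].
have anti k t (phi : roumieu n sigma) : 0 < t -> t <= tau k -> finite t (\val phi) ->
    X k phi /\ N (tau k) (\val phi) <= N t (\val phi).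
  by move=> t0 tk ft; exact: Xnorm_anti.
have above (t : R) : exists k, t <= tau k.
  have [k hk] := nat_above t; exists k; apply: le_trans hk _.
  by rewrite ler_nat.
have [G [s [S GP]]] := samplings tau_gt0 tauS.
pose nm k (phi : roumieu n sigma) := N (tau k) (\val phi).
pose G' k j (phi : roumieu n sigma) := G k j (\val phi).
pose P := [set g : seminorm (roumieu n sigma) | forall t : R, 0 < t ->
  exists C : R, forall phi : roumieu n sigma, Xspace sigma t (\val phi) ->
    g phi <= (C * fine (Xnorm sigma t (\val phi)))%:C%C].
apply: (@nuclear_domination R (roumieu n sigma) P X nm G' s S).
- move=> k; rewrite /X; apply: (@le_lt_trans _ _ 0%E) (ltry _).
  by rewrite le_eqVlt; apply/orP; left; apply/eqP; exact: Xnorm0.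
- by move=> k c phi psi Xphi Xpsi; exact: finite_lin (sm phi) (sm psi) Xphi Xpsi.
- move=> k phi Xphi; have [] // := anti k.+1 (tau k) phi (tau_gt0 k) _ Xphi.
  exact: ltW.
- move=> phi; have [t t0 ft] := roumieu_finite phi; have [k tk] := above t.
  by exists k; have [] := anti k t phi t0 tk ft.
- by move=> k phi _; exact: nrm_ge0.
- by move=> k c phi Xphi; exact: nrmZ (sm phi) Xphi.
- by move=> k j c phi psi; have [GL _ _ _ _] := GP k; exact: GL (sm phi) (sm psi).
- by move=> k j phi Xphi; have [_ _ _ Gn _] := GP k; exact: Gn.
- by move=> k j; have [_ s0 _ _ _] := GP k.
- by move=> k; have [_ _ sS _ _] := GP k.
- by move=> k phi A Xphi; have [_ _ _ _ nG] := GP k; exact: nG (sm phi) Xphi.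
- move=> k.
  have [C C0 hC] : exists2 C : R, 0 <= C & forall phi : roumieu n sigma, X k phi ->
      \sum_(ge <- l) complex.Re (ge.1 phi) / ge.2 <= C * N (tau k) (\val phi).
    elim: l lP {pl} => [_|[g e] l IH lP].
      by exists 0 => // phi _; rewrite big_nil mul0r.
    have [|C C0 hC] := IH; first by move=> ge gel; apply: lP; rewrite inE gel orbT.
    have [/= gP e0] := lP (g, e) (mem_head _ _).
    have [D hD] := gP (tau k) (tau_gt0 k).
    exists (e^-1 * `|D| + C).
      by rewrite addr_ge0 // mulr_ge0 // invr_ge0 ltW.
    move=> phi Xphi; rewrite big_cons /= mulrDl; apply: lerD; last exact: hC.
    rewrite mulrC -mulrA ler_wpM2l ?invr_ge0 ?(ltW e0) //.
    have := hD phi (conj (sm phi) Xphi); rewrite [g phi]seminormE lecR => /le_trans; apply.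
    by rewrite ler_wpM2r ?nrm_ge0 // ler_norm.
  by exists C => // phi Xphi; exact: le_trans (pl phi) (hC phi Xphi).
- move=> q hq; apply: (@lcs_continuous_le _ _ _ q q 1); last by move=> phi; rewrite mul1r.
  move=> t t0; have [k tk] := above t; have [C C0 qC] := hq k.
  exists C => phi [_ ft]; rewrite [q phi]seminormE lecR.
  have [Xphi le] := anti k t phi t0 tk ft.
  by apply: le_trans (qC phi Xphi) _; rewrite ler_wpM2l.
Qed.

End nuclearity.

Theorem theorem3p7 (R : realType) (n : nat) (sigma : R) (sigma_gt1 : 1 < sigma) :
  (SMM_roumieu n sigma = SWM_roumieu n sigma /\
   nuclear_space (roumieu_space n sigma)) /\
  (SMM_beurling n sigma = SWM_beurling n sigma /\
   nuclear_space (beurling_space n sigma)).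
Proof.
split; split.
- exact: SMM_roumieu_eq.
- exact: nuclear_roumieu.
- exact: SMM_beurling_eq.
- exact: nuclear_beurling.
Qed.
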